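(* Let $n\ge1$ be a natural number (even or odd) and put $$k_n:=i\,(-1)^{\frac{n-1}{2}}\,2^n\,\pi^{\frac{n+1}{2}}\,\Gamma\!\left(\tfrac{n+1}{2}\right).$$ (1) Let $s\in\mathbb{R}$ and, for $x\in\mathbb{R}^{n+1}$, $x\ne s$, let $\mathcal{F}_n(s,x)=\gamma_n(s-\bar x)(s^2-2x_0s+|x|^2)^{-\frac{n+1}{2}}$. The Fourier transform of $\mathcal{F}_n(s,x)$ with respect to $x$, in the sense of tempered distributions, is $$\widehat{\mathcal{F}_n}(s,\xi)=k_n\,\frac{\bar\xi}{\xi_0^2+|\underline{\xi}|^2}\;e^{-is\xi_0},\qquad \xi=\xi_0+\underline{\xi}\neq0.$$ (2) For each such $\xi$ the term $e^{-is_0\xi_0}$, $s_0\in\mathbb{R}$, extends to the intrinsic entire slice monogenic function $s\mapsto e^{-is\xi_0}$ of the paravector $s=s_0+\underline{s}\in\mathbb{R}^{n+1}$. Correspondingly, the Fourier transforms of the kernels $\mathcal{F}^L_n$ and $\mathcal{F}^R_n$ extend from real $s$ to $s\in\mathbb{R}^{n+1}$ as $$\mathrm{F}[\mathcal{F}^L_n(s,\cdot)](\xi)=k_n\,\frac{\bar\xi}{\xi_0^2+|\underline{\xi}|^2}\;e^{-is\xi_0},\qquad \mathrm{F}[\mathcal{F}^R_n(s,\cdot)](\xi)=k_n\,e^{-is\xi_0}\,\frac{\bar\xi}{\xi_0^2+|\underline{\xi}|^2},\qquad \xi\neq0,$$ where the extension $\mathrm{F}[\mathcal{F}^L_n(s,\cdot)](\xi)$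 is right slice monogenic in $s$ and the extension $\mathrm{F}[\mathcal{F}^R_n(s,\cdot)](\xi)$ is left slice monogenic in $s$.
   Context: $\mathbb{R}_n$ denotes the real Clifford algebra over $n$ imaginary units $e_1,\dots,e_n$ with $e_\ell e_m+e_me_\ell=0$ for $\ell\neq m$ and $e_\ell^2=-1$. A point $(x_0,\dots,x_n)\in\mathbb{R}^{n+1}$ is identified with the paravector $x=x_0+\underline{x}$, $\underline{x}=\sum_{\ell=1}^n x_\ell e_\ell$; $\bar x=x_0-\underline{x}$, $|x|^2=\sum_{\ell=0}^n x_\ell^2$; likewise $\xi=\xi_0+\underline{\xi}$, $\bar\xi=\xi_0-\underline{\xi}$. The symbol $i$ is the complex imaginary unit, commuting with all $e_\ell$; values are taken in the complexified Clifford algebra $\mathbb{C}\otimes\mathbb{R}_n$. $\mathbb{S}=\{\underline{x}: |\underline{x}|=1\}$, so $I^2=-1$ for $I\in\mathbb{S}$; $[x]=\{x_0+I|\underline{x}|: I\in\mathbb{S}\}$. Constants: $\gamma_n:=(-1)^{\frac{n-1}{2}}2^{n-1}\left[\Gamma\left(\frac{n+1}{2}\right)\right]^2$, where $(-1)^{\frac{n-1}{2}}=i^{\,n-1}$. $F_n$-kernels: for $s\notin[x]$, $\mathcal{F}^L_n(s,x):=\gamma_n(s-\bar x)(s^2-2x_0s+|x|^2)^{-\frac{n+1}{2}}$ and $\mathcal{F}^R_n(s,x):=\gamma_n(s^2-2x_0s+|x|^2)^{-\frac{n+1}{2}}(s-\bar x)$; for $n$ even the power is the fractional power $y^\alpha=e^{\alpha(\ln|y|+I_y\arg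 y)}$ of a paravector $y=u+I_yv\notin(-\infty,0]$, with $I_y=\underline{y}/|\underline{y}|$, $v=|\underline{y}|$ and $\arg y=\arccos(u/|y|)$ (and $\arg y=0$ when $y>0$ is real). For real $s$ the two kernels coincide and are denoted $\mathcal{F}_n(s,x)$. Fourier transform: for $f\in\mathcal{S}(\mathbb{R}^{n+1})$, $\hat f(\xi)=\mathrm{F}[f](\xi)=\int_{\mathbb{R}^{n+1}}f(x)e^{-i(x,\xi)}dx$ with $(x,\xi)=\sum_{j=0}^n x_j\xi_j$. In the distributional sense, a locally integrable function $G$ is the Fourier transform of $g$ if $\int g(x)\,\mathrm{F}[\varphi](x)\,dx=\int G(\xi)\varphi(\xi)\,d\xi$ for all $\varphi\in\mathcal{S}(\mathbb{R}^{n+1})$. For a nonreal paravector $s$, $\mathrm{F}[\mathcal{F}^L_n(s,\cdot)](\xi)$ and $\mathrm{F}[\mathcal{F}^R_n(s,\cdot)](\xi)$ denote, for fixed $\xi$, the right, respectively left, slice monogenic extensions in $s$ of the function $\widehat{\mathcal{F}_n}(s,\xi)$ obtained for real $s$. Slice monogenic functions: let $U\subseteq\mathbb{R}^{n+1}$ be open and axially symmetric (i.e. $[x]\subset U$ for all $x\in U$), and $\mathcal{U}=\{(u,v)\in\mathbb{R}^2: u+\mathbb{S}v\subset U\}$. A function $f$ on $U$ is left (resp. right) slice monogenic if $f(u+Iv)=f_0(u,v)+If_1(u,v)$ (resp. $f_0(u,v)+f_1(u,v)I$) for all $u+Iv\in U$, $I\in\mathbb{S}$, where $f_0,f_1$ are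 Clifford-algebra-valued $C^1$ functions on $\mathcal{U}$ with $f_0(u,-v)=f_0(u,v)$, $f_1(u,-v)=-f_1(u,v)$, satisfying $\partial_uf_0-\partial_vf_1=0$ and $\partial_vf_0+\partial_uf_1=0$. Here values are allowed in $\mathbb{C}\otimes\mathbb{R}_n$. Such an $f$ is called intrinsic if $f_0,f_1$ are scalar-valued (real-valued for $\mathbb{R}_n$-valued functions; complex-valued here, because of the presence of $i$), and entire if $U=\mathbb{R}^{n+1}$. *)

(* Defs.v *)
From HB Require Import structures.
From mathcomp Require Import all_boot all_order all_algebra.
From mathcomp Require Import all_classical all_reals all_analysis.
From mathcomp Require Import complex ring lra.
Set Implicit Arguments.
Unset Strict Implicit.
Unset Printing Implicit Defensive.
Import Order.TTheory GRing.Theory Num.Theory numFieldNormedType.Exports.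
Local Open Scope classical_set_scope.
Local Open Scope ring_scope.
Local Open Scope complex_scope.

Definition symd n (A B : {set 'I_n}) : {set 'I_n} := (A :\: B) :|: (B :\: A).

Lemma in_symd n (A B : {set 'I_n}) i : (i \in symd A B) = (i \in A) (+) (i \in B).
Proof. by rewrite !inE; case: (i \in A); case: (i \in B). Qed.

Lemma symdC n : commutative (@symd n).
Proof. by move=> A B; apply/setP => i; rewrite !in_symd addbC. Qed.
Lemma symdA n : associative (@symd n).
Proof. by move=> A B C; apply/setP => i; rewrite !in_symd addbA. Qed.
Lemma symdK n (A : {set 'I_n}) : involutive (symd A).
Proof. by move=> B; apply/setP => i; rewrite !in_symd addKb. Qed.
Lemma symd0 n (A : {set 'I_n}) : symd A finset.set0 = A.
Proof. by apply/setP => i; rewrite in_symd inE addbF. Qed.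
Lemma sym0d n (A : {set 'I_n}) : symd finset.set0 A = A.
Proof. by rewrite symdC symd0. Qed.

Section Clifford.
Variables (K : comNzRingType) (n : nat).

(* e_A e_B = cliff_sign A B e_(A symd B): one factor -1 for each swap of e_i and
   e_j with i in A, j in B, j < i, and one for each square e_i ^ 2 = -1. *)
Definition cliff_sign (A B : {set 'I_n}) : K :=
  \prod_(i in A) \prod_(j in B | (j <= i)%N) -1.

Lemma cliff_sign0l B : cliff_sign finset.set0 B = 1.
Proof. by rewrite /cliff_sign big_set0. Qed.

Lemma cliff_sign0r A : cliff_sign A finset.set0 = 1.
Proof. by rewrite /cliff_sign big1 // => i _; rewrite big1 // => j; rewrite inE. Qed.

Lemma prod_symd (F : 'I_n -> K) A B : (forall i, F i * F i = 1) ->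
  \prod_(i in symd A B) F i = (\prod_(i in A) F i) * \prod_(i in B) F i.
Proof.
move=> FF; rewrite big_mkcond [X in _ = X * _]big_mkcond [X in _ = _ * X]big_mkcond.
rewrite -big_split /=; apply: eq_bigr => i _; rewrite in_symd.
by case: (i \in A); case: (i \in B) => /=; rewrite ?mulr1 ?mul1r ?FF.
Qed.

Lemma cliff_signDl A B C :
  cliff_sign (symd A B) C = cliff_sign A C * cliff_sign B C.
Proof.
rewrite /cliff_sign prod_symd // => i; rewrite prodr_const -expr2 -exprM mulnC exprM.
by rewrite sqrrN !expr1n.
Qed.

Lemma cliff_signDr A B C :
  cliff_sign A (symd B C) = cliff_sign A B * cliff_sign A C.
Proof.
rewrite /cliff_sign -big_split /=; apply: eq_bigr => i _.
rewrite ![\prod_(j in _ | _) _]big_mkcondr /=.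
by rewrite prod_symd // => j; case: ifP => _; rewrite ?mulrNN mulr1.
Qed.

(* The Clifford algebra over K, as the free module on the products e_A of the
   generators taken in increasing order; cliff R[i] n is C (x) R_n. *)
Definition cliff := {ffun {set 'I_n} -> K}.
HB.instance Definition _ := GRing.Lmodule.copy cliff {ffun {set 'I_n} -> K^o}.

Implicit Types a b c : cliff.

Definition cliff_one : cliff := [ffun A => (A == finset.set0)%:R].
Definition cliff_mul a b : cliff :=
  [ffun C => \sum_A cliff_sign A (symd A C) * a A * b (symd A C)].

Fact cliff_mulA : associative cliff_mul.
Proof.
move=> a b c; apply/ffunP => D; rewrite !ffunE.
under eq_bigr do rewrite !ffunE mulr_sumr.
under [RHS]eq_bigr do rewrite !ffunE mulr_sumr mulr_suml.
rewrite [RHS]exchange_big /=; apply: eq_bigr => A _.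
rewrite [RHS](reindex_inj (inv_inj (symdK A))) /=; apply: eq_bigr => B _.
rewrite symdK -symdA cliff_signDl.
have -> : symd A (symd B D) = symd B (symd A D).
  by rewrite !symdA (symdC A).
rewrite -{1}(symdK B (symd A D)) cliff_signDr.
by rewrite [cliff_sign B _ * _ * _]mulrAC; ring.
Qed.
Fact cliff_mul1l : left_id cliff_one cliff_mul.
Proof.
move=> a; apply/ffunP => C; rewrite ffunE (bigD1 finset.set0) //= big1.
  by rewrite ffunE eqxx sym0d cliff_sign0l !mul1r addr0.
by move=> A /negbTE A0; rewrite ffunE A0 mulr0 mul0r.
Qed.
Fact cliff_mul1r : right_id cliff_one cliff_mul.
Proof.
move=> a; apply/ffunP => C; rewrite ffunE (bigD1 C) //= big1.
  have -> : symd C C = finset.set0 by apply/setP => i; rewrite in_symd addbb inE.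
  by rewrite ffunE eqxx cliff_sign0r mul1r mulr1 addr0.
move=> A AC; rewrite ffunE; case: eqP => [|_]; last by rewrite mulr0.
move=> E; case/eqP: AC; have := symdK A C; rewrite E.
by rewrite symd0.
Qed.
Fact cliff_mulDl : left_distributive cliff_mul +%R.
Proof.
move=> a b c; apply/ffunP => C; rewrite !ffunE -big_split /=.
by apply: eq_bigr => A _; rewrite !ffunE mulrDr mulrDl.
Qed.
Fact cliff_mulDr : right_distributive cliff_mul +%R.
Proof.
move=> a b c; apply/ffunP => C; rewrite !ffunE -big_split /=.
by apply: eq_bigr => A _; rewrite !ffunE mulrDr.
Qed.
Fact cliff_one_neq0 : cliff_one != 0.
Proof.
by apply/eqP => /ffunP /(_ finset.set0) /eqP; rewrite !ffunE eqxx oner_eq0.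
Qed.
HB.instance Definition _ := GRing.Zmodule_isNzRing.Build cliff
  cliff_mulA cliff_mul1l cliff_mul1r cliff_mulDl cliff_mulDr cliff_one_neq0.

Fact cliff_scaleAl (k : K) a b : k *: (a * b) = (k *: a) * b.
Proof.
apply/ffunP => C; rewrite !ffunE /GRing.scale /= mulr_sumr.
by apply: eq_bigr => A _; rewrite !ffunE /GRing.scale /=; ring.
Qed.
HB.instance Definition _ := GRing.Lmodule_isLalgebra.Build K cliff cliff_scaleAl.
Fact cliff_scaleAr (k : K) a b : k *: (a * b) = a * (k *: b).
Proof.
apply/ffunP => C; rewrite !ffunE /GRing.scale /= mulr_sumr.
by apply: eq_bigr => A _; rewrite !ffunE /GRing.scale /=; ring.
Qed.
HB.instance Definition _ := GRing.Lalgebra_isAlgebra.Build K cliff cliff_scaleAr.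

Definition cliff_basis (A : {set 'I_n}) : cliff := [ffun B => (B == A)%:R].
Definition cliff_gen (l : 'I_n) : cliff := cliff_basis [set l].

End Clifford.

Section CliffordRel.
Variables (K : comNzRingType) (n : nat).

Lemma cliff_basisM (A B : {set 'I_n}) :
  cliff_basis K A * cliff_basis K B =
  cliff_sign K A B *: cliff_basis K (symd A B).
Proof.
apply/ffunP => C; rewrite [LHS]ffunE [RHS]ffunE /GRing.scale /= (bigD1 A) //= big1.
  rewrite addr0 !ffunE eqxx mulr1.
  rewrite (can2_eq (symdK A) (symdK A)).
  by case: eqP => [->|_]; rewrite ?symdK ?mulr0.
by move=> D /negbTE DA; rewrite ffunE DA mulr0 mul0r.
Qed.

Lemma cliff_sign1 (l m : 'I_n) :
  cliff_sign K [set l] [set m] = if (m <= l)%N then -1 else 1.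
Proof. by rewrite /cliff_sign big_set1 big_mkcondr big_set1. Qed.

Lemma cliff_genM (l m : 'I_n) : l != m ->
  cliff_gen K l * cliff_gen K m + cliff_gen K m * cliff_gen K l = 0.
Proof.
move=> lm; rewrite !cliff_basisM !cliff_sign1 (symdC [set m]%SET) -scalerDl.
have : (l : nat) != m by [].
by case: ltngtP => // _ _; rewrite ?subrr ?addNr ?addrN scale0r.
Qed.

Lemma cliff_gen_sqr (l : 'I_n) : cliff_gen K l ^+ 2 = -1.
Proof.
rewrite expr2 cliff_basisM cliff_sign1 leqnn scaleN1r.
congr (- _); apply/ffunP => A; rewrite !ffunE; congr (_ == _)%:R.
by apply/setP => i; rewrite in_symd addbb inE.
Qed.

End CliffordRel.

Section LebesgueTuple.
Variable R : realType.
Local Notation RM := (measurableTypeR R).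

Definition tcons m (p : RM * m.-tuple RM) : m.+1.-tuple RM :=
  [tuple of p.1 :: p.2].

Lemma measurable_tcons m : measurable_fun [set: RM * m.-tuple RM] (@tcons m).
Proof. exact: measurable_cons. Qed.

Section step.
Variables (m : nat) (mu : {sigma_finite_measure set (m.-tuple RM) -> \bar R}).

Definition lebesgue_step : set (m.+1.-tuple RM) -> \bar R :=
  pushforward (@lebesgue_measure R \x mu)%E (@tcons m).

Let lebesgue_step0 : lebesgue_step set0 = 0%E.
Proof. by rewrite /lebesgue_step /pushforward preimage_set0 measure0. Qed.

Let lebesgue_step_ge0 A : (0 <= lebesgue_step A)%E.
Proof.
rewrite /lebesgue_step /pushforward; apply: measure_ge0. Qed.

Let lebesgue_step_sigma_additive : semi_sigma_additive lebesgue_step.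
Proof.
move=> F mF tF mUF; rewrite /lebesgue_step /pushforward preimage_bigcup.
apply: measure_semi_sigma_additive.
- by move=> k; rewrite -[X in measurable X]setTI; exact: measurable_tcons.
- apply/trivIsetP => /= i j _ _ ij; rewrite -preimage_setI.
  by move/trivIsetP : tF => /(_ _ _ _ _ ij) ->//; rewrite preimage_set0.
- by rewrite -preimage_bigcup -[X in measurable X]setTI; exact: measurable_tcons.
Qed.

HB.instance Definition _ := isMeasure.Build _ _ _ lebesgue_step
  lebesgue_step0 lebesgue_step_ge0 lebesgue_step_sigma_additive.

Let lebesgue_step_sigma_finite : sigma_finite setT lebesgue_step.
Proof.
have /sigma_finiteP[F [TF ndF Foo]] := @sigma_finiteT _ _ _ (@lebesgue_measure R).
have /sigma_finiteP[G [TG ndG Goo]] := sigma_finiteT mu.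
pose g (t : m.+1.-tuple RM) : RM * m.-tuple RM := (thead t, [tuple of behead t]).
have mg : measurable_fun setT g.
  apply/measurable_fun_pair => /=; first exact: (measurable_tnth ord0).
  exact: measurable_behead.
exists (fun k => g @^-1` (F k `*` G k)).
  apply/seteqP; split=> // t _.
  have [i _ Fi] : (\bigcup_i F i) (g t).1 by rewrite -TF.
  have [j _ Gj] : (\bigcup_i G i) (g t).2 by rewrite -TG.
  exists (maxn i j) => //; split => /=.
    by move: Fi; apply/subsetPset/ndF/leq_maxl.
  by move: Gj; apply/subsetPset/ndG/leq_maxr.
move=> k; have [mFk Fkoo] := Foo k; have [mGk Gkoo] := Goo k; split.
  by rewrite -[X in measurable X]setTI; apply: mg => //; exact: measurableX.
rewrite /lebesgue_step /pushforward -comp_preimage.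
have -> : g \o @tcons m = id.
  by apply/funext => -[a t]; rewrite /g /tcons /=; congr pair; apply/val_inj.
by rewrite preimage_id product_measure1E// lte_mul_pinfty// ge0_fin_numE.
Qed.

HB.instance Definition _ := Measure_isSigmaFinite.Build _ _ _ lebesgue_step
  lebesgue_step_sigma_finite.
End step.

(* Lebesgue measure on R^m, as an iterated product measure. *)
Fixpoint lebesgue_tuple m : {sigma_finite_measure set (m.-tuple RM) -> \bar R} :=
  if m is k.+1 then lebesgue_step (lebesgue_tuple k) else \d_([tuple] : 0.-tuple RM).
End LebesgueTuple.

Section Paravectors.
Variables (R : realType) (n : nat).
Local Notation V := 'rV[R]_n.+1.
Local Notation Cl := (cliff R[i] n).

Definition enorm m (w : 'rV[R]_m) : R := Num.sqrt (\sum_j w ord0 j ^+ 2).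

Definition dotp m (x y : 'rV[R]_m) : R := \sum_j x ord0 j * y ord0 j.

Definition paravec (u : R) (w : 'rV[R]_n) : V :=
  \row_j oapp (w ord0) u (unlift ord0 j).
Definition spart (x : V) : R := x ord0 ord0.
Definition vpart (x : V) : 'rV[R]_n := \row_l x ord0 (lift ord0 l).
Definition pconj (x : V) : V := paravec (spart x) (- vpart x).

Definition pv (x : V) : Cl :=
  (spart x)%:C%:A + \sum_l (vpart x ord0 l)%:C *: cliff_gen R[i] l.

Definition real_pv (u : R) : V := paravec u 0.

Definition pinv (y : V) : V := (enorm y ^+ 2)^-1 *: pconj y.

Definition parg (y : V) : R := acos (spart y / enorm y).

(* For real y > 0 the argument is 0 and the vector part vanishes. *)
Definition ppow (y : V) (a : R) : V :=
  expR (a * ln (enorm y)) *: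
    paravec (cos (a * parg y)) ((sin (a * parg y) / enorm (vpart y)) *: vpart y).

End Paravectors.

Section Kernels.
Variables (R : realType) (n : nat).
Local Notation V := 'rV[R]_n.+1.
Local Notation Cl := (cliff R[i] n).

Definition Gamma (a : R) : R :=
  Rintegral (@lebesgue_measure R) `]0, +oo[ (fun t => t `^ (a - 1) * expR (- t)).

(* 'i ^+ n.-1 is (-1) ^ ((n - 1) / 2). *)
Definition gamma_n : R[i] :=
  'i ^+ n.-1 * (2 ^+ n.-1 * Gamma (n.+1%:R / 2) ^+ 2)%:C.

(* The paravector s ^ 2 - 2 x_0 s + |x| ^ 2, see pv_kernel_base. *)
Definition kernel_base (s x : V) : V :=
  paravec (spart s ^+ 2 - enorm (vpart s) ^+ 2
           - 2 * spart x * spart s + enorm x ^+ 2)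
          ((2 * spart s - 2 * spart x) *: vpart s).

Definition kernel_pow (y : V) : Cl :=
  if odd n then pv (pinv y) ^+ (n.+1)./2 else pv (ppow y (- (n.+1%:R / 2))).

Definition FL (s x : V) : Cl :=
  gamma_n *: ((pv s - pv (pconj x)) * kernel_pow (kernel_base s x)).

Definition FR (s x : V) : Cl :=
  gamma_n *: (kernel_pow (kernel_base s x) * (pv s - pv (pconj x))).

Definition Fn (s : R) (x : V) : Cl :=
  (gamma_n * ((s ^+ 2 - 2 * spart x * s + enorm x ^+ 2)
              `^ (- (n.+1%:R / 2)))%:C)
  *: (pv (real_pv n s) - pv (pconj x)).

End Kernels.

Section KernelTheory.
Variables (R : realType) (n : nat).
Local Notation V := 'rV[R]_n.+1.
Local Notation Cl := (cliff R[i] n).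

Lemma spart_paravec u (w : 'rV[R]_n) : spart (paravec u w) = u.
Proof. by rewrite /spart mxE unlift_none. Qed.

Lemma vpart_paravec u (w : 'rV[R]_n) : vpart (paravec u w) = w.
Proof. by apply/rowP => l; rewrite !mxE liftK. Qed.

Lemma cliff_vec_sqr (w : 'rV[R]_n) :
  (\sum_l (w ord0 l)%:C *: cliff_gen R[i] l) ^+ 2 =
  - ((enorm w ^+ 2)%:C)%:A :> Cl.
Proof.
set v := \sum_l _.
suff E : v ^+ 2 + v ^+ 2 = - ((enorm w ^+ 2)%:C *+ 2)%:A.
  apply: (@scalerI _ Cl (2 : R[i])); first by rewrite pnatr_eq0.
  by rewrite scaler_nat mulr2n E scalerN scalerA mulr_natl.
have vv : v ^+ 2 = \sum_l \sum_m ((w ord0 l)%:C * (w ord0 m)%:C) *: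
    (cliff_gen R[i] l * cliff_gen R[i] m).
  rewrite expr2 mulr_suml; apply: eq_bigr => l _; rewrite mulr_sumr.
  by apply: eq_bigr => m _; rewrite -scalerAl -scalerAr scalerA.
rewrite {1}vv vv [X in X + _]exchange_big /= -big_split /=.
rewrite /enorm sqr_sqrtr; last by apply: sumr_ge0 => j _; exact: sqr_ge0.
have -> : - ((\sum_j w ord0 j ^+ 2)%:C *+ 2)%:A =
    \sum_l (- ((w ord0 l ^+ 2)%:C *+ 2))%:A :> Cl.
  by rewrite -scaleNr -scaler_suml sumrN sumrMnl rmorph_sum.
apply: eq_bigr => l _; rewrite -big_split /= (bigD1 l) //= big1 ?addr0.
  by rewrite -(expr2 (cliff_gen _ l)) cliff_gen_sqr -scalerDl -mulr2n scalerN
    scaleNr rmorphXn expr2.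
move=> m ml; rewrite [X in _ + X *: _]mulrC -scalerDr.
by rewrite cliff_genM ?scaler0.
Qed.

Lemma cliff_scalarD_sqr (c : R) (v : Cl) :
  (c%:C%:A + v) ^+ 2 = (c%:C ^+ 2)%:A + (2 * c)%:C *: v + v ^+ 2.
Proof.
move: v => v; have -> : (2 * c)%:C = c%:C + c%:C by rewrite mulr_natl mulr2n rmorphD.
move: (c%:C) => d; rewrite !(expr2 (_ : Cl)) mulrDl !mulrDr.
rewrite -!scalerAl -!scalerAr !mul1r mulr1 scalerA -expr2.
by rewrite scalerDl !addrA.
Qed.

Lemma pv_kernel_base (s x : V) :
  pv (kernel_base s x) =
  pv s ^+ 2 - (2 * spart x)%:C *: pv s + ((enorm x ^+ 2)%:C)%:A.
Proof.
have := cliff_vec_sqr (vpart s).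
rewrite /kernel_base /pv spart_paravec vpart_paravec.
set v := \sum_l (vpart s ord0 l)%:C *: _ => vv.
have -> : \sum_l (((2 * spart s - 2 * spart x) *: vpart s) ord0 l)%:C *:
    cliff_gen R[i] l = (2 * spart s - 2 * spart x)%:C *: v.
  rewrite scaler_sumr; apply: eq_bigr => l _.
  by rewrite mxE rmorphM scalerA.
set a := spart s.
rewrite cliff_scalarD_sqr -rmorphXn.
have subC (p q : R) : (p - q)%:C%:A = p%:C%:A - q%:C%:A :> Cl.
  by rewrite rmorphB scalerBl.
have addC (p q : R) : (p + q)%:C%:A = p%:C%:A + q%:C%:A :> Cl.
  by rewrite rmorphD scalerDl.
have zmodE (Z : zmodType) (p q r t y z : Z) :
    p - q - r + t + (y - z) = p + y - q - (r + z) + t.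
  by rewrite opprD !addrA [LHS](ACl (1*5*2*3*6*4)).
rewrite vv addC !subC rmorphB scalerBl scalerDr scalerA -rmorphM.
exact: zmodE.
Qed.

Lemma enorm0 m : enorm (0 : 'rV[R]_m) = 0.
Proof.
by rewrite /enorm big1 ?sqrtr0 // => j _; rewrite mxE expr0n.
Qed.

Lemma enorm_sqr m (w : 'rV[R]_m) : enorm w ^+ 2 = \sum_j w ord0 j ^+ 2.
Proof.
by rewrite /enorm sqr_sqrtr //; apply: sumr_ge0 => j _; exact: sqr_ge0.
Qed.

Lemma enorm_para (x : V) : enorm x ^+ 2 = spart x ^+ 2 + enorm (vpart x) ^+ 2.
Proof.
rewrite !enorm_sqr big_ord_recl; congr (_ + _).
by apply: eq_bigr => j _; rewrite mxE.
Qed.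

Lemma enorm_real_pv (u : R) : enorm (real_pv n u) = `|u|.
Proof.
rewrite -sqrtr_sqr -[RHS]/(Num.sqrt _) -[enorm _]ger0_norm ?sqrtr_ge0//.
by rewrite -sqrtr_sqr enorm_para spart_paravec vpart_paravec enorm0 expr0n addr0.
Qed.

Lemma pv_real_pv (u : R) : pv (real_pv n u) = u%:C%:A.
Proof.
rewrite /pv spart_paravec vpart_paravec big1 ?addr0 // => l _.
by rewrite mxE scale0r.
Qed.

Lemma paravec_scale (c u : R) (w : 'rV[R]_n) :
  c *: paravec u w = paravec (c * u) (c *: w).
Proof.
by apply/rowP => j; rewrite !mxE; case: unliftP => [l|] _ /=; rewrite ?mxE.
Qed.

Lemma kernel_pow_real (b : R) : 0 < b ->
  kernel_pow (real_pv n b) = (b `^ (- (n.+1%:R / 2)))%:C%:A.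
Proof.
move=> b0; have bn0 : b != 0 by rewrite gt_eqF.
rewrite /kernel_pow; case: ifPn => on.
  have -> : pinv (real_pv n b) = real_pv n b^-1.
    rewrite /pinv /pconj enorm_real_pv spart_paravec vpart_paravec oppr0.
    by rewrite paravec_scale scaler0 gtr0_norm // expr2 invfM -mulrA mulVf ?mulr1.
  rewrite pv_real_pv powRN -(rmorphXn (in_alg Cl)) -rmorphXn exprVn /=.
  suff -> : n.+1%:R / 2 = (n.+1)./2%:R :> R by rewrite powR_mulrn ?ltW.
  rewrite -[in LHS](odd_double_half n.+1) /= on /= add0n -muln2 natrM mulfK //.
rewrite /ppow enorm_real_pv gtr0_norm // /parg enorm_real_pv gtr0_norm //.
rewrite spart_paravec divff // acos1 mulr0 cos0 sin0 mul0r scale0r.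
rewrite paravec_scale mulr1 scaler0 -/(real_pv _ _) pv_real_pv.
by rewrite /powR (negbTE bn0).
Qed.

Lemma kernel_base_real (s : R) (x : V) :
  kernel_base (real_pv n s) x =
  real_pv n (s ^+ 2 - 2 * spart x * s + enorm x ^+ 2).
Proof.
by rewrite /kernel_base spart_paravec vpart_paravec enorm0 expr0n subr0 scaler0.
Qed.

Lemma kernel_base_gt0 (s : R) (x : V) : x != real_pv n s ->
  0 < s ^+ 2 - 2 * spart x * s + enorm x ^+ 2.
Proof.
move=> xs; have -> : s ^+ 2 - 2 * spart x * s + enorm x ^+ 2 =
    enorm (x - real_pv n s) ^+ 2.
  rewrite !enorm_para.
  have -> : vpart (x - real_pv n s) = vpart x.
    by apply/rowP => l; rewrite !mxE liftK /= mxE subr0.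
  have -> : spart (x - real_pv n s) = spart x - s.
    by rewrite /spart !mxE unlift_none.
  by ring.
rewrite lt_neqAle sqr_ge0 andbT eq_sym sqrf_eq0.
apply: contraNneq xs => /(congr1 (fun t => t ^+ 2)).
rewrite enorm_sqr expr0n => /psumr_eq0P E.
rewrite -subr_eq0; apply/eqP/rowP => j; rewrite [RHS]mxE; apply/eqP.
by rewrite -sqrf_eq0 E // => k _; exact: sqr_ge0.
Qed.

Lemma FL_real (s : R) (x : V) : x != real_pv n s ->
  FL (real_pv n s) x = Fn s x.
Proof.
move=> xs; rewrite /FL /Fn kernel_base_real kernel_pow_real ?kernel_base_gt0//.
by rewrite -scalerAr mulr1 scalerA.
Qed.

Lemma FR_real (s : R) (x : V) : x != real_pv n s ->
  FR (real_pv n s) x = Fn s x.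
Proof.
move=> xs; rewrite /FR /Fn kernel_base_real kernel_pow_real ?kernel_base_gt0//.
by rewrite -scalerAl mul1r scalerA.
Qed.
End KernelTheory.

Section Exponentials.
Variables (R : realType) (n : nat).
Local Notation Cl := (cliff R[i] n).

Definition cexp (z : R[i]) : R[i] :=
  (expR (complex.Re z))%:C * (cos (complex.Im z) +i* sin (complex.Im z)).

Definition clim (u : nat -> R[i]) : R[i] :=
  limn (fun N => complex.Re (u N)) +i* limn (fun N => complex.Im (u N)).

Definition cliff_exp (a : Cl) : Cl :=
  [ffun A => clim (fun N => (\sum_(k < N) (k`!%:R)^-1 *: a ^+ k : Cl) A)].

End Exponentials.

Section Fourier.
Variables (R : realType) (m : nat).
Local Notation V := 'rV[R]_m.+1.

Definition row_of_tuple (t : m.+1.-tuple (measurableTypeR R)) : V :=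
  \row_j tnth t j.

Local Notation mu := (lebesgue_tuple R m.+1).

Definition rintegral (f : V -> R) : R := Rintegral mu setT (f \o row_of_tuple).

Definition rintegrable (f : V -> R) : Prop :=
  mu.-integrable setT (EFin \o f \o row_of_tuple).

Definition rlocally_integrable (f : V -> R) : Prop :=
  measurable_fun setT (f \o row_of_tuple) /\
  forall K : set V, compact K ->
    (\int[mu]_(t in row_of_tuple @^-1` K) `|f (row_of_tuple t)|%:E < +oo)%E.

Definition cintegral (f : V -> R[i]) : R[i] :=
  rintegral (fun x => complex.Re (f x)) +i* rintegral (fun x => complex.Im (f x)).

Definition pderiv (j : 'I_m.+1) (f : V -> R) : V -> R :=
  fun x => 'D_(delta_mx ord0 j) (f : V -> R^o) x.

(* l lists the directions of an iterated partial derivative. *)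
Definition rschwartz (f : V -> R) : Prop :=
  forall l : seq 'I_m.+1, let g := foldr pderiv f l in
    (forall x, differentiable (g : V -> R^o) x) /\
    forall k : nat, exists M : R, forall x, enorm x ^+ k * `|g x| <= M.

Definition schwartz (phi : V -> R[i]) : Prop :=
  rschwartz (fun x => complex.Re (phi x)) /\
  rschwartz (fun x => complex.Im (phi x)).

Definition fourier (phi : V -> R[i]) (xi : V) : R[i] :=
  cintegral (fun x => phi x * cexp (- 'i * (dotp x xi)%:C)).

Section CliffordValued.
Variable n : nat.
Local Notation Cl := (cliff R[i] n).

Definition cl_comps (P : (V -> R) -> Prop) (f : V -> Cl) : Prop :=
  forall A, P (fun x => complex.Re (f x A)) /\ P (fun x => complex.Im (f x A)).

Definition cl_integral (f : V -> Cl) : Cl :=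
  [ffun A => cintegral (fun x => f x A)].

(* G is the Fourier transform of g in the sense of tempered distributions; the
   integrability conditions are needed since integrals are total. *)
Definition is_fourier_transform (g G : V -> Cl) : Prop :=
  cl_comps rlocally_integrable G /\
  forall phi, schwartz phi ->
    [/\ cl_comps rintegrable (fun x => fourier phi x *: g x),
        cl_comps rintegrable (fun xi => phi xi *: G xi) &
        cl_integral (fun x => fourier phi x *: g x) =
        cl_integral (fun xi => phi xi *: G xi)].

End CliffordValued.
End Fourier.

Section SliceMonogenic.
Variables (R : realType) (n : nat).
Local Notation V := 'rV[R]_n.+1.
Local Notation Cl := (cliff R[i] n).
Local Notation P := (R^o * R^o)%type.

Definition unit_sphere : set 'rV[R]_n := [set I | enorm I = 1].

Definition axially_symmetric (U : set V) : Prop :=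
  forall x, U x -> forall I, unit_sphere I ->
    U (paravec (spart x) (enorm (vpart x) *: I)).

Definition slice_domain (U : set V) : set P :=
  [set p | forall I, unit_sphere I -> U (paravec p.1 (p.2 *: I))].

Definition rC1 (D : set P) (g : P -> R^o) : Prop :=
  [/\ forall p, D p -> differentiable g p,
      forall p, D p -> {for p, continuous (fun q => 'D_((1, 0) : P) g q)} &
      forall p, D p -> {for p, continuous (fun q => 'D_((0, 1) : P) g q)}].

Definition clC1 (D : set P) (f : P -> Cl) : Prop :=
  forall A, rC1 D (fun p => complex.Re (f p A)) /\
            rC1 D (fun p => complex.Im (f p A)).

Definition cl_deriv (d : P) (f : P -> Cl) (p : P) : Cl :=
  [ffun A => 'D_d (fun q => complex.Re (f q A) : R^o) p
             +i* 'D_d (fun q => complex.Im (f q A) : R^o) p].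

Definition slice_pair (D : set P) (f0 f1 : P -> Cl) : Prop :=
  [/\ clC1 D f0, clC1 D f1 &
      forall u v, D (u, v) ->
        [/\ f0 (u, - v) = f0 (u, v),
            f1 (u, - v) = - f1 (u, v),
            cl_deriv (1, 0) f0 (u, v) - cl_deriv (0, 1) f1 (u, v) = 0 &
            cl_deriv (0, 1) f0 (u, v) + cl_deriv (1, 0) f1 (u, v) = 0]].

Definition left_slice_monogenic (U : set V) (f : V -> Cl) : Prop :=
  [/\ open U, axially_symmetric U &
      exists f0 f1 : P -> Cl, slice_pair (slice_domain U) f0 f1 /\
        forall u v I, unit_sphere I -> U (paravec u (v *: I)) ->
          f (paravec u (v *: I)) = f0 (u, v) + pv (paravec 0 I) * f1 (u, v)].

Definition right_slice_monogenic (U : set V) (f : V -> Cl) : Prop :=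
  [/\ open U, axially_symmetric U &
      exists f0 f1 : P -> Cl, slice_pair (slice_domain U) f0 f1 /\
        forall u v I, unit_sphere I -> U (paravec u (v *: I)) ->
          f (paravec u (v *: I)) = f0 (u, v) + f1 (u, v) * pv (paravec 0 I)].

(* Scalars commute with I, so an intrinsic function is left and right slice
   monogenic. *)
Definition intrinsic_slice_monogenic (U : set V) (f : V -> Cl) : Prop :=
  [/\ open U, axially_symmetric U &
      exists g0 g1 : P -> R[i],
        slice_pair (slice_domain U) (fun p => (g0 p)%:A) (fun p => (g1 p)%:A) /\
        forall u v I, unit_sphere I -> U (paravec u (v *: I)) ->
          f (paravec u (v *: I)) =
            (g0 (u, v))%:A + pv (paravec 0 I) * (g1 (u, v))%:A].

Definition extends_from_reals (f0 : R -> Cl) (f : V -> Cl) : Prop :=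
  forall s : R, f (real_pv n s) = f0 s.

(* The function s |-> F[K(s, .)](xi) of the paravector s, for a kernel K whose
   Fourier transform for real s is Khat: the slice monogenic extension, on the
   side prescribed by monogenic, of s |-> Khat s xi. *)
Definition extended_fourier_transform
    (monogenic : set V -> (V -> Cl) -> Prop)
    (K : V -> V -> Cl) (Khat : R -> V -> Cl) (xi : V) (h : V -> Cl) : Prop :=
  [/\ forall s : R, is_fourier_transform (K (real_pv n s)) (Khat s),
      monogenic setT h & extends_from_reals (Khat ^~ xi) h].

End SliceMonogenic.

(* Main.v *)
Require Import Defs.
From HB Require Import structures.
From mathcomp Require Import all_boot all_order all_algebra.
From mathcomp Require Import all_classical all_reals all_analysis.
From mathcomp Require Import complex ring lra.
From mathcomp Require Import measurable_realfun.
Set Implicit Arguments.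
Unset Strict Implicit.
Unset Printing Implicit Defensive.
Import Order.TTheory GRing.Theory Num.Theory numFieldNormedType.Exports.
Local Open Scope classical_set_scope.
Local Open Scope ring_scope.
Local Open Scope complex_scope.

(** At a real point s the kernel base is |x - s|^2, so F_n(s, x) is a combination
    of the Riesz kernels y_j / |y|^(n+1), y = x - s, with constant coefficients in
    the Clifford algebra (Fn_riesz).  These kernels and their expected transforms
    are superpositions of Gaussian moments,
      Gamma((n+1)/2) y_j / |y|^(n+1) = int_0^oo t^((n-1)/2) y_j e^(- t |y|^2) dt,
      4 xi_j / |xi|^2 = int_0^oo t^(-2) xi_j e^(- |xi|^2 / (4 t)) dt,
    and for each t the two moments correspond under the Fourier transform, which is
    explicit for Gaussians (riesz_gaussian_fourier).  Fubini's theorem turns this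
    into the transform of the Riesz kernels (riesz_fourier); the shift by s produces
    e^(- i s xi_0).

    Neither side is integrable on the whole space, only against test functions.
    Schwartz functions and their Fourier transforms are dominated by the weight
    prod_j 1 / (1 + x_j^2) (rschwartz_bound, fourier_decay), and |y|^(- k), k <= n, is
    dominated by prod_j |y_j|^(- k / (n+1)); so every integrability statement
    reduces to products of one-variable functions (rintg_sing_bound).

    For a unit I, the elements (1 + i I) / 2 and (1 - i I) / 2 are complementary
    orthogonal idempotents, by which the exponential series at u + I v splits into
    two complex ones (cliff_exp_unit).  This gives the scalar pair
      e^(- i u xi_0) cosh(v xi_0),  - i e^(- i u xi_0) sinh(v xi_0),
    which satisfies the Cauchy-Riemann system.  A scalar pair remains a slice
    monogenic pair when it is multiplied by a constant of the algebra, and the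
    constant q(xi) stands left of I in the first extension and right of I in the
    second: hence right, respectively left, slice monogenicity.

    For uniqueness, the components of the difference of two extensions satisfy the
    Cauchy-Riemann system and vanish on the real axis, the odd ones by parity.
    They are only known to be of class C^1; that they vanish identically is proved
    by integrating F(z) e^(- N (z - w)^2) over the boundary of a rectangle with one
    side on the real axis and w on the opposite side, for N large (cr_strip_le0,
    cr_unique). *)

(** * Integration of real functions *)

Section RealIntegral.
Context d (T : measurableType d) (R : realType).
Variable mu : {measure set T -> \bar R}.
Implicit Types f g : T -> R.

Definition rint f : R := Rintegral mu setT f.
Definition rintg f : Prop := mu.-integrable setT (EFin \o f).

Lemma rintg_measurable f : rintg f -> measurable_fun setT f.
Proof. by move=> /measurable_int/measurable_EFinP. Qed.

Lemma rintg_dominated f g :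
  measurable_fun setT f -> rintg g -> (forall x, `|f x| <= g x) -> rintg f.
Proof.
move=> mf ig fg; apply: (le_integrable _ _ _ ig) => //.
  exact/measurable_EFinP.
by move=> x _ /=; rewrite lee_fin (le_trans (fg x)) ?ler_norm.
Qed.

Lemma rintgD f g : rintg f -> rintg g -> rintg (f \+ g).
Proof.
by move=> fi gi; exact: (integrableD measurableT fi gi).
Qed.

Lemma rintgZ (c : R) f : rintg f -> rintg (fun x => c * f x).
Proof.
by move=> fi; exact: (integrableZl measurableT c fi).
Qed.

Lemma rintgN f : rintg f -> rintg (fun x => - f x).
Proof.
move=> fi; rewrite (_ : (fun x => - f x) = (fun x => -1 * f x)).
  exact: rintgZ.
by apply/funext => x; rewrite mulN1r.
Qed.

Lemma rintgB f g : rintg f -> rintg g -> rintg (fun x => f x - g x).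
Proof. by move=> fi gi; apply: rintgD => //; exact: rintgN. Qed.

Lemma rintg0 : rintg (fun=> 0).
Proof. exact: integrable0. Qed.

Lemma rintD f g : rintg f -> rintg g -> rint (fun x => f x + g x) = rint f + rint g.
Proof. by move=> fi gi; rewrite /rint RintegralD. Qed.

Lemma rintB f g : rintg f -> rintg g -> rint (fun x => f x - g x) = rint f - rint g.
Proof. by move=> fi gi; rewrite /rint RintegralB. Qed.

Lemma rintZ (c : R) f : rintg f -> rint (fun x => c * f x) = c * rint f.
Proof. by move=> fi; rewrite /rint RintegralZl. Qed.

Lemma rint0 : rint (fun=> 0) = 0.
Proof. by rewrite /rint /Rintegral integral0. Qed.

Lemma rintN f : rintg f -> rint (fun x => - f x) = - rint f.
Proof.
move=> fi; rewrite -[in RHS]mulN1r -rintZ//.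
by congr rint; apply/funext => x; rewrite mulN1r.
Qed.

Lemma ler_norm_rint f g :
  measurable_fun setT f -> rintg g -> (forall x, `|f x| <= g x) ->
  `|rint f| <= rint g.
Proof.
move=> mf ig fg; have fi := rintg_dominated mf ig fg.
apply: (le_trans (le_normr_Rintegral measurableT fi)).
apply: le_Rintegral => //.
by apply: (rintg_dominated _ ig) => [|x]; rewrite ?normr_id//; exact: measurableT_comp.
Qed.

Lemma EFin_rint f : rintg f -> (rint f)%:E = (\int[mu]_x (f x)%:E)%E.
Proof. by move=> fi; rewrite /rint /Rintegral fineK// integrable_fin_num. Qed.

(** The inner integral in Fubini's theorem is finite only almost everywhere; fine
    replaces its infinite values by 0. *)
Lemma rintg_fine (F : T -> \bar R) : mu.-integrable setT F -> rintg (fine \o F).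
Proof.
move=> iF; apply: (le_integrable _ _ _ iF) => //.
  exact/measurable_EFinP/measurableT_comp/(measurable_int mu).
move=> x _ /=; case: (F x) => [r| |] //=; by rewrite normr0 leey.
Qed.

Lemma rint_fine (F : T -> \bar R) : mu.-integrable setT F ->
  rint (fine \o F) = fine (\int[mu]_x F x).
Proof.
move=> iF; congr fine; apply: ae_eq_integral => //.
- exact: measurable_int (rintg_fine iF).
- exact: measurable_int iF.
- have := @integrable_ae _ _ _ mu setT measurableT F iF.
  by apply: filterS => x /(_ I) Fx _ /=; rewrite fineK.
Qed.

End RealIntegral.

Section RealFubini.
Context d1 d2 (T1 : measurableType d1) (T2 : measurableType d2) (R : realType).
Variable m1 : {sigma_finite_measure set T1 -> \bar R}.
Variable m2 : {sigma_finite_measure set T2 -> \bar R}.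
Implicit Types h : T1 * T2 -> R.

Lemma rintg_fubini1 h : rintg (m1 \x m2)%E h ->
  rintg m1 (fun x => rint m2 (fun y => h (x, y))).
Proof. by move=> ih; exact: rintg_fine (integrable_fubini_F ih). Qed.

Lemma rint_fubini1 h : rintg (m1 \x m2)%E h ->
  rint m1 (fun x => rint m2 (fun y => h (x, y))) = rint (m1 \x m2)%E h.
Proof.
move=> ih; have := rint_fine (integrable_fubini_F ih).
by rewrite (integral12_prod_meas1 ih).
Qed.

Lemma integrable_fubini_G' h : rintg (m1 \x m2)%E h ->
  m2.-integrable setT (fun y => \int[m1]_x (h (x, y))%:E)%E.
Proof.
move=> ih; have mh := measurable_int _ ih.
apply/integrableP; split; first exact: (measurable_fubini_G ih).
have /(integrable21ltyP _ _ mh) := ih; apply: le_lt_trans.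
have mN : measurable_fun setT (fun z : T1 * T2 => `|(h z)%:E|%E).
  exact: measurableT_comp.
apply: ge0_le_integral => //.
- by apply: measurableT_comp => //; exact: (measurable_fubini_G ih).
- exact: (@measurable_fun_fubini_tonelli_G _ _ _ _ _ m1 (fun z => `|(h z)%:E|%E)).
- move=> y _; apply: le_abse_integral => //.
  by apply: measurableT_comp mh _; exact: pair2_measurable.
Qed.

Lemma rintg_fubini2 h : rintg (m1 \x m2)%E h ->
  rintg m2 (fun y => rint m1 (fun x => h (x, y))).
Proof. by move=> ih; exact: rintg_fine (integrable_fubini_G' ih). Qed.

Lemma rint_fubini2 h : rintg (m1 \x m2)%E h ->
  rint m2 (fun y => rint m1 (fun x => h (x, y))) = rint (m1 \x m2)%E h.
Proof.
move=> ih; rewrite [RHS](_ : _ = fine (\int[m2]_y \int[m1]_x (h (x, y))%:E)%E).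
  exact: rint_fine (integrable_fubini_G' ih).
by congr fine; exact/esym/(integral21_prod_meas1 ih).
Qed.

Lemma rint_fubini h : rintg (m1 \x m2)%E h ->
  rint m1 (fun x => rint m2 (fun y => h (x, y))) =
  rint m2 (fun y => rint m1 (fun x => h (x, y))).
Proof. by move=> ih; rewrite rint_fubini1// rint_fubini2. Qed.

(** Tonelli: the iterated integral of the absolute value, computed in the
    extended reals, decides integrability. *)
Lemma rintg_tonelli1 h : measurable_fun setT h ->
  (\int[m1]_x \int[m2]_y (`|h (x, y)|)%:E < +oo)%E -> rintg (m1 \x m2)%E h.
Proof.
by move=> mh H; apply/integrable12ltyP => //; exact/measurable_EFinP.
Qed.

Lemma rintg_tonelli2 h : measurable_fun setT h ->
  (\int[m2]_y \int[m1]_x (`|h (x, y)|)%:E < +oo)%E -> rintg (m1 \x m2)%E h.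
Proof.
by move=> mh H; apply/integrable21ltyP => //; exact/measurable_EFinP.
Qed.

Lemma rintg_tensor (f : T1 -> R) (g : T2 -> R) : rintg m1 f -> rintg m2 g ->
  rintg (m1 \x m2)%E (fun z => f z.1 * g z.2).
Proof.
move=> fi gi; have mf := rintg_measurable fi; have mg := rintg_measurable gi.
apply: rintg_tonelli1.
  by apply: measurable_funM; exact: measurableT_comp.
have /integrableP[_ fo] := fi; have /integrableP[_ go] := gi.
rewrite (_ : (\int[m1]_x _)%E =
  (\int[m1]_x (`|f x|%:E * \int[m2]_y `|g y|%:E))%E); last first.
  apply: eq_integral => x _; rewrite -ge0_integralZl//.
    by apply: eq_integral => y _; rewrite normrM EFinM.
  exact/measurable_EFinP/measurableT_comp.
rewrite ge0_integralZr//.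
- by rewrite lte_mul_pinfty// ?integral_ge0// ge0_fin_numE// integral_ge0.
- exact/measurable_EFinP/measurableT_comp.
- exact: integral_ge0.
Qed.

End RealFubini.

Section MeasurePreserving.
Context d (T : measurableType d) (R : realType).
Variable mu : {measure set T -> \bar R}.

Definition preserves (phi : T -> T) : Prop :=
  measurable_fun setT phi /\
  forall A, measurable A -> mu (phi @^-1` A) = mu A.

Variables (phi : T -> T) (pphi : preserves phi).

Lemma rintg_preserves (f : T -> R) : rintg mu f -> rintg mu (f \o phi).
Proof.
have [mphi pE] := pphi => fi; have mf := rintg_measurable fi.
apply/integrableP; split; first exact/measurable_EFinP/measurableT_comp.
have /integrableP[_] := fi; rewrite (_ : (\int[_]_(_ in _) _)%E =
  (\int[mu]_x `|(EFin \o (f \o phi)) x|)%E)//.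
rewrite [RHS](_ : _ = \int[mu]_(x in phi @^-1` setT)
   ((fun y => `|(f y)%:E|) \o phi) x)%E; last by rewrite preimage_setT.
rewrite -(ge0_integral_pushforward mphi)//; last first.
  by apply: measurableT_comp => //; exact/measurable_EFinP.
by apply: eq_measure_integral => A mA _; rewrite /pushforward; apply/esym/pE.
Qed.

Lemma rint_preserves (f : T -> R) : rintg mu f -> rint mu (f \o phi) = rint mu f.
Proof.
have [mphi pE] := pphi => fi; have mf := rintg_measurable fi.
congr fine.
rewrite [LHS](_ : _ = \int[mu]_(x in phi @^-1` setT)
   ((fun y => (f y)%:E) \o phi) x)%E; last by rewrite preimage_setT.
rewrite -(integral_pushforward mphi)//.
- by apply: eq_measure_integral => A mA _; rewrite /pushforward; apply/pE.
- exact/measurable_EFinP.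
- by rewrite preimage_setT; exact: rintg_preserves fi.
Qed.

End MeasurePreserving.

Section PreservesProduct.
Context d1 d2 (T1 : measurableType d1) (T2 : measurableType d2) (R : realType).
Variable m1 : {sigma_finite_measure set T1 -> \bar R}.
Variable m2 : {sigma_finite_measure set T2 -> \bar R}.

Lemma preserves_prod (p : T1 -> T1) (q : T2 -> T2) :
  preserves m1 p -> preserves m2 q ->
  preserves (m1 \x m2)%E (fun z => (p z.1, q z.2)).
Proof.
move=> [mp pE] [mq qE].
have mpq : measurable_fun setT (fun z : T1 * T2 => (p z.1, q z.2)).
  by apply/measurable_fun_pair; exact: measurableT_comp.
split=> // A mA.
pose pq : {mfun (T1 * T2)%type >-> (T1 * T2)%type} := mfun_Sub (mem_set mpq).
apply/esym; have := @product_measure_unique _ _ _ _ _ m1 m2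
  (pushforward (m1 \x m2)%E pq) _ A mA; apply => B C mB mC.
rewrite -[in RHS](pE B mB) -(qE C mC) /= -product_measure1E//.
- by rewrite -[X in measurable X]setTI; exact: mp.
- by rewrite -[X in measurable X]setTI; exact: mq.
Qed.

End PreservesProduct.

Lemma preserves_shift (R : realType) (a : R) :
  preserves (@lebesgue_measure R) (fun x : measurableTypeR R => x + a).
Proof.
pose s0 : measurableTypeR R -> measurableTypeR R := fun x => x + a.
have ms : measurable_fun setT s0 by exact: measurable_funD.
split=> // A mA.
pose s : {mfun (measurableTypeR R) >-> (measurableTypeR R)} := mfun_Sub (mem_set ms).
apply/esym; have := @lebesgue_measure_unique R
  (pushforward (@lebesgue_measure R) s) _ A mA; apply => _ [[b c]] _ <-.
rewrite /= /pushforward (_ : _ @^-1` _ = `]b - a, c - a]%classic).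
  rewrite !lebesgue_measure_itv/= !lte_fin ltrD2r; case: ifP => // _.
  by rewrite -!EFinB -addrA; congr EFin; ring.
by apply/seteqP; split=> x /=; rewrite !in_itv/= ltrBlDr lerBrDr.
Qed.

(** * Integration of complex functions *)

Section ComplexArith.
Variable R : realType.
Implicit Types (a : R) (z w : R[i]).
Local Notation normc := Normc.normc.

Lemma cReM z w : complex.Re (z * w) =
  complex.Re z * complex.Re w - complex.Im z * complex.Im w.
Proof. by case: z; case: w. Qed.

Lemma cImM z w : complex.Im (z * w) =
  complex.Re z * complex.Im w + complex.Im z * complex.Re w.
Proof. by case: z => a b; case: w => c e. Qed.

Lemma cReD z w : complex.Re (z + w) = complex.Re z + complex.Re w.
Proof. by case: z; case: w. Qed.

Lemma cImD z w : complex.Im (z + w) = complex.Im z + complex.Im w.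
Proof. by case: z; case: w. Qed.

Lemma cReN z : complex.Re (- z) = - complex.Re z.
Proof. by case: z. Qed.

Lemma cImN z : complex.Im (- z) = - complex.Im z.
Proof. by case: z. Qed.

Lemma complexP z w : complex.Re z = complex.Re w ->
  complex.Im z = complex.Im w -> z = w.
Proof. by case: z => a b; case: w => c e /= -> ->. Qed.

Lemma ler_Re_normc z : `|complex.Re z| <= normc z.
Proof.
case: z => a b /=; rewrite -(sqrtr_sqr a) ler_sqrt ?addr_ge0 ?sqr_ge0//.
by rewrite lerDl sqr_ge0.
Qed.

Lemma ler_Im_normc z : `|complex.Im z| <= normc z.
Proof.
case: z => a b /=; rewrite -(sqrtr_sqr b) ler_sqrt ?addr_ge0 ?sqr_ge0//.
by rewrite lerDr sqr_ge0.
Qed.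

Lemma normc_real a : normc a%:C = `|a|.
Proof. by rewrite /= expr0n addr0 sqrtr_sqr. Qed.

Lemma normc_ge0 z : 0 <= normc z.
Proof. by case: z => a b; exact: sqrtr_ge0. Qed.

Lemma ler_normc z : normc z <= `|complex.Re z| + `|complex.Im z|.
Proof.
rewrite [leLHS](_ : _ = normc ((complex.Re z)%:C + 'i%C * (complex.Im z)%:C)).
  apply: le_trans (le_normcD _ _) _; rewrite Normc.normcM !normc_real /=.
  by rewrite expr0n expr1n add0r sqrtr1 mul1r.
by rewrite -complexE.
Qed.

End ComplexArith.

Section ComplexIntegral.
Context d (T : measurableType d) (R : realType).
Variable mu : {measure set T -> \bar R}.
Implicit Types f g : T -> R[i].

Definition cmeas f : Prop :=
  measurable_fun setT (fun x => complex.Re (f x)) /\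
  measurable_fun setT (fun x => complex.Im (f x)).

Definition cintg f : Prop :=
  rintg mu (fun x => complex.Re (f x)) /\ rintg mu (fun x => complex.Im (f x)).

Definition cint f : R[i] :=
  rint mu (fun x => complex.Re (f x)) +i* rint mu (fun x => complex.Im (f x)).

Lemma cintg_cmeas f : cintg f -> cmeas f.
Proof. by move=> [/rintg_measurable mr /rintg_measurable mi]. Qed.

Lemma cmeas_cst c : cmeas (fun=> c).
Proof. by split; exact: measurable_cst. Qed.

Lemma cmeas_real (f : T -> R) : measurable_fun setT f -> cmeas (fun x => (f x)%:C).
Proof. by split => //=; exact: measurable_cst. Qed.

Lemma cmeasM f g : cmeas f -> cmeas g -> cmeas (fun x => f x * g x).
Proof.
move=> [fr fi] [gr gi]; split.
  by under eq_fun do rewrite cReM; apply: measurable_funB; exact: measurable_funM.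
by under eq_fun do rewrite cImM; apply: measurable_funD; exact: measurable_funM.
Qed.

Lemma cmeasD f g : cmeas f -> cmeas g -> cmeas (fun x => f x + g x).
Proof.
move=> [fr fi] [gr gi]; split.
  by under eq_fun do rewrite cReD; exact: measurable_funD.
by under eq_fun do rewrite cImD; exact: measurable_funD.
Qed.

Lemma measurable_normc f : cmeas f ->
  measurable_fun setT (fun x => Normc.normc (f x)).
Proof.
move=> [fr fi].
rewrite (_ : (fun x => _) = (fun x => Num.sqrt
  (complex.Re (f x) ^+ 2 + complex.Im (f x) ^+ 2))); last first.
  by apply/funext => x; case: (f x).
apply: measurableT_comp.
  exact: continuous_measurable_fun (@sqrt_continuous R).
by apply: measurable_funD; exact: measurable_funX.
Qed.

Lemma cintg_dominated f (g : T -> R) :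
  cmeas f -> rintg mu g -> (forall x, Normc.normc (f x) <= g x) -> cintg f.
Proof.
move=> [fr fi] gi fg; split; apply: rintg_dominated gi _ => // x.
  exact: le_trans (ler_Re_normc _) (fg x).
exact: le_trans (ler_Im_normc _) (fg x).
Qed.

Lemma rintg_normc f : cintg f -> rintg mu (fun x => Normc.normc (f x)).
Proof.
move=> fi; have [fr fim] := fi; have /measurable_normc mf := cintg_cmeas fi.
apply: (@rintg_dominated _ _ _ mu _
  (fun x => `|complex.Re (f x)| + `|complex.Im (f x)|)) => //.
  apply: rintgD.
  - apply: (le_integrable _ _ _ fr) => //.
      by apply/measurable_EFinP/measurableT_comp => //; exact: rintg_measurable fr.
    by move=> x _ /=; rewrite lee_fin normr_id.
  - apply: (le_integrable _ _ _ fim) => //.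
      by apply/measurable_EFinP/measurableT_comp => //; exact: rintg_measurable fim.
    by move=> x _ /=; rewrite lee_fin normr_id.
by move=> x; rewrite ger0_norm ?normc_ge0// ler_normc.
Qed.

Lemma cintgZ (c : R[i]) f : cintg f -> cintg (fun x => c * f x).
Proof.
move=> [fr fi]; split.
  by under eq_fun do rewrite cReM; apply: rintgB; exact: rintgZ.
by under eq_fun do rewrite cImM; apply: rintgD; exact: rintgZ.
Qed.

Lemma cintZ (c : R[i]) f : cintg f -> cint (fun x => c * f x) = c * cint f.
Proof.
move=> [fr fi]; apply: complexP.
  rewrite cReM /=; under [LHS]eq_Rintegral do rewrite cReM.
  by rewrite [LHS]rintB ?rintZ//; exact: rintgZ.
rewrite cImM /=; under [LHS]eq_Rintegral do rewrite cImM.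
by rewrite [LHS]rintD ?rintZ//; exact: rintgZ.
Qed.

Lemma cintgD f g : cintg f -> cintg g -> cintg (fun x => f x + g x).
Proof.
move=> [fr fi] [gr gi]; split.
  by under eq_fun do rewrite cReD; exact: rintgD.
by under eq_fun do rewrite cImD; exact: rintgD.
Qed.

Lemma cintD f g : cintg f -> cintg g ->
  cint (fun x => f x + g x) = cint f + cint g.
Proof.
move=> [fr fi] [gr gi]; apply: complexP => /=.
  by under [LHS]eq_Rintegral do rewrite cReD; exact: rintD.
by under [LHS]eq_Rintegral do rewrite cImD; exact: rintD.
Qed.

Lemma cintg0 : cintg (fun=> 0).
Proof. by split; exact: rintg0. Qed.

Lemma cint0 : cint (fun=> 0) = 0.
Proof. by rewrite /cint /= !rint0. Qed.

Lemma cintg_sum (I : Type) (r : seq I) (F : I -> T -> R[i]) :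
  (forall i, cintg (F i)) -> cintg (fun x => \sum_(i <- r) F i x).
Proof.
move=> FI; elim: r => [|i r IH].
  by under eq_fun do rewrite big_nil; exact: cintg0.
by under eq_fun do rewrite big_cons; exact: cintgD.
Qed.

Lemma cint_sum (I : Type) (r : seq I) (F : I -> T -> R[i]) :
  (forall i, cintg (F i)) ->
  cint (fun x => \sum_(i <- r) F i x) = \sum_(i <- r) cint (F i).
Proof.
move=> FI; elim: r => [|i r IH].
  by under eq_fun do rewrite big_nil; rewrite big_nil cint0.
under eq_fun do rewrite big_cons; rewrite cintD ?IH ?big_cons//.
exact: cintg_sum.
Qed.

Lemma cint_real (f : T -> R) : cint (fun x => (f x)%:C) = (rint mu f)%:C.
Proof. by rewrite /cint /= rint0. Qed.

Lemma cintg_real (f : T -> R) : rintg mu f -> cintg (fun x => (f x)%:C).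
Proof. by split => //=; exact: rintg0. Qed.

Lemma eq_cint f g : f =1 g -> cint f = cint g.
Proof. by move=> fg; congr cint; exact/funext. Qed.

Lemma cintg_preserves (phi : T -> T) f : preserves mu phi -> cintg f ->
  cintg (f \o phi).
Proof. by move=> p [fr fi]; split; [exact: (rintg_preserves p fr)|exact: (rintg_preserves p fi)]. Qed.

Lemma cint_preserves (phi : T -> T) f : preserves mu phi -> cintg f ->
  cint (f \o phi) = cint f.
Proof.
by move=> p [fr fi]; apply: complexP; [exact: (rint_preserves p fr)|exact: (rint_preserves p fi)].
Qed.

End ComplexIntegral.

Lemma cmeas_comp d d' (T : measurableType d) (T' : measurableType d')
    (R : realType) (f : T' -> R[i]) (g : T -> T') :
  cmeas f -> measurable_fun setT g -> cmeas (f \o g).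
Proof.
by move=> [fr fi] mg; split; [exact: (measurableT_comp fr)|exact: (measurableT_comp fi)].
Qed.

Section ComplexFubini.
Context d1 d2 (T1 : measurableType d1) (T2 : measurableType d2) (R : realType).
Variable m1 : {sigma_finite_measure set T1 -> \bar R}.
Variable m2 : {sigma_finite_measure set T2 -> \bar R}.

Lemma cint_fubini (h : T1 * T2 -> R[i]) : cintg (m1 \x m2)%E h ->
  cint m1 (fun x => cint m2 (fun y => h (x, y))) =
  cint m2 (fun y => cint m1 (fun x => h (x, y))).
Proof. by move=> [hr hi]; apply: complexP; [exact: (rint_fubini hr)|exact: (rint_fubini hi)]. Qed.

Lemma cintg_fubini1 (h : T1 * T2 -> R[i]) : cintg (m1 \x m2)%E h ->
  cintg m1 (fun x => cint m2 (fun y => h (x, y))).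
Proof. by move=> [hr hi]; split; [exact: (rintg_fubini1 hr)|exact: (rintg_fubini1 hi)]. Qed.

Lemma cintg_fubini2 (h : T1 * T2 -> R[i]) : cintg (m1 \x m2)%E h ->
  cintg m2 (fun y => cint m1 (fun x => h (x, y))).
Proof. by move=> [hr hi]; split; [exact: (rintg_fubini2 hr)|exact: (rintg_fubini2 hi)]. Qed.

Lemma cint_fubini1 (h : T1 * T2 -> R[i]) : cintg (m1 \x m2)%E h ->
  cint m1 (fun x => cint m2 (fun y => h (x, y))) = cint (m1 \x m2)%E h.
Proof. by move=> [hr hi]; apply: complexP; [exact: (rint_fubini1 hr)|exact: (rint_fubini1 hi)]. Qed.

Lemma cintg_tensor (f : T1 -> R[i]) (g : T2 -> R[i]) : cintg m1 f -> cintg m2 g ->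
  cintg (m1 \x m2)%E (fun z => f z.1 * g z.2).
Proof.
move=> fi gi; apply: (@cintg_dominated _ _ _ _ _
  (fun z => Normc.normc (f z.1) * Normc.normc (g z.2))).
- apply: cmeasM.
    exact: (cmeas_comp (cintg_cmeas fi) measurable_fst).
  exact: (cmeas_comp (cintg_cmeas gi) measurable_snd).
- exact: (rintg_tensor (rintg_normc fi) (rintg_normc gi)).
- by move=> z; rewrite Normc.normcM.
Qed.

Lemma cint_tensor (f : T1 -> R[i]) (g : T2 -> R[i]) : cintg m1 f -> cintg m2 g ->
  cint (m1 \x m2)%E (fun z => f z.1 * g z.2) = cint m1 f * cint m2 g.
Proof.
move=> fi gi; rewrite -cint_fubini1; last exact: cintg_tensor.
rewrite mulrC -cintZ//; apply: eq_cint => x /=.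
by rewrite cintZ// mulrC.
Qed.

End ComplexFubini.

(** * Lebesgue measure on tuples *)

Section TupleMeasure.
Variable R : realType.
Local Notation RM := (measurableTypeR R).
Local Notation mu1 := (@lebesgue_measure R).
Local Notation mu m := (lebesgue_tuple R m).

Lemma rintg_tuple m (f : m.+1.-tuple RM -> R) : measurable_fun setT f ->
  rintg (mu1 \x mu m)%E (f \o @tcons R m) -> rintg (mu m.+1) f.
Proof.
move=> mf fi; apply: (@integrable_pushforward _ _ _ _ _ _ (@measurable_tcons R m)
   (mu1 \x mu m)%E setT (EFin \o f)) => //.
  exact/measurable_EFinP.
Qed.

Lemma rint_tuple m (f : m.+1.-tuple RM -> R) : measurable_fun setT f ->
  rintg (mu1 \x mu m)%E (f \o @tcons R m) ->
  rint (mu m.+1) f = rint (mu1 \x mu m)%E (f \o @tcons R m).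
Proof.
move=> mf fi; congr fine.
apply: (@integral_pushforward _ _ _ _ _ _ (@measurable_tcons R m)
   (mu1 \x mu m)%E setT (EFin \o f)) => //.
exact/measurable_EFinP.
Qed.

Lemma cintg_tuple m (f : m.+1.-tuple RM -> R[i]) : cmeas f ->
  cintg (mu1 \x mu m)%E (f \o @tcons R m) -> cintg (mu m.+1) f.
Proof. by move=> [mr mi] [fr fi]; split; exact: rintg_tuple. Qed.

Lemma cint_tuple m (f : m.+1.-tuple RM -> R[i]) : cmeas f ->
  cintg (mu1 \x mu m)%E (f \o @tcons R m) ->
  cint (mu m.+1) f = cint (mu1 \x mu m)%E (f \o @tcons R m).
Proof. by move=> [mr mi] [fr fi]; apply: complexP => /=; exact: rint_tuple. Qed.

Lemma ge0_integral_tuple m (f : m.+1.-tuple RM -> \bar R) :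
  measurable_fun setT f -> (forall t, (0 <= f t)%E) ->
  (\int[mu m.+1]_t f t = \int[mu1]_a \int[mu m]_t f (tcons (a, t)))%E.
Proof.
move=> mf f0.
transitivity (\int[(mu1 \x mu m)]_z (f \o @tcons R m) z)%E.
  by apply: (@ge0_integral_pushforward _ _ _ _ _ _ (@measurable_tcons R m)).
rewrite fubini_tonelli1//; last by move=> z; exact: f0.
by apply: measurableT_comp => //; exact: measurable_tcons.
Qed.

(** The extended-real valued factors are allowed to be infinite: the singular
    weights used below are infinite on coordinate hyperplanes. *)
Lemma measurable_prod_tuple m (h : 'I_m -> RM -> \bar R) :
  (forall j, measurable_fun setT (h j)) ->
  measurable_fun setT (fun t : m.-tuple RM => \big[*%E/1%E]_j h j (tnth t j)).
Proof.
move=> mh; elim: (index_enum _) => [|j r IH].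
  by under eq_fun do rewrite big_nil; exact: measurable_cst.
under eq_fun do rewrite big_cons.
apply: emeasurable_funM => //.
by apply: measurableT_comp => //; exact: measurable_tnth.
Qed.

Lemma prod_tuple_ge0 m (h : 'I_m -> RM -> \bar R) (t : m.-tuple RM) :
  (forall j u, (0 <= h j u)%E) -> (0 <= \big[*%E/1%E]_j h j (tnth t j))%E.
Proof.
by move=> h0; elim/big_ind : _ => // x y; exact: mule_ge0.
Qed.

Lemma prod_tuple_lty m (h : 'I_m -> RM -> \bar R) :
  (forall j, measurable_fun setT (h j)) -> (forall j u, (0 <= h j u)%E) ->
  (forall j, \int[mu1]_u h j u < +oo)%E ->
  (\int[mu m]_t \big[*%E/1%E]_j h j (tnth t j) < +oo)%E.
Proof.
elim: m h => [|m IH] h mh h0 hoo.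
  rewrite integral_dirac//; last exact: measurable_prod_tuple.
  by rewrite diracT mul1e big_ord0 ltry.
rewrite ge0_integral_tuple; last 2 first.
  exact: measurable_prod_tuple.
  by move=> t; exact: prod_tuple_ge0.
have mh' := @measurable_prod_tuple m (fun j => h (lift ord0 j)) (fun j => mh _).
rewrite (_ : (\int[_]_a _)%E = (\int[mu1]_a (h ord0 a *
   \int[mu m]_t \big[*%E/1%E]_j h (lift ord0 j) (tnth t j)))%E); last first.
  apply: eq_integral => a _; rewrite -ge0_integralZl//; last first.
    by move=> t _; apply: (prod_tuple_ge0 (h := fun j => h (lift ord0 j))).
  apply: eq_integral => t _; rewrite big_ord_recl; congr (_ * _)%E.
  by apply: eq_bigr => j _; rewrite tnthS.
have I0 : (0 <= \int[mu m]_t \big[*%E/1%E]_j h (lift ord0 j) (tnth t j))%E.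
  by apply: integral_ge0 => t _; apply: (prod_tuple_ge0 (h := fun j => h (lift ord0 j))).
rewrite ge0_integralZr//.
rewrite lte_mul_pinfty ?integral_ge0// ?ge0_fin_numE ?integral_ge0//.
exact: (IH (fun j => h (lift ord0 j))).
Qed.

Lemma rintg_prod_bound m (h : 'I_m -> RM -> \bar R) (C : R)
    (f : m.-tuple RM -> R) :
  (forall j, measurable_fun setT (h j)) -> (forall j u, (0 <= h j u)%E) ->
  (forall j, \int[mu1]_u h j u < +oo)%E -> measurable_fun setT f -> 0 <= C ->
  (forall t, (`|f t|%:E <= C%:E * \big[*%E/1%E]_j h j (tnth t j))%E) ->
  rintg (mu m) f.
Proof.
move=> mh h0 hoo mf C0 fh; apply/integrableP; split; first exact/measurable_EFinP.
have mp := measurable_prod_tuple mh.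
apply: (@le_lt_trans _ _ (\int[mu m]_t
   (C%:E * \big[*%E/1%E]_j h j (tnth t j)))%E).
  apply: ge0_le_integral => //.
  - by apply: measurableT_comp => //; exact/measurable_EFinP.
  - exact: emeasurable_funM.
  - by move=> t _; exact: fh.
rewrite ge0_integralZl//; last by move=> t _; exact: prod_tuple_ge0.
rewrite lte_mul_pinfty ?lee_fin//; exact: prod_tuple_lty.
Qed.

Lemma cmeas_prod_tuple m (f : 'I_m -> RM -> R[i]) :
  (forall j, cmeas (f j)) ->
  cmeas (fun t : m.-tuple RM => \prod_j f j (tnth t j)).
Proof.
move=> mf; elim: (index_enum _) => [|j r IH].
  by under eq_fun do rewrite big_nil; exact: cmeas_cst.
under eq_fun do rewrite big_cons; apply: cmeasM => //.
exact: (cmeas_comp (mf j) (measurable_tnth j)).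
Qed.

Lemma cint_prod_tuple m (f : 'I_m -> RM -> R[i]) :
  (forall j, cintg mu1 (f j)) ->
  cintg (mu m) (fun t => \prod_j f j (tnth t j)) /\
  cint (mu m) (fun t => \prod_j f j (tnth t j)) = \prod_j cint mu1 (f j).
Proof.
elim: m f => [|m IH] f fi.
  under eq_fun do rewrite big_ord0; rewrite big_ord0; split.
    apply: (cintg_real (f := fun=> 1)); apply/integrableP; split.
      exact: measurable_cst.
    by rewrite integral_dirac ?diracT ?mul1e//= normr1 ltry.
  rewrite (cint_real (mu 0) (fun=> 1)) /rint /Rintegral integral_dirac//=.
  by rewrite indicT mulr1.
have [IH1 IH2] := IH (fun j => f (lift ord0 j)) (fun j => fi _).
have mP := cmeas_prod_tuple (fun j => cintg_cmeas (fi j)).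
have E : (fun t : m.+1.-tuple RM => \prod_j f j (tnth t j)) \o @tcons R m =
  (fun z : RM * m.-tuple RM => f ord0 z.1 *
     \prod_j f (lift ord0 j) (tnth z.2 j)).
  apply/funext => -[a t] /=; rewrite big_ord_recl; congr (_ * _).
  by apply: eq_bigr => j _; rewrite tnthS.
have iT := cintg_tensor (fi ord0) IH1.
split; first by apply: cintg_tuple => //; rewrite E; exact: iT.
rewrite cint_tuple// ?E; last exact: iT.
by rewrite (cint_tensor (fi ord0) IH1) big_ord_recl IH2.
Qed.

Definition shift_tuple m (v : 'I_m -> R) (t : m.-tuple RM) : m.-tuple RM :=
  [tuple (tnth t j : R) + v j | j < m].

Lemma preserves_shift_tuple m (v : 'I_m -> R) :
  preserves (mu m) (shift_tuple v).
Proof.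
have ms k (w : 'I_k -> R) : measurable_fun setT (shift_tuple w).
  apply/measurable_fun_tnthP => j.
  rewrite (_ : _ \o _ = (fun t : k.-tuple RM => (tnth t j : RM) + w j)).
    by apply: measurable_funD => //; exact: measurable_tnth.
  by apply/funext => t /=; rewrite tnth_mktuple.
elim: m v => [|m IH] v; split; try exact: ms; move=> A mA.
  rewrite (_ : _ @^-1` A = A)//.
  by apply/seteqP; split => t /=; rewrite (tuple0 t) (tuple0 (shift_tuple _ _)).
pose v' j := v (lift ord0 j).
have [_ pE] := preserves_prod (preserves_shift (v ord0)) (IH v').
have mA' : measurable (@tcons R m @^-1` A).
  by rewrite -[X in measurable X]setTI; exact: measurable_tcons.
rewrite -[RHS](pE _ mA'); congr ((mu1 \x mu m)%E _).
apply/seteqP; split => -[a t] /=; congr A; apply: eq_from_tnth => j;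
  rewrite tnth_mktuple; case: (unliftP ord0 j) => [k|] ->;
  by rewrite ?tnthS ?tnth_mktuple// !tnth0.
Qed.

End TupleMeasure.

Section BorelTuple.
Variables (R : realType) (m : nat).
Local Notation RM := (measurableTypeR R).
Local Notation V := 'rV[R]_m.+1.

Lemma row_of_tupleE (t : m.+1.-tuple RM) j : row_of_tuple t ord0 j = tnth t j.
Proof. by rewrite mxE. Qed.

Lemma measurable_tuple_box (q : 'I_m.+1 -> R) (e : R) :
  measurable [set t : m.+1.-tuple RM | forall j, `|(tnth t j : R) - q j| < e].
Proof.
rewrite (_ : mkset _ = \bigcap_(j in [set: 'I_m.+1])
    [set t : m.+1.-tuple RM | `|(tnth t j : R) - q j| < e]); last first.
  by apply/seteqP; split => t /= H j; [move=> _|]; exact: H.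
apply: fin_bigcap_measurable => //.
move=> j _; rewrite -[X in measurable X]setTI.
have mj : measurable_fun setT (fun t : m.+1.-tuple RM => `|(tnth t j : RM) - q j|).
  apply: measurableT_comp => //; apply: measurable_funB => //.
  exact: measurable_tnth.
rewrite (_ : mkset _ = (fun t : m.+1.-tuple RM => `|(tnth t j : RM) - q j|) @^-1`
   `]-oo, e[%classic); last by apply/seteqP; split => t /=; rewrite in_itv.
exact: mj.
Qed.

(** Every open set is a countable union of boxes with rational centres and
    radii, hence measurable for the product sigma-algebra. *)
Lemma measurable_open_row (U : set V) : open U ->
  measurable (@row_of_tuple R m @^-1` U).
Proof.
move=> oU.
pose box (p : {ffun 'I_m.+1 -> rat} * nat) : set (m.+1.-tuple RM) :=
  [set t | forall j, `|(tnth t j : R) - ratr (p.1 j)| < p.2.+1%:R^-1].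
pose good p := box p `<=` @row_of_tuple R m @^-1` U.
rewrite (_ : _ @^-1` _ = \bigcup_p (if `[< good p >] then box p else set0)).
  apply: countable_bigcupT_measurable; first exact: countableP.
  by move=> p; case: ifP => _ //; exact: measurable_tuple_box.
apply/seteqP; split=> [t Ut|t [p _]]; last first.
  by case: ifPn => // /asboolP gp /gp.
have /nbhs_ballP[e /= e0 eU] : nbhs (row_of_tuple t) U by exact: open_nbhs_nbhs.
have near2 (a b c r : R) : `|a - c| < r -> `|b - c| < r -> r < e / 2 ->
    `|a - b| < e.
  move=> ac bc re; rewrite (_ : a - b = (a - c) - (b - c)); last by ring.
  by apply: (le_lt_trans (ler_normB _ _)); lra.
have [k ke] : exists k : nat, k.+1%:R^-1 < e / 2.
  have [k] := ltr_add_invr (divr_gt0 e0 (ltr0n _ 2)); rewrite add0r.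
  by exists k.
have /choice[q qt] : forall j, exists q : rat, `|(tnth t j : R) - ratr q| < k.+1%:R^-1.
  move=> j; have : (tnth t j : R) - k.+1%:R^-1 < tnth t j + k.+1%:R^-1.
    by rewrite ltrD2l gtrN// invr_gt0.
  move=> /rat_in_itvoo[q]; rewrite in_itv/= => /andP[q1 q2].
  by exists q; rewrite ltr_distlC q1 q2.
exists (finfun q, k) => //; case: ifPn => [_ j /=|/asboolPn[]].
  by rewrite ffunE.
move=> y /= yq; apply: eU; split => // i j; rewrite ord1 !row_of_tupleE /ball/=.
have := qt j; have := yq j; rewrite ffunE /= => y1 t1.
exact: (near2 _ _ _ _ t1 y1 ke).
Qed.

Lemma continuous_measurable_row (f : V -> R) : continuous f ->
  measurable_fun setT (f \o @row_of_tuple R m).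
Proof.
move=> /continuousP cf; apply: (measurability _ (RGenOpens.measurableE R)).
move=> _ [_ [a [b ->] <-]]; rewrite setTI comp_preimage.
by apply: measurable_open_row; apply: cf; exact: interval_open.
Qed.

Lemma measurable_row_coord j :
  measurable_fun setT (fun t : m.+1.-tuple RM => row_of_tuple t ord0 j).
Proof.
rewrite (_ : (fun t => _) = (fun t : m.+1.-tuple RM => tnth t j : RM)).
  exact: measurable_tnth.
by apply/funext => t; rewrite row_of_tupleE.
Qed.

End BorelTuple.

(** * Integration by parts, derivatives and the complex exponential *)

Section FlowDerivative.
Context d (T : measurableType d) (R : realType).
Variable mu : {sigma_finite_measure set T -> \bar R}.
Local Notation mu1 := (@lebesgue_measure R).
Local Notation RM := (measurableTypeR R).

(** If a measure-preserving flow transports f and g is the derivative of f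
    along the flow, then integrating f (flow 1 x) - f x = int_0^1 g (flow h x) dh
    over x gives 0 = int_0^1 (int g) dh, by Fubini and invariance.  This is
    integration by parts without boundary terms. *)
Lemma rint_flow_derivative (flow : R -> T -> T) (f g : T -> R) :
  (forall h, preserves mu (flow h)) -> rintg mu f -> rintg mu g ->
  measurable_fun setT (fun z : RM * T => g (flow z.1 z.2)) ->
  (forall x, f (flow 1 x) - f x = Rintegral mu1 `[0, 1] (fun h => g (flow h x))) ->
  rint mu g = 0.
Proof.
move=> pf fi gi mg fg.
pose H (z : RM * T) : R := \1_(`[0, 1]%classic : set R) z.1 * g (flow z.1 z.2).
have i1 : rintg mu1 (\1_(`[0, 1]%classic : set R)).
  exact: integrable_indic_itv.
have mi : measurable_fun setT (fun z : RM * T => \1_(`[0, 1]%classic : set R) z.1 : R).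
  apply: (@measurableT_comp _ _ _ _ _ _ (\1_(`[0, 1]%classic : set R) : RM -> R)) => //.
have mH : measurable_fun setT H by exact: measurable_funM.
have gn : rintg mu (fun x => `|g x|).
  by have := integrable_norm gi; apply: eq_integrable.
have iH : rintg (mu1 \x mu)%E H.
  apply: rintg_tonelli1 => //.
  have := integrable_lty measurableT (rintgZ (rint mu (fun x => `|g x|)) i1).
  congr (_ < _)%E; apply: eq_integral => h _ /=.
  have gnh := rintg_preserves (pf h) gn.
  rewrite mulrC -(rint_preserves (pf h) gn) -rintZ// EFin_rint; last exact: rintgZ.
  apply: eq_integral => x _; by rewrite /H normrM ger0_norm.
have E h : rint mu (fun x => H (h, x)) = \1_(`[0, 1]%classic : set R) h * rint mu g.
  by rewrite /H /= rintZ ?(rint_preserves (pf h))//; exact: (rintg_preserves (pf h)).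
have : rint mu (fun x => f (flow 1 x) - f x) = 0.
  rewrite rintB ?(rint_preserves (pf 1))// ?subrr//.
  exact: (rintg_preserves (pf 1)).
rewrite (_ : (fun x => f (flow 1 x) - f x) = (fun x => rint mu1 (fun h => H (h, x)))).
  rewrite -rint_fubini// (_ : (fun h => _) =
     (fun h => rint mu g * \1_(`[0, 1]%classic : set R) h)).
    rewrite rintZ// /rint /Rintegral integral_indic//= setIT lebesgue_measure_itv/=.
    by rewrite lte01 oppr0 adde0 mulr1.
  by apply/funext => h; rewrite E mulrC.
apply/funext => x; rewrite fg Rintegral_mkcond /rint; congr fine.
apply: eq_integral => h _; congr EFin; rewrite /H /= patchE indicE.
by case: ifP => _; rewrite ?mul1r ?mul0r.
Qed.

End FlowDerivative.

Section Cexp.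
Variable R : realType.
Implicit Types z w : R[i].

Lemma cexpD z w : cexp (z + w) = cexp z * cexp w.
Proof.
case: z => a b; case: w => c e; rewrite /cexp /= expRD cosD sinD.
by apply: complexP; rewrite !(cReM, cImM) /=; ring.
Qed.

Lemma cexp_Ni (x : R) : cexp (- 'i * x%:C) = cos x -i* sin x.
Proof.
rewrite /cexp; apply: complexP; rewrite !(cReM, cImM, cReN, cImN) /=;
  rewrite ?oppr0 ?mul0r ?mulr0 ?subr0 ?addr0 ?add0r ?mulN1r ?expR0 ?mul1r ?cosN ?sinN //.
Qed.

Lemma normc_cexp_Ni (x : R) : Normc.normc (cexp (- 'i * x%:C)) = 1.
Proof. by rewrite cexp_Ni /= sqrrN cos2Dsin2 sqrtr1. Qed.

Lemma cexp0 : cexp 0 = 1 :> R[i].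
Proof. by rewrite /cexp /= expR0 cos0 sin0 mul1r. Qed.

End Cexp.

Section Derivatives.
Variable R : realType.
Implicit Types (f g : R -> R) (x a b : R).

(** Not a class, unlike is_derive: derivatives are found by the syntactic rules
    below, for functions written pointwise. *)
Definition hasd f x a : Prop := is_derive x 1 f a.

Lemma hasd_eq f x a b : hasd f x a -> a = b -> hasd f x b.
Proof. by move=> ? <-. Qed.

Lemma hasd_cst a x : hasd (fun=> a) x 0.
Proof. exact: is_derive_cst. Qed.

Lemma hasd_id x : hasd (fun y => y) x 1.
Proof. exact: is_derive_id. Qed.

Lemma hasdD f g x a b : hasd f x a -> hasd g x b ->
  hasd (fun y => f y + g y) x (a + b).
Proof. exact: is_deriveD. Qed.

Lemma hasdN f x a : hasd f x a -> hasd (fun y => - f y) x (- a).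
Proof. exact: is_deriveN. Qed.

Lemma hasdM f g x a b : hasd f x a -> hasd g x b ->
  hasd (fun y => f y * g y) x (a * g x + f x * b).
Proof.
move=> fa gb; apply: hasd_eq (is_deriveM fa gb) _.
by rewrite addrC /GRing.scale /= [g x * a]mulrC.
Qed.

Lemma hasdX f n x a : hasd f x a ->
  hasd (fun y => f y ^+ n) x (n%:R * f x ^+ n.-1 * a).
Proof.
move=> fa; elim: n => [|n IH].
  by rewrite !mul0r; exact: hasd_cst.
rewrite (_ : (fun y => f y ^+ n.+1) = (fun y => f y * f y ^+ n)); last first.
  by apply/funext => y; rewrite exprS.
apply: hasd_eq (hasdM fa IH) _.
by case: n {IH} => [|n] /=; rewrite ?expr0 ?exprS -?[n.+2%:R]natr1; ring.
Qed.

Lemma hasd_comp f g x a b : hasd f (g x) a -> hasd g x b ->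
  hasd (fun y => f (g y)) x (a * b).
Proof. exact: is_derive1_comp. Qed.

Lemma hasd_expR f x a : hasd f x a ->
  hasd (fun y => expR (f y)) x (expR (f x) * a).
Proof. by apply: hasd_comp; exact: is_derive_expR. Qed.

Lemma hasd_cos f x a : hasd f x a ->
  hasd (fun y => cos (f y)) x (- sin (f x) * a).
Proof. by apply: hasd_comp; exact: is_derive_cos. Qed.

Lemma hasd_sin f x a : hasd f x a ->
  hasd (fun y => sin (f y)) x (cos (f x) * a).
Proof. by apply: hasd_comp; exact: is_derive_sin. Qed.

Lemma hasd_derivable f x a : hasd f x a -> derivable f x 1.
Proof. by case. Qed.

Lemma hasd_derive f x a : hasd f x a -> derive1 f x = a.
Proof. by case=> _; rewrite derive1E. Qed.

Lemma hasd_continuous f : (forall x, exists a, hasd f x a) -> continuous f.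
Proof.
move=> H x; have [a [fx _]] := H x.
exact/differentiable_continuous/derivable1_diffP.
Qed.

Lemma continuous_compf f g : continuous f -> continuous g ->
  continuous (fun x => g (f x)).
Proof. by move=> cf cg x; apply: continuous_comp; [exact: cf|exact: cg]. Qed.

Lemma derivative_line (V : normedModType R) (f : V -> R) (x v : V) h :
  differentiable (f : V -> R^o) (x + h *: v) ->
  hasd (fun h => f (x + h *: v)) h ('D_v (f : V -> R^o) (x + h *: v)).
Proof.
move=> df; have /cvg_ex[/= l fl] := diff_derivable (v := v) df.
have E : (fun k : R => k^-1 *: (f (x + (k *: 1 + h) *: v) - f (x + h *: v)) : R^o) =
    (fun k : R => k^-1 *: (f (k *: v + (x + h *: v)) - f (x + h *: v))).
  apply/funext => k; congr (_ *: (f _ - _)).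
  by rewrite scalerDl addrCA [k *: 1]mulr1.
split; first by apply/cvg_ex; exists l; rewrite /= E.
by rewrite /derive /= E.
Qed.

Lemma hasd0_cst f x y : (forall x, hasd f x 0) -> f x = f y.
Proof. exact: is_derive_0_is_cst. Qed.

Lemma integral_hasd (f F : R -> R) (a b : R) : a < b ->
  (forall x, hasd F x (f x)) -> continuous f ->
  Rintegral (@lebesgue_measure R) `[a, b] f = F b - F a.
Proof.
move=> ab dF cf; have cF : continuous F.
  by apply: hasd_continuous => x; exists (f x).
rewrite /Rintegral (@continuous_FTC2 _ f F a b)//.
- exact: continuous_subspaceT.
- split => [x _||].
  + exact: hasd_derivable (dF x).
  + by apply: cvg_at_right_filter; exact: cF.
  + by apply: cvg_at_left_filter; exact: cF.
- by move=> x _; exact: hasd_derive (dF x).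
Qed.

End Derivatives.

Ltac hasd := solve [repeat first
  [ apply: hasd_cst | apply: hasd_id | apply: hasdD | apply: hasdN | apply: hasdX
  | apply: hasdM | apply: hasd_expR | apply: hasd_cos | apply: hasd_sin | eassumption]].
Tactic Notation "hasd_by" tactic(tac) := eapply hasd_eq; [hasd|rewrite /=; tac].

(** * One-dimensional Gaussian integrals *)

Section Gaussian.
Variable R : realType.
Local Notation mu1 := (@lebesgue_measure R).
Local Notation RM := (measurableTypeR R).
Local Open Scope ring_scope.

Lemma gaussian_integral (t : R) : 0 < t ->
  rintg mu1 (fun u : RM => expR (- (t * u ^+ 2))) /\
  rint mu1 (fun u : RM => expR (- (t * u ^+ 2))) = Num.sqrt (pi / t).
Proof.
move=> t0.
(* The normal density with 2 s^2 = 1 / t. *)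
pose s : R := Num.sqrt (2 * t)^-1.
have s2 : s ^+ 2 *+ 2 = t^-1.
  rewrite /s sqr_sqrtr ?invr_ge0 ?mulr_ge0 ?ltW// -mulr_natl invfM.
  by rewrite mulrA divff// mul1r.
have s0 : s != 0 by rewrite gt_eqF// sqrtr_gt0 invr_gt0 mulr_gt0.
have E u : expR (- (t * u ^+ 2)) = (normal_peak s)^-1 * normal_pdf 0 s u.
  rewrite normal_pdfE// mulrA mulVf ?mul1r ?gt_eqF ?normal_peak_gt0//.
  by rewrite /normal_fun s2 invrK subr0 mulNr mulrC.
rewrite (_ : (fun u => _) = (fun u : RM => (normal_peak s)^-1 * normal_pdf 0 s u));
  last exact/funext.
have iN : rintg mu1 (normal_pdf 0 s : RM -> R) by exact: integrable_normal_pdf.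
split; first exact: rintgZ.
rewrite rintZ// /rint /Rintegral integral_normal_pdf mulr1 /normal_peak invrK.
by congr Num.sqrt; rewrite -mulrnAl s2 mulrC.
Qed.

Lemma measurable_gaussian (t : R) :
  measurable_fun setT (fun u : RM => expR (- (t * u ^+ 2))).
Proof.
apply: measurableT_comp => //; apply: measurableT_comp => //.
by apply: measurable_funM => //; exact: measurable_funX.
Qed.

Lemma gaussian_moment_integrable (t : R) : 0 < t ->
  rintg mu1 (fun u : RM => `|u| * expR (- (t * u ^+ 2))).
Proof.
move=> t0; have t20 : 0 < t / 2 by lra.
have [iG _] := gaussian_integral t20.
apply: (rintg_dominated _ (rintgZ (1 + 2 / t) iG)).
  apply: measurable_funM; last exact: measurable_gaussian.
  exact: normr_measurable.
move=> u; rewrite ger0_norm ?mulr_ge0 ?expR_ge0//.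
(* Half of the exponent absorbs the factor |u|. *)
have -> : - (t * u ^+ 2) = - (t / 2 * u ^+ 2) + - (t / 2 * u ^+ 2) by field.
rewrite expRD mulrA ler_pM2r ?expR_gt0// expRN -ler_pdivlMr ?invr_gt0 ?expR_gt0//.
rewrite invrK.
apply: le_trans (_ : _ <= (1 + 2 / t) * (1 + t / 2 * u ^+ 2)) _; last first.
  by rewrite ler_wpM2l ?expR_ge1Dx// addr_ge0// divr_ge0// ltW.
have -> : (1 + 2 / t) * (1 + t / 2 * u ^+ 2) = 1 + u ^+ 2 + (2 / t + t / 2 * u ^+ 2).
  by field; rewrite gt_eqF.
have : 0 <= 2 / t + t / 2 * u ^+ 2.
  by apply: addr_ge0; [rewrite divr_ge0// ltW|rewrite mulr_ge0 ?sqr_ge0// ltW].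
have : `|u| <= 1 + u ^+ 2.
  rewrite -[u ^+ 2]real_normK ?num_real//.
  by have := sqr_ge0 (`|u| - 1); have := normr_ge0 u; nra.
by lra.
Qed.

Lemma hasd_gaussian (t u : R) :
  hasd (fun v => expR (- (t * v ^+ 2))) u (- (2 * t * u * expR (- (t * u ^+ 2)))).
Proof. hasd_by (rewrite /= expr1; ring). Qed.

Let I (t : R) (h : R -> R) (x : R) :=
  rint mu1 (fun u : RM => expR (- (t * u ^+ 2)) * h (u * x)).
Let I1 (t : R) (h : R -> R) (x : R) :=
  rint mu1 (fun u : RM => u * expR (- (t * u ^+ 2)) * h (u * x)).

Lemma measurable_bounded_comp (h : R -> R) x : continuous h ->
  measurable_fun setT (fun u : RM => h (u * x)).
Proof.
move=> ch; apply: (@measurableT_comp _ _ _ _ _ _ (h : RM -> R)) => //.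
  exact: continuous_measurable_fun.
exact: measurable_funM.
Qed.

Let int0 (t : R) (h : R -> R) x : 0 < t -> continuous h -> (forall y, `|h y| <= 1) ->
  rintg mu1 (fun u : RM => expR (- (t * u ^+ 2)) * h (u * x)).
Proof.
move=> t0 ch h1; have [iG _] := gaussian_integral t0.
apply: (rintg_dominated _ iG).
  by apply: measurable_funM; [exact: measurable_gaussian|exact: measurable_bounded_comp].
by move=> u; rewrite normrM ger0_norm ?expR_ge0// ler_piMr ?expR_ge0.
Qed.

Let int1 (t : R) (h : R -> R) x : 0 < t -> continuous h -> (forall y, `|h y| <= 1) ->
  rintg mu1 (fun u : RM => u * expR (- (t * u ^+ 2)) * h (u * x)).
Proof.
move=> t0 ch h1; apply: (rintg_dominated _ (gaussian_moment_integrable t0)).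
  apply: measurable_funM; last exact: measurable_bounded_comp.
  by apply: measurable_funM; [exact: measurable_id|exact: measurable_gaussian].
move=> u; rewrite !normrM [ `|expR _| ]ger0_norm ?expR_ge0// ler_piMr//.
Qed.

Let dI (t : R) (h h' : R -> R) x : 0 < t -> continuous h -> (forall y, `|h y| <= 1) ->
  (forall y, `|h' y| <= 1) -> (forall y, hasd h y (h' y)) -> hasd (I t h) x (I1 t h' x).
Proof.
move=> t0 ch h1 h1' dh.
pose f (x : R) (u : RM) := expR (- (t * u ^+ 2)) * h (u * x).
have df z u : hasd (f ^~ u) z (u * expR (- (t * u ^+ 2)) * h' (u * z)).
  eapply hasd_eq; first apply: hasdM; first exact: hasd_cst.
    apply: (hasd_comp (f := h)); first exact: dh.
    by apply: hasdM; [exact: hasd_cst|exact: hasd_id].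
  by rewrite /=; ring.
have pE z u : partial1of2 f z u = u * expR (- (t * u ^+ 2)) * h' (u * z).
  by rewrite partial1of2E; have [_] := df z u.
have xI : `]x - 1, x + 1[%classic x by rewrite /= in_itv /= gtrBl ltrDl ltr01.
have G0 (u : RM) : 0 <= `|u| * expR (- (t * u ^+ 2)) by rewrite mulr_ge0 ?expR_ge0.
have H1 z : `]x - 1, x + 1[%classic z -> mu1.-integrable setT (EFin \o f z).
  by move=> _; exact: int0.
have H2 z (u : RM) : `]x - 1, x + 1[%classic z -> setT u -> derivable (f ^~ u) z 1.
  by move=> _ _; exact: hasd_derivable (df z u).
have H3 z (u : RM) : `]x - 1, x + 1[%classic z -> setT u ->
    `|partial1of2 f z u| <= `|u| * expR (- (t * u ^+ 2)).
  move=> _ _; rewrite pE !normrM [ `|expR _| ]ger0_norm ?expR_ge0// ler_piMr//.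
have D1 := derivable_under_integral measurableT xI H1 H2 G0
  (gaussian_moment_integrable t0) H3.
have D2 := differentiation_under_integral measurableT xI H1 H2 G0
  (gaussian_moment_integrable t0) H3.
split; first exact: D1.
rewrite -derive1E [LHS]D2; apply: eq_Rintegral => u _; exact: pE.
Qed.

Let cos1 (y : R) : `|cos y| <= 1. Proof. exact: cos_max. Qed.
Let sin1 (y : R) : `|sin y| <= 1. Proof. exact: sin_max. Qed.
Let Nsin1 (y : R) : `|- sin y| <= 1. Proof. by rewrite normrN. Qed.
Let csin : continuous (@sin R). Proof. exact: continuous_sin. Qed.
Let ccos : continuous (@cos R). Proof. exact: continuous_cos. Qed.

Let by_parts (t : R) (h h' : R -> R) x : 0 < t ->
  continuous h -> (forall y, `|h y| <= 1) ->
  continuous h' -> (forall y, `|h' y| <= 1) -> (forall y, hasd h y (h' y)) ->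
  x * I t h' x = 2 * t * I1 t h x.
Proof.
move=> t0 ch h1 ch' h1' dh.
pose F (u : RM) := expR (- (t * u ^+ 2)) * h (u * x).
pose G (u : RM) := x * (expR (- (t * u ^+ 2)) * h' (u * x)) -
   2 * t * (u * expR (- (t * u ^+ 2)) * h (u * x)).
have dF u : hasd F u (G u).
  eapply hasd_eq; first apply: hasdM; first exact: hasd_gaussian.
    apply: (hasd_comp (f := h)); first exact: dh.
    by apply: hasdM; [exact: hasd_id|exact: hasd_cst].
  by rewrite /G /=; ring.
have cg : continuous (fun v : R => expR (- (t * v ^+ 2))).
  by apply: hasd_continuous => v; eexists; exact: hasd_gaussian.
have cx (k : R -> R) : continuous k -> continuous (fun v : R => k (v * x)).
  apply: continuous_compf => v.
  by apply: cvgM; [exact: cvg_id|exact: cvg_cst].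
have cG : continuous G.
  move=> u; apply: cvgB; (apply: cvgM; first exact: cvg_cst); apply: cvgM.
  - exact: cg.
  - exact: cx.
  - by apply: cvgM; [exact: cvg_id|exact: cg].
  - exact: cx.
have iG : rintg mu1 G.
  by apply: rintgB; apply: rintgZ; [exact: int0|exact: int1].
suff : rint mu1 G = 0.
  have i0 := @int0 t h' x t0 ch' h1'; have i1 := @int1 t h x t0 ch h1.
  rewrite /G rintB; [|exact: rintgZ|exact: rintgZ]; rewrite !rintZ//.
  by move=> /eqP; rewrite subr_eq0 => /eqP.
apply: (@rint_flow_derivative _ _ _ _ (fun (h : R) (u : RM) => u + h : RM) F G) => //.
- by move=> a; exact: preserves_shift.
- exact: int0.
- apply: (@measurableT_comp _ _ _ _ _ _ (G : RM -> R)).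
    exact: (continuous_measurable_fun cG).
  by apply: measurable_funD.
move=> u; transitivity (F (u + 1) - F (u + 0)); first by rewrite addr0.
symmetry; apply: (@integral_hasd _ (fun v => G (u + v)) (fun v => F (u + v)) 0 1 ltr01).
- move=> v; apply: hasd_eq; first apply: (hasd_comp (f := F)); first exact: dF.
    by apply: hasdD; [exact: hasd_cst|exact: hasd_id].
  by rewrite add0r mulr1.
- apply: (continuous_compf _ cG) => v.
  by apply: cvgD; [exact: cvg_cst|exact: cvg_id].
Qed.

Let solve_ode (t : R) (f : R -> R) x : 0 < t ->
  (forall y, hasd f y (- (y / (2 * t)) * f y)) ->
  f x = f 0 * expR (- (x ^+ 2 / (4 * t))).
Proof.
move=> t0 df; pose g y := f y * expR (y ^+ 2 / (4 * t)).
have : g x = g 0.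
  apply: hasd0_cst => y; have dfy := df y; eapply hasd_eq; first by rewrite /g; hasd.
  by rewrite /=; field; rewrite gt_eqF.
rewrite /g expr0n /= mul0r expR0 mulr1 => <-.
by rewrite -mulrA -expRD subrr expR0 mulr1.
Qed.

Let C_E (t x : R) : 0 < t ->
  I t cos x = Num.sqrt (pi / t) * expR (- (x ^+ 2 / (4 * t))).
Proof.
move=> t0; have [_ G0] := gaussian_integral t0.
rewrite (@solve_ode t (I t cos) x t0).
  congr (_ * _); rewrite -G0; apply: eq_Rintegral => u _.
  by rewrite mulr0 cos0 mulr1.
move=> y; have D := @dI t cos (fun z => - sin z) y t0 ccos cos1 Nsin1
  (fun z => is_derive_cos z).
apply: hasd_eq D _.
have P := @by_parts t sin cos y t0 csin sin1 ccos cos1 (fun z => is_derive_sin z).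
rewrite (_ : I1 t (fun z => - sin z) y = - I1 t sin y); last first.
  rewrite /I1 -rintN; last exact: int1.
  by apply: eq_Rintegral => u _; rewrite mulrN.
apply: (@mulfI _ (2 * t)); first by rewrite mulf_neq0// gt_eqF.
by rewrite mulrN -P; field; rewrite gt_eqF.
Qed.

Let S_E (t x : R) : 0 < t -> I t sin x = 0.
Proof.
move=> t0; rewrite (@solve_ode t (I t sin) x t0).
  rewrite (_ : I t sin 0 = 0) ?mul0r// /I -[RHS](rint0 mu1).
  by apply: eq_Rintegral => u _; rewrite mulr0 sin0 mulr0.
move=> y; have D := @dI t sin cos y t0 csin sin1 cos1 (fun z => is_derive_sin z).
have cNs : continuous (fun z : R => - sin z).
  by move=> z; apply: cvgN; exact: csin.
apply: hasd_eq D _.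
have P := @by_parts t cos (fun z => - sin z) y t0 ccos cos1 cNs Nsin1
  (fun z => is_derive_cos z).
rewrite (_ : I t (fun z => - sin z) y = - I t sin y) in P; last first.
  rewrite /I -rintN; last exact: int0.
  by apply: eq_Rintegral => u _; rewrite mulrN.
apply: (@mulfI _ (2 * t)); first by rewrite mulf_neq0// gt_eqF.
by rewrite -P; field; rewrite gt_eqF.
Qed.

(** Differentiation under the integral sign and integration by parts show that the
    real and imaginary parts of the transform satisfy f' x = - x / (2 t) f x. *)
Lemma gaussian_fourier (t x : R) : 0 < t ->
  let g (u : RM) := (expR (- (t * u ^+ 2)))%:C * cexp (- 'i * (u * x)%:C) in
  cintg mu1 g /\
  cint mu1 g = (Num.sqrt (pi / t) * expR (- (x ^+ 2 / (4 * t))))%:C.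
Proof.
move=> t0 g.
have RE : (fun u => complex.Re (g u)) =
   (fun u : RM => expR (- (t * u ^+ 2)) * cos (u * x)).
  by apply/funext => u; rewrite /g cexp_Ni cReM /= mul0r subr0.
have IE : (fun u => complex.Im (g u)) =
   (fun u : RM => - (expR (- (t * u ^+ 2)) * sin (u * x))).
  by apply/funext => u; rewrite /g cexp_Ni cImM /= mul0r addr0 mulrN.
rewrite /cintg /cint RE IE; split.
  by split; [exact: int0|apply: rintgN; exact: int0].
apply: complexP; first exact: C_E.
rewrite /= rintN; last exact: int0.
by rewrite -[rint _ _]/(I t sin x) S_E// oppr0.
Qed.

Lemma gaussian_moment_fourier (t x : R) : 0 < t ->
  let g (u : RM) := (u * expR (- (t * u ^+ 2)))%:C * cexp (- 'i * (u * x)%:C) in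
  cintg mu1 g /\
  cint mu1 g =
  - 'i * (x / (2 * t) * (Num.sqrt (pi / t) * expR (- (x ^+ 2 / (4 * t)))))%:C.
Proof.
move=> t0 g.
have RE : (fun u => complex.Re (g u)) =
   (fun u : RM => u * expR (- (t * u ^+ 2)) * cos (u * x)).
  by apply/funext => u; rewrite /g cexp_Ni cReM /= mul0r subr0.
have IE : (fun u => complex.Im (g u)) =
   (fun u : RM => - (u * expR (- (t * u ^+ 2)) * sin (u * x))).
  by apply/funext => u; rewrite /g cexp_Ni cImM /= mul0r addr0 mulrN.
have t20 : 2 * t != 0 by rewrite mulf_neq0// gt_eqF.
have cNs : continuous (fun z : R => - sin z).
  by move=> z; apply: cvgN; exact: csin.
have P1 := @by_parts t sin cos x t0 csin sin1 ccos cos1 (fun z => is_derive_sin z).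
have P2 := @by_parts t cos (fun z => - sin z) x t0 ccos cos1 cNs Nsin1
  (fun z => is_derive_cos z).
rewrite (_ : I t (fun z => - sin z) x = 0) ?mulr0 in P2; last first.
  rewrite -oppr0 -(S_E x t0) /I -rintN; last exact: int0.
  by apply: eq_Rintegral => u _; rewrite mulrN.
rewrite /cintg /cint RE IE; split.
  by split; [exact: int1|apply: rintgN; exact: int1].
apply: complexP; rewrite !(cReM, cImM, cReN, cImN) /=.
  rewrite -[LHS]/(I1 t cos x); move: P2 => /esym/eqP.
  by rewrite mulf_eq0 (negbTE t20) => /eqP ->; ring.
rewrite rintN; last exact: int1.
rewrite -[rint _ _]/(I1 t sin x); apply: (mulfI t20).
by rewrite mulrN -P1 C_E//; field; rewrite gt_eqF.
Qed.

End Gaussian.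

(** * Integrals over the half-line *)

Section HalfLine.
Variable R : realType.
Local Notation mu1 := (@lebesgue_measure R).
Local Notation RM := (measurableTypeR R).

Definition hpos (t : R) : R := \1_(`]0, +oo[%classic : set R) t.

Lemma hposE t : hpos t = (0 < t)%R%:R.
Proof. by rewrite /hpos indicE mem_setE in_itv /= andbT. Qed.

Lemma hpos_ge0 t : 0 <= hpos t.
Proof. by rewrite hposE ler0n. Qed.

Lemma measurable_hpos : measurable_fun setT (hpos : RM -> R).
Proof. exact: measurable_indic. Qed.

Lemma rint_hpos (f : RM -> R) :
  rint mu1 (fun t => hpos t * f t) = Rintegral mu1 `]0, +oo[ f.
Proof.
rewrite Rintegral_mkcond; apply: eq_Rintegral => t _.
by rewrite /= patchE /hpos indicE; case: ifP => _; rewrite ?mul1r ?mul0r.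
Qed.

(** The integrand of the Gamma function at (k + 2) / 2, with the half-integral
    power written as a power of the square root. *)
Definition gamma_fun (k : nat) (r t : R) : R := Num.sqrt t ^+ k * expR (- (t * r)).

Lemma gamma_fun_ge0 k r t : 0 <= gamma_fun k r t.
Proof. by rewrite mulr_ge0 ?expR_ge0// exprn_ge0. Qed.

Lemma measurable_gamma_fun k r : measurable_fun setT (gamma_fun k r : RM -> R).
Proof.
apply: measurable_funM.
  by apply: measurable_funX; exact: continuous_measurable_fun (@sqrt_continuous R).
by do 2 apply: measurableT_comp => //; exact: measurable_funM.
Qed.

(** Domination by an exponential density: half of the exponent absorbs the power,
    because e^x >= 1 + x. *)
Lemma gamma_fun_integrable k r : 0 < r ->
  rintg mu1 (fun t : RM => hpos t * gamma_fun k r t).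
Proof.
move=> r0; have r20 : 0 < r / 2 by rewrite divr_gt0.
have iE : rintg mu1 (exponential_pdf (r / 2) : RM -> R).
  exact: integrable_exponential_pdf.
pose K : R := k.+1%:R; have K0 : 0 < K by rewrite ltr0n.
pose c := 1 + 2 * K / r; have c0 : 0 <= c by rewrite addr_ge0// divr_ge0 ?ltW ?mulr_gt0.
apply: (rintg_dominated _ (rintgZ (c ^+ k.+1 / (r / 2)) iE)).
  by apply: measurable_funM; [exact: measurable_hpos|exact: measurable_gamma_fun].
move=> t; rewrite ger0_norm ?mulr_ge0 ?hpos_ge0 ?gamma_fun_ge0//.
rewrite hposE; have [t0|t0] := ltrP 0 (t : R); last first.
  rewrite mul0r; apply: mulr_ge0; last by rewrite exponential_pdf_ge0 ?ltW.
  by rewrite divr_ge0 ?exprn_ge0// ltW.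
rewrite mul1r exponential_pdfE; last exact: ltW.
rewrite mulrA divfK ?gt_eqF//.
have Kt (q t' : R) : 0 < q -> - (t' * r) = - (q * (t' * r / (2 * q))) + (- (r / 2) * t').
  by move=> q0; field; rewrite gt_eqF.
rewrite /gamma_fun (Kt K)// expRD.
set e1 := expR (- (K * _)); set e2 := expR _.
have e20 : 0 < e2 by exact: expR_gt0.
rewrite [X in X <= _]mulrA (ler_pM2r e20) /e1 {e1 e20 e2}.
rewrite expRN ler_pdivrMr ?expR_gt0// expRM_natl -exprMn.
have t10 : 0 <= 1 + t by rewrite addr_ge0// ltW.
have tk : Num.sqrt t ^+ k <= (1 + t) ^+ k.+1.
  apply: (@le_trans _ _ ((1 + t) ^+ k)); last first.
    by rewrite exprS ler_peMl ?exprn_ge0// lerDl ltW.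
  apply: lerXn2r; rewrite ?nnegrE ?sqrtr_ge0//.
  rewrite -[leRHS]ger0_norm// -sqrtr_sqr ler_sqrt ?sqr_ge0//; nra.
apply: le_trans tk _; apply: lerXn2r; rewrite ?nnegrE ?mulr_ge0 ?expR_ge0//.
apply: (@le_trans _ _ (c * (1 + t * r / (2 * K)))); last first.
  by rewrite ler_wpM2l// expR_ge1Dx.
rewrite /c (_ : _ * _ = 1 + t + (t * r / (2 * K) + 2 * K / r)); last first.
  by field; rewrite !gt_eqF.
rewrite lerDl addr_ge0// divr_ge0// ?mulr_ge0// ltW//.
Qed.

(** Scaling: the substitution t |-> t r. *)
Lemma rint_gamma_fun k r : 0 < r ->
  rint mu1 (fun t : RM => hpos t * gamma_fun k r t) =
  Gamma (k.+2%:R / 2) / Num.sqrt r ^+ k.+2.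
Proof.
move=> r0; rewrite rint_hpos.
have sr0 : Num.sqrt r ^+ k.+2 != 0 by rewrite expf_neq0// gt_eqF// sqrtr_gt0.
apply: (canRL (mulfK sr0)).
have i0 := gamma_fun_integrable k r0.
have -> : Gamma (k.+2%:R / 2) = Rintegral mu1 `]0, +oo[ (gamma_fun k 1).
  apply: eq_Rintegral => t; rewrite inE /= in_itv /= andbT => t0.
  rewrite /gamma_fun mulr1; congr (_ * _).
  rewrite -powR12_sqrt ?ltW// -powR_mulrn ?powR_ge0// -powRrM.
  by congr (_ `^ _); rewrite -[k.+2%:R]natr1 -[k.+1%:R]natr1; field.
have S : (\int[mu1]_(t in `[0%R, +oo[) (gamma_fun k 1 t)%:E =
   \int[mu1]_(t in `[0%R, +oo[) (Num.sqrt r ^+ k.+2 * gamma_fun k r t)%:E)%E.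
  have dr : (fun t : R => t * r)^`()%classic = cst r.
    apply/funext => t; apply: hasd_derive; hasd_by ring.
  have cr : continuous (fun t : R => t * r).
    by apply: hasd_continuous => t; eexists; hasd.
  have := @increasing_ge0_integration_by_substitutiony R (fun t => t * r) (gamma_fun k 1) 0.
  rewrite mul0r dr => ->.
  - apply: eq_integral => t; rewrite inE /= in_itv /= andbT => t0; congr EFin.
    rewrite !fctE /gamma_fun mulr1 sqrtrM// exprMn !exprS.
    by rewrite -[X in _ * X = _](sqr_sqrtr (ltW r0)); ring.
  - by move=> x y _ _ xy; rewrite ltr_pM2r.
  - by move=> x _; exact: cvg_cst.
  - exact: is_cvg_cst.
  - exact: is_cvg_cst.
  - split; first by move=> x _; apply: hasd_derivable; hasd.
    by apply: cvg_at_right_filter; exact: cr.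
  - by apply: gt0_cvgMly => //; exact: cvg_id.
  - apply: continuous_subspaceT => t; apply: cvgM.
      by apply: (@continuous_compf _ Num.sqrt (fun x => x ^+ k) _ _ t);
        [exact: sqrt_continuous|exact: exprn_continuous].
    by apply: (hasd_continuous (f := fun t => expR (- (t * 1)))) => u; eexists; hasd.
  - by move=> t _; exact: gamma_fun_ge0.
have O (f : R -> R) : measurable_fun setT (f : RM -> R) ->
    Rintegral mu1 `]0, +oo[ f = fine (\int[mu1]_(t in `[0%R, +oo[) (f t)%:E)%E.
  move=> mf; congr fine; apply: integral_itv_obnd_cbnd.
  exact/measurable_EFinP/measurable_funTS.
rewrite (O _ (measurable_gamma_fun k 1)) S.
rewrite -(O (fun t => Num.sqrt r ^+ k.+2 * gamma_fun k r t)); last first.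
  by apply: measurable_funM => //; exact: measurable_gamma_fun.
rewrite mulrC -(rint_hpos (gamma_fun k r)) -(rint_hpos (fun t => _ * gamma_fun k r t)).
by rewrite -rintZ//; congr rint; apply/funext => t; rewrite mulrCA.
Qed.

(** The integrand is positive, and bounded below on [1, 2]. *)
Lemma Gamma_half_gt0 k : 0 < Gamma (k.+2%:R / 2 : R).
Proof.
have := rint_gamma_fun k ltr01; rewrite sqrtr1 expr1n divr1 => <-.
have i1 : rintg mu1 (\1_(`[1, 2]%classic : set R) : RM -> R) by exact: integrable_indic_itv.
have -> : 0 < rint mu1 (fun t : RM => hpos t * gamma_fun k 1 t) =
  (0 < rint mu1 (fun t : RM => hpos t * gamma_fun k 1 t)) by [].
apply: (@lt_le_trans _ _ (rint mu1 (fun t : RM => expR (-2) * \1_(`[1, 2]%classic : set R) t))).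
  rewrite rintZ// /rint /Rintegral integral_indic//= setIT lebesgue_measure_itv/=.
  rewrite lte_fin ltr1n /= mulr_gt0 ?expR_gt0//; lra.
apply: le_Rintegral => //; [exact: rintgZ|exact: gamma_fun_integrable|].
move=> t _; rewrite indicE mem_setE in_itv /=.
have [/andP[t1 t2]|_] := boolP (1 <= t <= 2); last first.
  by rewrite mulr0 mulr_ge0 ?hpos_ge0// gamma_fun_ge0.
rewrite hposE (lt_le_trans ltr01 t1) mulr1 mul1r /gamma_fun mulr1.
rewrite -[leLHS]mul1r ler_pM ?expR_ge0 ?ler_expR ?lerN2//.
by apply: exprn_ege1; rewrite -sqrtr1 ler_sqrt// (le_trans ler01).
Qed.

Lemma measurable_funV d (S : measurableType d) (f : S -> R) : measurable_fun setT f ->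
  measurable_fun setT (fun t => (f t)^-1).
Proof.
move=> mf; apply: (@measurableT_comp _ _ _ _ _ _ (fun t : RM => t^-1 : R)) => //.
rewrite (_ : (fun t => t^-1) = (fun t : RM => hpos t * (t `^ (-1) : R) +
    - (hpos (- t) * ((- t) `^ (-1) : R)))).
  apply: measurable_funD.
    by apply: measurable_funM; [exact: measurable_hpos|exact: measurable_powR].
  have mN : measurable_fun setT (fun t : RM => - t : RM) by exact: oppr_measurable.
  apply: measurableT_comp => //; apply: measurable_funM.
    exact: measurableT_comp measurable_hpos mN.
  exact: (measurableT_comp (measurable_powR (-1)) mN).
apply/funext => t; rewrite !hposE oppr_gt0.
case: (ltgtP 0 (t : R)) => [t0|t0|<-].
- by rewrite mul1r mul0r subr0 powR_inv1// ltW.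
- by rewrite mul0r mul1r add0r powR_inv1 ?oppr_ge0 ?ltW// invrN opprK.
- by rewrite !mul0r subr0 invr0.
Qed.

(** d/dt e^(-a/t) = a t^(-2) e^(-a/t). *)
Definition inverse_gaussian (a t : R) : R := t ^- 2 * expR (- (a / t)).

Lemma inverse_gaussian_ge0 a t : 0 <= inverse_gaussian a t.
Proof. by rewrite mulr_ge0 ?expR_ge0// invr_ge0 sqr_ge0. Qed.

Lemma measurable_inverse_gaussian a :
  measurable_fun setT (inverse_gaussian a : RM -> R).
Proof.
apply: measurable_funM; first by apply: measurable_funV; exact: measurable_funX.
by do 2 apply: measurableT_comp => //; apply: measurable_funM => //; exact: measurable_funV.
Qed.

Let F a (t : R) : R := if 0 < t then a^-1 * expR (- (a / t)) else 0.

Let dF a t : 0 < a -> 0 < t -> hasd (F a) t (inverse_gaussian a t).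
Proof.
move=> a0 t0; rewrite /hasd; apply: (@near_eq_is_derive R R R (fun t => a^-1 * expR (- (a / t))) (F a) t 1).
  by near=> u; rewrite /F ifT//; near: u; exact: lt_nbhsr.
have dV : hasd (fun u : R => u^-1) t (- t ^- 2).
  have tn0 : t != 0 by rewrite gt_eqF.
  apply: hasd_eq (@is_deriveV R (fun u => u) t 1 1 tn0 (is_derive_id _ _)) _.
  by rewrite /GRing.scale /= mulr1.
eapply hasd_eq; first by rewrite /=; hasd.
by rewrite /inverse_gaussian /=; field; rewrite !gt_eqF.
Unshelve. all: by end_near. Qed.

Let expRN_le (x : R) : 0 < x -> expR (- x) <= 6 * x ^- 3.
Proof.
move=> x0; have := @expR_ge1Dxn _ x 2 (ltW x0).
rewrite expRN -[6 * _]invrK invfM invrK => H.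
rewrite lef_pV2 ?posrE ?expR_gt0 ?mulr_gt0 ?invr_gt0 ?exprn_gt0//.
apply: le_trans H; rewrite (_ : 3`! = 6)%N//; rewrite mulrC; lra.
Qed.

(** The antiderivative e^(-a/t) / a tends to 0 at 0 and to 1 / a at infinity. The
    cubic bound on e^(-x) makes the integrand continuous at 0. *)
Lemma inverse_gaussian_integral a : 0 < a ->
  rintg mu1 (fun t : RM => hpos t * inverse_gaussian a t) /\
  rint mu1 (fun t : RM => hpos t * inverse_gaussian a t) = a^-1.
Proof.
move=> a0; have mi := measurable_inverse_gaussian a.
have cvg0 (f : R -> R) C : f 0 = 0 -> (forall t, 0 < t -> 0 <= f t <= C * t) ->
    f t @[t --> 0^'+] --> f 0.
  move=> f0 fC; rewrite f0.
  apply: (@squeeze_cvgr _ _ _ _ (cst 0) (fun t => C * t)).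
  - by near=> t; apply: fC; near: t; exact: nbhs_right_gt.
  - exact: cvg_cst.
  - rewrite -[X in _ --> X](mulr0 C); apply: cvgM; first exact: cvg_cst.
    by apply: cvg_at_right_filter; exact: cvg_id.
have I : (\int[mu1]_(t in `[0%R, +oo[) (inverse_gaussian a t)%:E = (a^-1)%:E)%E.
  rewrite (@ge0_continuous_FTC2y _ _ (F a) _ a^-1).
  - by rewrite /F ltxx sube0.
  - by move=> t _; exact: inverse_gaussian_ge0.
  - apply/continuous_within_itvcyP; split.
      move=> t; rewrite in_itv /= andbT => t0.
      apply: cvgM.
        apply: cvgV; first by rewrite expf_neq0// gt_eqF.
        exact: exprn_continuous.
      apply: (@continuous_comp _ _ _ (fun t : R => - (a / t)) expR); last exact: continuous_expR.
      apply: cvgN; apply: cvgM; first exact: cvg_cst.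
      by apply: cvgV; [rewrite gt_eqF|exact: cvg_id].
    apply: (cvg0 _ (6 / a ^+ 3)).
      by rewrite /inverse_gaussian expr0n /= invr0 mul0r.
    move=> t t0; rewrite inverse_gaussian_ge0 /=.
    have := expRN_le (divr_gt0 a0 t0); rewrite -(ler_pM2l (x := t ^- 2)) ?invr_gt0 ?exprn_gt0//.
    move=> /le_trans; apply; rewrite le_eqVlt; apply/orP; left; apply/eqP.
    by field; rewrite !gt_eqF.
  - have : a^-1 * expR (- (a * (t^-1))) @[t --> +oo%R] --> a^-1 * expR (- (a * 0)).
      apply: cvgM; first exact: cvg_cst.
      apply: (@cvg_comp _ _ _ (fun t : R => - (a * t^-1)) expR _ (nbhs (- (a * 0)))).
        apply: cvgN; apply: cvgM; first exact: cvg_cst.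
        by apply/gtr0_cvgV0; [exact: nbhs_pinfty_gt|exact: cvg_id].
      exact: continuous_expR.
    rewrite mulr0 oppr0 expR0 mulr1; apply: cvg_trans; apply: near_eq_cvg.
    by near=> t; rewrite /F ifT//; near: t; exact: nbhs_pinfty_gt.
  - by move=> t t0; exact: hasd_derivable (dF a0 t0).
  - apply: (cvg0 _ (a^-1 * a^-1)); first by rewrite /F ltxx.
    move=> t t0; rewrite /F t0; apply/andP; split.
      by apply: mulr_ge0; [rewrite invr_ge0 ltW|exact: expR_ge0].
    rewrite -mulrA.
    rewrite ler_pM2l ?invr_gt0//.
    have : expR (- (a / t)) <= (a / t)^-1.
      rewrite expRN lef_pV2 ?posrE ?expR_gt0 ?divr_gt0//.
      by apply: le_trans (expR_ge1Dx _); rewrite lerDr.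
    by move=> /le_trans; apply; rewrite invf_div mulrC.
  - by move=> t; rewrite in_itv /= andbT => t0; exact: hasd_derive (dF a0 t0).
have E : (\int[mu1]_t (hpos t * inverse_gaussian a t)%:E = (a^-1)%:E)%E.
  rewrite -I -integral_itv_obnd_cbnd; last exact/measurable_EFinP/measurable_funTS.
  rewrite [RHS]integral_mkcond; apply: eq_integral => t _.
  by rewrite /hpos patchE indicE; case: ifP => _; rewrite ?mul1r ?mul0r.
split; last by rewrite /rint /Rintegral E.
apply/integrableP; split.
  by apply/measurable_EFinP/measurable_funM => //; exact: measurable_hpos.
apply: (@le_lt_trans _ _ (a^-1)%:E); last exact: ltry.
rewrite -E; apply: ge0_le_integral => //.
- by apply/measurableT_comp/measurable_EFinP/measurable_funM => //; exact: measurable_hpos.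
- by apply/measurable_EFinP/measurable_funM => //; exact: measurable_hpos.
- move=> t _; rewrite /= ger0_norm// mulr_ge0 ?hpos_ge0//; exact: inverse_gaussian_ge0.
Unshelve. all: by end_near. Qed.

End HalfLine.

(** * Singular weights with finite integral *)

Section Weights.
Variable R : realType.
Local Notation mu1 := (@lebesgue_measure R).
Local Notation RM := (measurableTypeR R).

Definition unit_power (a u : R) : R := \1_(`]0, 1]%classic : set R) u * u `^ (- a).

Lemma unit_power_ge0 a u : 0 <= unit_power a u.
Proof. by rewrite mulr_ge0 ?powR_ge0// indicE ler0n. Qed.

Lemma measurable_unit_power a : measurable_fun setT (unit_power a : RM -> R).
Proof.
by apply: measurable_funM; [exact: measurable_indic|exact: measurable_powR].
Qed.

(** Monotone convergence over the intervals [1 / (k + 2), 1]. *)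
Lemma unit_power_integrable a : 0 < a < 1 -> rintg mu1 (unit_power a : RM -> R).
Proof.
move=> /andP[a0 a1]; have b0 : 0 < 1 - a by rewrite subr_gt0.
pose F (k : nat) : set RM := `[k.+2%:R^-1, 1]%classic.
have Fsub k : (k.+2%:R^-1 : R) < 1 by rewrite invf_lt1// ltr1n.
have ndF : nondecreasing_seq F.
  move=> i j ij; apply/subsetPset => u; rewrite /F /= !in_itv /= => /andP[+ ->].
  rewrite andbT; apply: le_trans.
  by rewrite lef_pV2 ?posrE// ler_nat !ltnS.
have UF : \bigcup_k F k = `]0, 1]%classic.
  apply/seteqP; split=> u; rewrite /F /=.
    move=> [k _ /=]; rewrite !in_itv /= => /andP[+ ->]; rewrite andbT.
    by apply: lt_le_trans; rewrite invr_gt0.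
  rewrite in_itv /= => /andP[u0 u1].
  have [k] := ltr_add_invr u0; rewrite add0r => ku; exists k => //=.
  rewrite in_itv /= u1 andbT ltW// (le_lt_trans _ ku)//.
  by rewrite lef_pV2 ?posrE// ler_nat.
have mp (D : set RM) : measurable_fun D (fun u : RM => (u `^ (- a))%:E).
  by apply/measurable_EFinP; apply: measurable_funTS; exact: measurable_powR.
have bound k : (\int[mu1]_(u in F k) (u `^ (- a))%:E <= ((1 - a)^-1)%:E)%E.
  have E0 x : 0 < x -> hasd (fun x => (1 - a)^-1 * x `^ (1 - a)) x (x `^ (- a)).
    move=> x0; apply: hasd_eq; first apply: hasdM; first exact: hasd_cst.
      exact: (is_derive1_powR (1 - a) x0).
    rewrite mul0r add0r mulrA mulVf ?gt_eqF// mul1r.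
    by congr (_ `^ _); ring.
  have c0 x : 0 < x -> {for x, continuous (fun x : R => (1 - a)^-1 * x `^ (1 - a))}.
    move=> x0; apply/differentiable_continuous/derivable1_diffP.
    exact: hasd_derivable (E0 x x0).
  have k0 : 0 < (k.+2%:R^-1 : R) by rewrite invr_gt0.
  rewrite (@continuous_FTC2 _ (fun u => u `^ (- a))
    (fun x => (1 - a)^-1 * x `^ (1 - a)))//.
  - rewrite powR1 mulr1 -EFinB lee_fin gerBl.
    by rewrite mulr_ge0 ?powR_ge0// invr_ge0 ltW.
  - apply: continuous_in_subspaceT => x; rewrite inE /= in_itv /= => /andP[kx _].
    apply/differentiable_continuous/derivable1_diffP.
    have := is_derive1_powR (- a) (lt_le_trans k0 kx).
    by case.
  - split => [x||].
    + rewrite in_itv /= => /andP[kx _].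
      exact: hasd_derivable (E0 x (lt_trans k0 kx)).
    + by apply: cvg_at_right_filter; exact: c0.
    + by apply: cvg_at_left_filter; exact: c0.
  - move=> x; rewrite in_itv /= => /andP[kx _].
    exact: hasd_derive (E0 x (lt_trans k0 kx)).
have cvgF := @ge0_nondecreasing_set_cvg_integral _ _ _ F
  (fun u => (u `^ (- a))%:E) mu1 ndF (fun k => measurable_itv _) (fun k => mp _)
  (fun k u _ => ltac:(rewrite lee_fin; exact: powR_ge0)).
apply/integrableP; split.
  by apply/measurable_EFinP; exact: measurable_unit_power.
apply: (@le_lt_trans _ _ ((1 - a)^-1)%:E); last exact: ltry.
rewrite (_ : (\int[_]_x _)%E = (\int[mu1]_(u in \bigcup_k F k) (u `^ (- a))%:E)%E).
  rewrite -(cvg_lim _ cvgF)//; apply: lime_le; first by apply/cvg_ex; eexists; exact: cvgF.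
  by apply: nearW => k; exact: bound.
rewrite UF [RHS]integral_mkcond; apply: eq_integral => u _.
rewrite /= ger0_norm ?unit_power_ge0// /unit_power patchE indicE.
by case: ifP => _; rewrite ?mul1r ?mul0r.
Qed.

Lemma preserves_reflect (s : R) : preserves mu1 (fun u : RM => s - u : RM).
Proof.
have [ms pE] := @preserves_shift R (- s).
have mN : measurable_fun setT (fun t : RM => - t : RM) by exact: oppr_measurable.
have E : (fun u : RM => s - u : RM) = (fun u : RM => - u : RM) \o (fun u : RM => u + - s : RM).
  by apply/funext => u /=; rewrite opprB.
rewrite E; split; first exact: measurableT_comp.
move=> A mA; rewrite comp_preimage pE.
  exact: lebesgue_measureN.
by rewrite -[X in measurable X]setTI; exact: mN.
Qed.

Definition inv1sqr (u : R) : R := (1 + u ^+ 2)^-1.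

Lemma inv1sqr_gt0 u : 0 < inv1sqr u.
Proof. by rewrite invr_gt0 ltr_pwDl// sqr_ge0. Qed.

Lemma inv1sqr_le1 u : inv1sqr u <= 1.
Proof. by rewrite invf_le1 ?lerDl ?sqr_ge0// ltr_pwDl// sqr_ge0. Qed.

Lemma continuous_inv1sqr : continuous inv1sqr.
Proof. exact: continuous_oneDsqrV. Qed.

Lemma inv1sqr_integrable : rintg mu1 (inv1sqr : RM -> R).
Proof.
apply/integrableP; split.
  by apply/measurable_EFinP; apply: continuous_measurable_fun; exact: continuous_inv1sqr.
rewrite (_ : (\int[_]_x _)%E = (\int[mu1]_x (inv1sqr x)%:E)%E); last first.
  by apply: eq_integral => u _; rewrite /= ger0_norm// ltW// inv1sqr_gt0.
rewrite ge0_symfun_integralT; first last.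
- by move=> u; rewrite /= /inv1sqr sqrrN.
- exact: continuous_inv1sqr.
- by move=> u; rewrite ltW// inv1sqr_gt0.
rewrite -set_itvcy integral0y_oneDsqr; exact: ltry.
Qed.

(** A weight that dominates |u - s|^(-a) / (1 + u^2) off s. *)
Definition sing_fin (a s u : R) : R :=
  unit_power a (u - s) + unit_power a (s - u) + inv1sqr u.

(** Infinite at s, where |u - s|^(-a) blows up: the product of these weights over
    the coordinates is then infinite on the hyperplanes x_j = v_j, and bounds the
    singular kernels there too. *)
Definition sing_weight (a s u : R) : \bar R :=
  ((sing_fin a s u)%:E + (if u == s then +oo else 0))%E.

Lemma sing_fin_gt0 a s u : 0 < sing_fin a s u.
Proof. by rewrite ltr_wpDl ?inv1sqr_gt0// addr_ge0 ?unit_power_ge0. Qed.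

Lemma sing_fin_integrable a s : 0 < a < 1 -> rintg mu1 (sing_fin a s : RM -> R).
Proof.
move=> a01; apply: rintgD; last exact: inv1sqr_integrable.
have iU := unit_power_integrable a01.
apply: rintgD; first exact: (rintg_preserves (preserves_shift (- s)) iU).
exact: (rintg_preserves (preserves_reflect s) iU).
Qed.

Lemma sing_weight_gt0 a s u : (0 < sing_weight a s u)%E.
Proof.
rewrite /sing_weight; case: ifP => _; last by rewrite adde0 lte_fin sing_fin_gt0.
by rewrite addey.
Qed.

Lemma sing_weight_center a s : sing_weight a s s = +oo%E.
Proof. by rewrite /sing_weight eqxx addey. Qed.

Lemma sing_weight_ge0 a s u : (0 <= sing_weight a s u)%E.
Proof. exact/ltW/sing_weight_gt0. Qed.

Lemma measurable_sing_weight a s : 0 < a < 1 ->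
  measurable_fun setT (sing_weight a s : RM -> \bar R).
Proof.
move=> a01; apply: emeasurable_funD.
  exact: measurable_int (sing_fin_integrable s a01).
apply: measurable_fun_ifT => //.
apply: (measurable_fun_bool true).
rewrite setTI (_ : _ @^-1` _ = [set s])//.
by apply/seteqP; split => u /= /eqP.
Qed.

Lemma sing_weight_lty a s : 0 < a < 1 -> (\int[mu1]_u sing_weight a s u < +oo)%E.
Proof.
move=> a01; have iS := sing_fin_integrable s a01.
rewrite (_ : (\int[_]_u _)%E = (\int[mu1]_(u in ~` [set s]) (sing_fin a s u)%:E)%E).
  have := integrable_lty measurableT iS; apply: le_lt_trans.
  apply: ge0_subset_integral => //.
  - by apply: measurableC.
  - exact: measurable_int iS.
  - by move=> u _; rewrite lee_fin ltW// sing_fin_gt0.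
rewrite -[in LHS](setvU [set s]) ge0_integral_setU//=.
- rewrite integral_set1 adde0; apply: eq_integral => u; rewrite inE /= => us.
  by rewrite /sing_weight ifF ?adde0//; exact/eqP.
- by apply: measurableC.
- by rewrite setvU; exact: measurable_sing_weight.
- by move=> u _; exact: sing_weight_ge0.
- by apply/disj_setPS => u [].
Qed.

Lemma sing_weight_bound a s u : 0 < a -> u != s ->
  ((`|u - s| `^ (- a) * inv1sqr u)%:E <= sing_weight a s u)%E.
Proof.
move=> a0 us; rewrite /sing_weight (negbTE us) adde0 lee_fin.
have us0 : 0 < `|u - s| by rewrite normr_gt0 subr_eq0.
have q0 := inv1sqr_gt0 u.
have [le1|gt1] := leP `|u - s| 1.
  apply: (@le_trans _ _ (`|u - s| `^ (- a))).
    by rewrite ler_piMr ?powR_ge0 ?inv1sqr_le1.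
  have [us1|us1] := leP 0 (u - s).
    rewrite ger0_norm// in us0 le1 *.
    rewrite /sing_fin -addrA; apply: ler_wpDr.
      by apply: addr_ge0; [exact: unit_power_ge0|exact: ltW].
    by rewrite /unit_power indicE mem_setE in_itv /= us0 le1 mul1r.
  rewrite ltr0_norm// opprB in us0 le1 *.
  rewrite /sing_fin (addrC (unit_power a (u - s))) -addrA; apply: ler_wpDr.
    by apply: addr_ge0; [exact: unit_power_ge0|exact: ltW].
  by rewrite /unit_power indicE mem_setE in_itv /= us0 le1 mul1r.
apply: (@le_trans _ _ (inv1sqr u)); last first.
  by rewrite /sing_fin ler_wpDl ?addr_ge0 ?unit_power_ge0.
apply: ler_piMl; first exact: ltW.
rewrite powRN invf_le1 ?powR_gt0//.
by rewrite -(powRr0 `|u - s|); apply: ler_powR; exact: ltW.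
Qed.

Lemma prod_lee m (f : 'I_m -> R) (g : 'I_m -> \bar R) :
  (forall j, 0 <= f j) -> (forall j, (f j)%:E <= g j)%E ->
  ((\prod_j f j)%:E <= \big[*%E/1%E]_j g j)%E.
Proof.
move=> f0 fg; suff : 0 <= \prod_j f j /\ ((\prod_j f j)%:E <= \big[*%E/1%E]_j g j)%E.
  by case.
apply: (big_ind2 (fun (x : R) (y : \bar R) => 0 <= x /\ (x%:E <= y)%E)) => //.
  move=> x1 y1 x2 y2 [x10 xy1] [x20 xy2]; split; first exact: mulr_ge0.
  by rewrite EFinM lee_pmul.
Qed.

(** Each coordinate is at most the norm, so |x - v|^(-a m) is at most the
    product of the |x_j - v_j|^(-a). *)
Lemma prod_sing_weight m (a : R) (x v : 'rV[R]_m) : 0 < a ->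
  (((enorm (x - v) `^ (a * m%:R))^-1 * \prod_j inv1sqr (x ord0 j))%:E <=
   \big[*%E/1%E]_j sing_weight a (v ord0 j) (x ord0 j))%E.
Proof.
move=> a0; have [[j xj]|ne] := pselect (exists j, x ord0 j = v ord0 j).
  rewrite [leRHS](_ : _ = +oo%E) ?leey// (bigD1 j)//=.
  rewrite xj sing_weight_center gt0_mulye//.
  by elim/big_ind : _ => // [y z|k _]; [exact: mule_gt0|exact: sing_weight_gt0].
have ne' j : x ord0 j != v ord0 j by apply/eqP => xj; apply: ne; exists j.
apply: le_trans (_ : (_ <= (\prod_j (`|x ord0 j - v ord0 j| `^ (- a) *
    inv1sqr (x ord0 j)))%:E)%E) _; last first.
  apply: prod_lee => j; first by rewrite mulr_ge0 ?powR_ge0// ltW// inv1sqr_gt0.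
  exact: sing_weight_bound.
rewrite lee_fin big_split /= ler_wpM2r//.
  by apply: prodr_ge0 => j _; rewrite ltW// inv1sqr_gt0.
rewrite powRrM powR_mulrn ?powR_ge0// -exprVn -powRN -[X in _ ^+ X]card_ord -prodr_const.
apply: ler_prod => j _; rewrite powR_ge0 /= !powRN.
have xj0 : 0 < `|x ord0 j - v ord0 j| by rewrite normr_gt0 subr_eq0.
have xje : `|x ord0 j - v ord0 j| <= enorm (x - v).
  rewrite -sqrtr_sqr ler_sqrt; last by apply: sumr_ge0 => i _; exact: sqr_ge0.
  rewrite (bigD1 j)//= !mxE lerDl; apply: sumr_ge0 => i _; exact: sqr_ge0.
rewrite lef_pV2 ?posrE ?powR_gt0 ?(lt_le_trans xj0 xje)//.
by apply: ge0_ler_powR => //; rewrite ?nnegrE ?ltW// (lt_le_trans xj0 xje).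
Qed.

End Weights.

(** * Schwartz functions and the decay of their Fourier transforms *)

Section PointwiseContinuity.
Variables (R : realType) (S : topologicalType).
Implicit Types f g : S -> R.

Lemma contD f g : continuous f -> continuous g -> continuous (fun x => f x + g x).
Proof. by move=> cf cg x; exact: (continuousD (cf x) (cg x)). Qed.

Lemma contM f g : continuous f -> continuous g -> continuous (fun x => f x * g x).
Proof. by move=> cf cg x; exact: (continuousM (cf x) (cg x)). Qed.

Lemma cont_comp f (h : R -> R) : continuous f -> continuous h ->
  continuous (fun x => h (f x)).
Proof. by move=> cf ch x; apply: continuous_comp; [exact: cf|exact: ch]. Qed.

End PointwiseContinuity.

Section Schwartz.
Variables (R : realType) (m : nat).
Local Notation RM := (measurableTypeR R).
Local Notation V := 'rV[R]_m.+1.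
Local Notation T := (m.+1.-tuple RM).
Local Notation row := (@row_of_tuple R m).
Local Notation mu := (lebesgue_tuple R m.+1).
Implicit Types (f g : V -> R) (x y : V).

Lemma rschwartz_differentiable f x : rschwartz f -> differentiable (f : V -> R^o) x.
Proof. by move=> /(_ [::]) [+ _]; exact. Qed.

Lemma rschwartz_continuous f : rschwartz f -> continuous f.
Proof. by move=> fS x; exact: differentiable_continuous (rschwartz_differentiable x fS). Qed.

Lemma rschwartz_pderiv j f : rschwartz f -> rschwartz (pderiv j f).
Proof. by move=> fS l; have := fS (rcons l j); rewrite foldr_rcons. Qed.

Lemma foldr_pderivB f g l : rschwartz f -> rschwartz g ->
  foldr (@pderiv R m) (fun x => f x - g x) l =
  (fun x => foldr (@pderiv R m) f l x - foldr (@pderiv R m) g l x).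
Proof.
move=> fS gS; elim: l => //= j l ->; apply/funext => x.
have [df _] := fS l; have [dg _] := gS l.
rewrite /pderiv; exact: (deriveB (diff_derivable (df x)) (diff_derivable (dg x))).
Qed.

Lemma rschwartzB f g : rschwartz f -> rschwartz g -> rschwartz (fun x => f x - g x).
Proof.
move=> fS gS l /=; rewrite foldr_pderivB//.
have [df bf] := fS l; have [dg bg] := gS l; split.
  by move=> x; exact: differentiableB.
move=> k; have [M Mf] := bf k; have [N Ng] := bg k.
exists (M + N) => x; apply: le_trans (lerD (Mf x) (Ng x)).
by rewrite -mulrDr ler_wpM2l ?exprn_ge0 ?sqrtr_ge0// ler_normB.
Qed.

Lemma enorm_ge0 k (w : 'rV[R]_k) : 0 <= enorm w.
Proof. exact: sqrtr_ge0. Qed.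

Lemma ler_coord_enorm k (w : 'rV[R]_k) j : `|w ord0 j| <= enorm w.
Proof.
rewrite -sqrtr_sqr ler_sqrt; last by apply: sumr_ge0 => i _; exact: sqr_ge0.
by rewrite (bigD1 j)//= lerDl; apply: sumr_ge0 => i _; exact: sqr_ge0.
Qed.

Definition weight x : R := \prod_j inv1sqr (x ord0 j).

Lemma weight_gt0 x : 0 < weight x.
Proof. by apply: prodr_gt0 => j _; exact: inv1sqr_gt0. Qed.

(** The product of the 1 + x_j^2 is at most (1 + |x|^2)^(m+1), hence at most
    2^(m+1) (1 + |x|^(2(m+1))). *)
Lemma rschwartz_bound f : rschwartz f ->
  exists2 C : R, 0 <= C & forall x, `|f x| <= C * weight x.
Proof.
move=> /(_ [::]) [_ bf]; have [M Mf] := bf 0; have [N Nf] := bf (2 * m.+1)%N.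
exists (2 ^+ m.+1 * (M + N)).
  have := lerD (Mf 0) (Nf 0); rewrite mulr_ge0 ?exprn_ge0//.
  by apply: le_trans (lerD (Mf 0) (Nf 0)); rewrite addr_ge0 ?mulr_ge0 ?exprn_ge0 ?enorm_ge0.
move=> x; have w0 := weight_gt0 x; rewrite -ler_pdivrMr//.
have := lerD (Mf x) (Nf x); rewrite /= expr0 mul1r => H.
apply: le_trans (ler_wpM2l (exprn_ge0 _ _) H) => //.
rewrite -[X in X + _]mul1r -mulrDl mulrA mulrC ler_wpM2r//.
rewrite /weight -prodfV; under eq_bigr do rewrite invrK.
apply: (@le_trans _ _ ((1 + enorm x ^+ 2) ^+ m.+1)).
  rewrite -[X in _ <= _ ^+ X]card_ord -prodr_const; apply: ler_prod => j _.
  rewrite addr_ge0 ?sqr_ge0//= lerD2l -[leLHS]real_normK ?num_real//.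
  by apply: lerXn2r; rewrite ?nnegrE ?enorm_ge0// ler_coord_enorm.
rewrite exprM.
have e0 := enorm_ge0 x; have [e1|e1] := leP (enorm x ^+ 2) 1.
  apply: (@le_trans _ _ (2 ^+ m.+1)).
    apply: lerXn2r; rewrite ?nnegrE ?addr_ge0 ?sqr_ge0//; lra.
  by rewrite -[leLHS]mulr1 ler_wpM2l ?exprn_ge0// lerDl !exprn_ge0.
apply: (@le_trans _ _ ((2 * enorm x ^+ 2) ^+ m.+1)).
  apply: lerXn2r; rewrite ?nnegrE ?mulr_ge0 ?addr_ge0 ?sqr_ge0//; lra.
by rewrite exprMn ler_wpM2l ?exprn_ge0// lerDr.
Qed.

Lemma measurable_weight : measurable_fun setT (fun t : T => weight (row t)).
Proof.
have : cmeas (fun t : T => \prod_j (inv1sqr (tnth t j))%:C).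
  apply: (cmeas_prod_tuple (f := fun j u => (inv1sqr u)%:C)) => j.
  split => /=; last exact: measurable_cst.
  by apply: continuous_measurable_fun; exact: continuous_inv1sqr.
move=> [+ _]; congr (measurable_fun _ _); apply/funext => t.
rewrite -rmorph_prod /=; apply: eq_bigr => j _.
by rewrite row_of_tupleE.
Qed.

Lemma rintg_weight_bound (F : T -> R) (C : R) : measurable_fun setT F -> 0 <= C ->
  (forall t, `|F t| <= C * weight (row t)) -> rintg mu F.
Proof.
move=> mF C0 FC.
apply: (@rintg_prod_bound _ _ (fun j u => (inv1sqr u)%:E) C) => //.
- move=> j; apply/measurable_EFinP; apply: continuous_measurable_fun.
  exact: continuous_inv1sqr.
- by move=> j u; rewrite lee_fin ltW// inv1sqr_gt0.
- by move=> j; exact: integrable_lty (inv1sqr_integrable R).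
- move=> t; rewrite (_ : (\big[_/_]_j _)%E = (weight (row t))%:E) ?lee_fin//.
  rewrite /weight (big_morph EFin EFinM (erefl 1%E)).
  by apply: eq_bigr => j _; rewrite row_of_tupleE.
Qed.

Lemma rintg_weight : rintg mu (fun t => weight (row t)).
Proof.
apply: (rintg_weight_bound measurable_weight ler01) => t.
by rewrite mul1r ger0_norm// ltW// weight_gt0.
Qed.

Lemma measurable_rschwartz f : rschwartz f -> measurable_fun setT (f \o row).
Proof.
by move=> fS; apply: continuous_measurable_row; exact: rschwartz_continuous.
Qed.

Lemma rintg_rschwartz_mul f (h : T -> R) : rschwartz f -> measurable_fun setT h ->
  (forall t, `|h t| <= 1) -> rintg mu (fun t => f (row t) * h t).
Proof.
move=> fS mh h1; have [C C0 fC] := rschwartz_bound fS.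
apply: (@rintg_weight_bound _ C) => //.
  by apply: measurable_funM => //; exact: measurable_rschwartz.
move=> t; rewrite normrM; apply: le_trans (fC _).
by rewrite ler_piMr.
Qed.

Lemma row_shift (t : T) j h :
  row (shift_tuple (fun i => h * (i == j)%:R) t) = row t + h *: delta_mx ord0 j.
Proof.
by apply/rowP => i; rewrite !mxE tnth_mktuple eqxx.
Qed.

Lemma dotpDl x y z : dotp (x + y) z = dotp x z + dotp y z.
Proof. by rewrite /dotp -big_split; apply: eq_bigr => j _; rewrite mxE mulrDl. Qed.

Lemma dotpC x y : dotp x y = dotp y x.
Proof. by apply: eq_bigr => j _; rewrite mulrC. Qed.

Lemma dotp_delta (h : R) (j : 'I_m.+1) z : dotp (h *: delta_mx ord0 j) z = h * z ord0 j.
Proof.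
rewrite /dotp (bigD1 j)//= big1 ?addr0 => [|i ij].
  by rewrite !mxE !eqxx mulr1.
by rewrite !mxE eqxx (negbTE ij) mulr0 mul0r.
Qed.

Lemma continuous_dotp x : continuous (fun y : V => dotp y x).
Proof.
suff H (r : seq 'I_m.+1) : continuous (fun y : V => \sum_(i <- r) y ord0 i * x ord0 i : R).
  exact: H.
elim: r => [|i r IH].
  rewrite (_ : (fun y : V => _) = fun=> 0); first exact: cst_continuous.
  by apply/funext => y; rewrite big_nil.
rewrite (_ : (fun y : V => _) = (fun y : V => y ord0 i * x ord0 i +
    \sum_(k <- r) y ord0 k * x ord0 k)); last first.
  by apply/funext => y; rewrite big_cons.
apply: contD; last exact: IH.
by apply: contM; [exact: coord_continuous|exact: cst_continuous].
Qed.

Lemma measurable_dotp x : measurable_fun setT (fun t : T => dotp (row t) x).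
Proof.
rewrite /dotp; apply: measurable_sum => j.
by apply: measurable_funM => //; exact: measurable_row_coord.
Qed.

(** For c = cos and c = - sin these are the real and imaginary parts of the Fourier
    transform. *)
Definition trig (c : R -> R) f x : R :=
  rint mu (fun t => f (row t) * c (dotp (row t) x)).

Section TrigDerivative.
Variables (c c' : R -> R).
Hypotheses (cc : continuous c) (c1 : forall y : R, `|c y| <= 1).
Hypotheses (cc' : continuous c') (c1' : forall y : R, `|c' y| <= 1).
Hypothesis dc : forall y : R, hasd c y (c' y).

Let mtrig (b : R -> R) x : continuous b ->
  measurable_fun setT (fun t : T => b (dotp (row t) x)).
Proof.
move=> cb; apply: (@measurableT_comp _ _ _ _ _ _ (b : RM -> R)).
  exact: continuous_measurable_fun.
exact: measurable_dotp.
Qed.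

Lemma rintg_trig f x : rschwartz f ->
  rintg mu (fun t => f (row t) * c (dotp (row t) x)).
Proof. by move=> fS; apply: rintg_rschwartz_mul => //; exact: mtrig. Qed.

(** Integration by parts in the direction j. *)
Lemma trig_pderiv j f x : rschwartz f ->
  trig c (pderiv j f) x = - (x ord0 j * trig c' f x).
Proof.
move=> fS; have fS' := rschwartz_pderiv j fS.
pose F (y : V) := f y * c (dotp y x).
pose G (y : V) := pderiv j f y * c (dotp y x) + x ord0 j * (f y * c' (dotp y x)).
have iF' : rintg mu (fun t => f (row t) * c' (dotp (row t) x)).
  by apply: rintg_rschwartz_mul => //; exact: mtrig.
have iG : rintg mu (G \o row).
  by apply: rintgD; [exact: rintg_trig|exact: rintgZ].
suff : rint mu (G \o row) = 0.
  rewrite [LHS]rintD; [|exact: rintg_trig|exact: rintgZ].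
  by rewrite rintZ// => /eqP; rewrite addr_eq0 => /eqP.
have cdot := @continuous_dotp x.
have cG : continuous G.
  apply: contD.
    by apply: contM; [exact: rschwartz_continuous|exact: cont_comp].
  apply: contM; first exact: cst_continuous.
  by apply: contM; [exact: rschwartz_continuous|exact: cont_comp].
pose fl (h : R) (t : T) : T := shift_tuple (fun i => h * (i == j)%:R) t.
apply: (@rint_flow_derivative _ _ _ mu fl (F \o row) (G \o row)) => //.
- by move=> h; exact: preserves_shift_tuple.
- exact: rintg_trig.
- apply: (@measurableT_comp _ _ _ _ _ _ (G \o row)).
    exact: continuous_measurable_row.
  apply/measurable_fun_tnthP => i.
  rewrite (_ : _ \o _ = (fun z : RM * T => (tnth z.2 i : RM) + z.1 * (i == j)%:R)).
    apply: measurable_funD.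
      by apply: (measurableT_comp (measurable_tnth i)); exact: measurable_snd.
    by apply: measurable_funM => //; exact: measurable_fst.
  by apply/funext => z /=; rewrite tnth_mktuple.
move=> t; pose v : V := delta_mx ord0 j.
transitivity (F (row t + 1 *: v) - F (row t + 0 *: v)).
  by rewrite /= /fl row_shift scale0r addr0.
have RE : (fun h => (G \o row) (fl h t)) = (fun h => G (row t + h *: v)).
  by apply/funext => h; rewrite /= /fl row_shift.
rewrite RE; symmetry.
apply: (@integral_hasd _ (fun h => G (row t + h *: v)) (fun h => F (row t + h *: v)) 0 1 ltr01).
- move=> h; rewrite /F /G; eapply hasd_eq.
    apply: hasdM; first by apply: derivative_line; exact: rschwartz_differentiable.
    apply: (hasd_comp (f := c)); first exact: dc.
    rewrite (_ : (fun h => dotp (row t + h *: v) x) =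
      (fun h => dotp (row t) x + h * x ord0 j)); first hasd.
    by apply/funext => k; rewrite dotpDl dotp_delta.
  by rewrite /= /pderiv /v; ring.
- move=> h; apply: (@continuous_comp _ _ _ (fun h : R => row t + h *: v) G).
    apply: cvgD; first exact: cvg_cst.
    exact: scalel_continuous.
  exact: cG.
Qed.

End TrigDerivative.

Let cos1 (y : R) : `|cos y| <= 1. Proof. exact: cos_max. Qed.
Let sin1 (y : R) : `|sin y| <= 1. Proof. exact: sin_max. Qed.
Let csin : continuous (@sin R). Proof. exact: continuous_sin. Qed.
Let ccos : continuous (@cos R). Proof. exact: continuous_cos. Qed.
Let cNs : continuous (fun z : R => - sin z).
Proof. by move=> z; apply: cvgN; exact: csin. Qed.
Let Nsin1 (y : R) : `|- sin y| <= 1. Proof. by rewrite normrN. Qed.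

Let trigNsin f x : rschwartz f -> trig (fun z => - sin z) f x = - trig sin f x.
Proof.
move=> fS; rewrite /trig -rintN; last exact: rintg_trig.
by apply: eq_Rintegral => t _; rewrite mulrN.
Qed.

Definition one_minus_d2 (j : 'I_m.+1) f : V -> R :=
  fun y => f y - pderiv j (pderiv j f) y.

Lemma rschwartz_one_minus_d2 j f : rschwartz f -> rschwartz (one_minus_d2 j f).
Proof. by move=> fS; apply: rschwartzB => //; do 2 apply: rschwartz_pderiv. Qed.

(** 1 - d^2/dx_j^2 becomes multiplication by 1 + x_j^2. *)
Lemma trig_one_minus_d2 (c : R -> R) j f x : c = cos \/ c = sin -> rschwartz f ->
  trig c (one_minus_d2 j f) x = (1 + x ord0 j ^+ 2) * trig c f x.
Proof.
move=> cE fS; have fS1 := rschwartz_pderiv j fS; have fS2 := rschwartz_pderiv j fS1.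
have -> : trig c (one_minus_d2 j f) x = trig c f x - trig c (pderiv j (pderiv j f)) x.
  rewrite /trig /one_minus_d2; under [LHS]eq_Rintegral do rewrite mulrBl.
  by case: cE => ->; rewrite [LHS]rintB//; exact: rintg_trig.
case: cE => ->.
  rewrite (trig_pderiv ccos cos1 cNs Nsin1 (fun z => is_derive_cos z) _ _ fS1).
  rewrite (trigNsin _ fS1).
  rewrite (trig_pderiv csin sin1 ccos cos1 (fun z => is_derive_sin z) _ _ fS).
  by ring.
rewrite (trig_pderiv csin sin1 ccos cos1 (fun z => is_derive_sin z) _ _ fS1).
rewrite (trig_pderiv ccos cos1 cNs Nsin1 (fun z => is_derive_cos z) _ _ fS).
by rewrite (trigNsin _ fS); ring.
Qed.

(** Applying 1 - d^2/dx_j^2 for all j multiplies the transform by 1 / weight, and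
    the transform of the resulting integrable function is bounded. *)
Lemma trig_decay (c : R -> R) f : c = cos \/ c = sin -> rschwartz f ->
  exists2 K : R, 0 <= K & forall x, `|trig c f x| <= K * weight x.
Proof.
move=> cE fS; pose L s := foldr one_minus_d2 f s.
have LS s : rschwartz (L s).
  by elim: s => //= j s; exact: rschwartz_one_minus_d2.
have LE s x : trig c (L s) x = (\prod_(j <- s) (1 + x ord0 j ^+ 2)) * trig c f x.
  elim: s => [|j s IH]; first by rewrite big_nil mul1r.
  by rewrite big_cons /= trig_one_minus_d2// -/(L s) IH mulrA.
pose g := L (index_enum 'I_m.+1).
have iN : rintg mu (fun t => `|g (row t)|).
  have [C C0 gC] := rschwartz_bound (LS (index_enum 'I_m.+1)).
  apply: (@rintg_weight_bound _ C) => //.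
    by apply: measurableT_comp => //; exact: (measurable_rschwartz (LS _)).
  by move=> t; rewrite normr_id.
exists (rint mu (fun t => `|g (row t)|)); first exact: Rintegral_ge0.
move=> x; have := LE (index_enum 'I_m.+1) x.
have w0 := weight_gt0 x; have wV : \prod_j (1 + x ord0 j ^+ 2) = (weight x)^-1.
  by rewrite /weight -prodfV; apply: eq_bigr => j _; rewrite invrK.
rewrite wV => E; rewrite -[trig c f x](mulVKf (lt0r_neq0 w0)) -E mulrC.
rewrite normrM [ `|weight x| ]ger0_norm ?(ltW w0)//.
apply: (ler_wpM2r (ltW w0)).
have c1 (y : R) : `|c y| <= 1 by case: cE => ->.
have ig : rintg mu (fun t => g (row t) * c (dotp (row t) x)).
  by case: cE => ->; exact: (rintg_trig _ _ x (LS _)).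
apply: ler_norm_rint => //; first exact: rintg_measurable ig.
by move=> t; rewrite normrM ler_piMr.
Qed.

Lemma fourierE (phi : V -> R[i]) x :
  fourier phi x = cint mu (fun t => phi (row t) * cexp (- 'i * (dotp (row t) x)%:C)).
Proof. by []. Qed.

Lemma schwartz_cont (phi : V -> R[i]) : schwartz phi -> cmeas (phi \o row).
Proof.
by move=> [pr pi]; split; [exact: (measurable_rschwartz pr)|exact: (measurable_rschwartz pi)].
Qed.

Lemma schwartz_bound (phi : V -> R[i]) : schwartz phi ->
  exists2 C : R, 0 <= C & forall x, Normc.normc (phi x) <= C * weight x.
Proof.
move=> [pr pi]; have [C C0 HC] := rschwartz_bound pr.
have [D D0 HD] := rschwartz_bound pi; exists (C + D); first exact: addr_ge0.
by move=> x; apply: le_trans (ler_normc _) _; rewrite mulrDl lerD.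
Qed.

Lemma fourier_decay (phi : V -> R[i]) : schwartz phi ->
  exists2 K : R, 0 <= K & forall x, Normc.normc (fourier phi x) <= K * weight x.
Proof.
move=> [pr pi].
have [A A0 HA] := trig_decay (or_introl erefl) pr.
have [B B0 HB] := trig_decay (or_intror erefl) pr.
have [C C0 HC] := trig_decay (or_introl erefl) pi.
have [D D0 HD] := trig_decay (or_intror erefl) pi.
exists (A + B + C + D); first by rewrite !addr_ge0.
move=> x; apply: le_trans (ler_normc _) _.
have -> : complex.Re (fourier phi x) =
    trig cos (fun y => complex.Re (phi y)) x + trig sin (fun y => complex.Im (phi y)) x.
  rewrite /trig -rintD; [|exact: (rintg_trig ccos cos1 x pr)|exact: (rintg_trig csin sin1 x pi)].
  by apply: eq_Rintegral => t _; rewrite /= cexp_Ni cReM /= mulrN opprK.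
have -> : complex.Im (fourier phi x) =
    trig cos (fun y => complex.Im (phi y)) x - trig sin (fun y => complex.Re (phi y)) x.
  rewrite /trig -rintB; [|exact: (rintg_trig ccos cos1 x pi)|exact: (rintg_trig csin sin1 x pr)].
  by apply: eq_Rintegral => t _; rewrite /= cexp_Ni cImM /= mulrN addrC.
have := HA x; have := HB x; have := HC x; have := HD x.
set w := weight x; set a := trig _ _ _; set b := trig _ _ _.
set a' := trig _ _ _; set b' := trig _ _ _.
rewrite !mulrDl => h1 h2 h3 h4.
have := ler_normD b' a; have := ler_normB b a'; lra.
Qed.

End Schwartz.

(** * The Fourier transform of the Riesz kernels *)

Section Riesz.
Variables (R : realType) (m : nat).
Local Notation RM := (measurableTypeR R).
Local Notation V := 'rV[R]_m.+1.
Local Notation T := (m.+1.-tuple RM).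
Local Notation row := (@row_of_tuple R m).
Local Notation mu := (lebesgue_tuple R m.+1).
Local Notation mu1 := (@lebesgue_measure R).
Local Notation e_ x := (cexp (- 'i * x%:C)).
Implicit Types (x y v : V).

Lemma e_D (a b : R) : e_ (a + b) = e_ a * e_ b.
Proof. by rewrite rmorphD mulrDr cexpD. Qed.

Lemma e_sum (I : Type) (r : seq I) (F : I -> R) :
  e_ (\sum_(i <- r) F i) = \prod_(i <- r) e_ (F i).
Proof.
elim: r => [|i r IH]; first by rewrite !big_nil mulr0 cexp0.
by rewrite !big_cons e_D IH.
Qed.

Lemma cmeas_e d (S : measurableType d) (f : S -> R) :
  measurable_fun setT f -> cmeas (fun s => e_ (f s)).
Proof.
move=> mf; split.
  under eq_fun do rewrite cexp_Ni /=.
  apply: (@measurableT_comp _ _ _ _ _ _ (@cos R : RM -> R)) => //.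
  exact: continuous_measurable_fun (@continuous_cos R).
under eq_fun do rewrite cexp_Ni /=.
apply: measurableT_comp => //.
apply: (@measurableT_comp _ _ _ _ _ _ (@sin R : RM -> R)) => //.
exact: continuous_measurable_fun (@continuous_sin R).
Qed.

Lemma measurable_coord_sub v j :
  measurable_fun setT (fun t : T => (row t - v) ord0 j).
Proof.
under eq_fun do rewrite mxE; apply: measurable_funD => //.
exact: measurable_row_coord.
Qed.

Lemma measurable_enorm_sub v : measurable_fun setT (fun t : T => enorm (row t - v)).
Proof.
apply: measurableT_comp.
  exact: continuous_measurable_fun (@sqrt_continuous R).
apply: measurable_sum => j; apply: measurable_funX.
exact: measurable_coord_sub.
Qed.

Lemma cintg_mul_e d (S : measurableType d) (nu : {measure set S -> \bar R})
    (f : S -> R[i]) (h : S -> R) :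
  cintg nu f -> measurable_fun setT h -> cintg nu (fun s => f s * e_ (h s)).
Proof.
move=> fi mh; apply: (cintg_dominated _ (rintg_normc fi)).
  by apply: cmeasM; [exact: cintg_cmeas fi|exact: cmeas_e].
by move=> s; rewrite Normc.normcM normc_cexp_Ni mulr1.
Qed.

Lemma cmeas_character v : cmeas (fun t : T => e_ (dotp v (row t))).
Proof. by apply: cmeas_e; under eq_fun do rewrite dotpC; exact: measurable_dotp. Qed.

Lemma measurable_dotp_pair :
  measurable_fun setT (fun z : T * T => dotp (row z.1) (row z.2)).
Proof.
rewrite /dotp; apply: measurable_sum => j; apply: measurable_funM.
  exact: (measurableT_comp (measurable_row_coord j) measurable_fst).
exact: (measurableT_comp (measurable_row_coord j) measurable_snd).
Qed.

Lemma cintg_schwartz (phi : V -> R[i]) : schwartz phi -> cintg mu (phi \o row).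
Proof.
move=> pS; have [C C0 pC] := schwartz_bound pS.
apply: (cintg_dominated (schwartz_cont pS) (rintgZ C (rintg_weight R m))) => t.
exact: pC.
Qed.

Lemma cintg_character_pair (f g : T -> R[i]) : cintg mu f -> cintg mu g ->
  cintg (mu \x mu)%E (fun z => f z.1 * g z.2 * e_ (dotp (row z.1) (row z.2))).
Proof.
by move=> fi gi; apply: cintg_mul_e measurable_dotp_pair; exact: cintg_tensor.
Qed.

(** Multiplied by an integrable weight, the defining integral falls under
    Fubini's theorem, which gives measurability. *)
Lemma cmeas_fourier (phi : V -> R[i]) : schwartz phi ->
  cmeas (fun t => fourier phi (row t)).
Proof.
move=> pS; have iw := cintg_real (rintg_weight R m).
have /cintg_fubini2/cintg_cmeas M := cintg_character_pair (cintg_schwartz pS) iw.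
have mW : measurable_fun setT (fun t : T => \prod_j (1 + row t ord0 j ^+ 2)).
  apply: measurable_prod => j _; apply: measurable_funD => //.
  by apply: measurable_funX; exact: measurable_row_coord.
have := cmeasM M (cmeas_real mW); congr cmeas; apply/funext => t.
rewrite (@eq_cint _ _ _ _ _ (fun x : T => (weight (row t))%:C *
   (phi (row x) * e_ (dotp (row x) (row t))))); last by move=> x /=; ring.
have E : (weight (row t))%:C * (\prod_j (1 + row t ord0 j ^+ 2))%:C = 1 :> R[i].
  rewrite -rmorphM /= /weight -big_split /= big1 // => j _.
  by rewrite mulVf// gt_eqF// ltr_pwDl// sqr_ge0.
rewrite cintZ /=; first by rewrite mulrAC E mul1r.
by apply: cintg_mul_e (measurable_dotp _); exact: cintg_schwartz.
Qed.

(** The multiplication formula: the transform is moved from phi to g, by Fubini. *)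
Lemma fourier_multiplication (phi : V -> R[i]) (g : T -> R[i]) :
  schwartz phi -> cintg mu g ->
  cint mu (fun t => fourier phi (row t) * g t) =
  cint mu (fun t => phi (row t) * cint mu (fun s => g s * e_ (dotp (row s) (row t)))).
Proof.
move=> pS gi; have pi := cintg_schwartz pS.
have H := cintg_character_pair pi gi.
have ie (f : T -> R[i]) x : cintg mu f -> cintg mu (fun t => f t * e_ (dotp (row t) x)).
  by move=> fi; exact: cintg_mul_e (measurable_dotp _).

transitivity (cint mu (fun t => cint mu (fun s =>
    phi (row s) * g t * e_ (dotp (row s) (row t))))).
  apply: eq_cint => t; rewrite fourierE mulrC -cintZ; last exact: (ie _ _ pi).
  by apply: eq_cint => s; rewrite /=; ring.
rewrite -(cint_fubini H); apply: eq_cint => t /=.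
rewrite -cintZ; last exact: (ie _ _ gi).
by apply: eq_cint => s; rewrite (dotpC (row s)); ring.
Qed.

Lemma shifted_gaussian_fourier (t s x : R) (b : bool) : 0 < t ->
  let g (u : RM) := ((u - s) ^+ b * expR (- (t * (u - s) ^+ 2)))%:C in
  cintg mu1 g /\
  cint mu1 (fun u => g u * e_ (u * x)) =
  e_ (s * x) * (if b then - 'i * (x / (2 * t))%:C else 1) *
    (Num.sqrt (pi / t) * expR (- (x ^+ 2 / (4 * t))))%:C.
Proof.
move=> t0 g.
pose g0 (u : RM) := ((u : R) ^+ b * expR (- (t * u ^+ 2)))%:C.
have ps := preserves_shift (- s).
have ig0 : cintg mu1 g0.
  apply: cintg_real; case: b @g @g0 => /=.
    under eq_fun do rewrite expr1.
    apply: (rintg_dominated _ (gaussian_moment_integrable t0)).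
      by apply: measurable_funM; [exact: measurable_id|exact: measurable_gaussian].
    by move=> u; rewrite normrM [ `|expR _| ]ger0_norm ?expR_ge0.
  under eq_fun do rewrite expr0 mul1r.
  by have [] := gaussian_integral t0.
split; first exact: (cintg_preserves ps ig0).
have E : (fun u => g u * e_ (u * x)) =
    (fun u => e_ (s * x) * (g0 u * e_ (u * x))) \o (fun u : RM => u + - s : RM).
  apply/funext => u; rewrite /= /g /g0.
  have -> : e_ (u * x) = e_ (s * x) * e_ ((u - s) * x).
    by rewrite -e_D; congr (e_ _); ring.
  by ring.
have [i0 F0] : cintg mu1 (fun u => g0 u * e_ (u * x)) /\
   cint mu1 (fun u => g0 u * e_ (u * x)) =
   (if b then - 'i * (x / (2 * t))%:C else 1) *
    (Num.sqrt (pi / t) * expR (- (x ^+ 2 / (4 * t))))%:C.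
  rewrite /g0; case: b @g @g0 ig0 E => /= _ _.
    have [h1 h2] := gaussian_moment_fourier x t0; split.
      by move: h1; congr cintg.
    rewrite -mulrA -rmorphM -h2; apply: eq_cint => u; by rewrite expr1.
  have [h1 h2] := gaussian_fourier x t0; split.
    by move: h1; congr cintg; apply/funext => u; rewrite expr0 mul1r.
  rewrite mul1r -h2; apply: eq_cint => u; by rewrite expr0 mul1r.
rewrite E (cint_preserves ps); last exact: cintgZ.
by rewrite cintZ// F0 mulrA.
Qed.

(** The integrand is a product of one-variable functions, one of which is a first
    moment. *)
Lemma riesz_gaussian_fourier (t : R) v x j : 0 < t ->
  let g (s : T) := ((row s - v) ord0 j * expR (- (t * enorm (row s - v) ^+ 2)))%:C in
  cintg mu g /\
  cint mu (fun s => g s * e_ (dotp (row s) x)) =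
  e_ (dotp v x) * (- 'i * (x ord0 j / (2 * t))%:C) *
    (Num.sqrt (pi / t) ^+ m.+1 * expR (- (enorm x ^+ 2 / (4 * t))))%:C.
Proof.
move=> t0 g.
pose f (i : 'I_m.+1) (u : RM) : R[i] :=
  ((u - v ord0 i) ^+ (i == j) * expR (- (t * (u - v ord0 i) ^+ 2)))%:C.
have fP i := @shifted_gaussian_fourier t (v ord0 i) (x ord0 i) (i == j) t0.
have gE (s : T) : g s = \prod_i f i (tnth s i).
  rewrite /g /f -rmorph_prod /= big_split /=; congr (_ * _)%:C.
    rewrite (bigD1 j)//= eqxx expr1 big1 ?mulr1 ?mxE// => i ij.
    by rewrite (negbTE ij).
  rewrite -expR_sum enorm_sqr mulr_sumr -sumrN; congr expR.
  by apply: eq_bigr => i _; rewrite !mxE.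
have [ig _] := cint_prod_tuple (fun i => (fP i).1).
split; first by rewrite (_ : g = (fun s => \prod_i f i (tnth s i)))//; exact/funext.
have fi i : cintg mu1 (fun u => f i u * e_ (u * x ord0 i)).
  by apply: cintg_mul_e; [exact: (fP i).1|exact: measurable_funM].
have [_ P] := cint_prod_tuple fi.
transitivity (cint mu (fun s => \prod_i (f i (tnth s i) * e_ (tnth s i * x ord0 i)))).
  apply: eq_cint => s; rewrite gE big_split /=; congr (_ * _).
  rewrite /dotp e_sum; apply: eq_bigr => i _; by rewrite row_of_tupleE.
rewrite P; under eq_bigr => i _ do rewrite (fP i).2.
rewrite big_split big_split /=; congr (_ * _ * _).
- exact/esym/e_sum.
- by rewrite (bigD1 j)//= eqxx big1 ?mulr1// => i /negbTE ->.
- rewrite -rmorph_prod /= big_split /= prodr_const card_ord; congr (_ * _)%:C.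
  rewrite -expR_sum enorm_sqr mulr_suml -sumrN; congr expR.
Qed.

Hypothesis m_gt0 : (0 < m)%N.

(** A singularity of order below the dimension m + 1, with decay in each variable,
    is integrable: it is dominated by a product of integrable weights. *)
Lemma rintg_sing_bound (a C : R) v (F : T -> R) : 0 < a < 1 -> 0 <= C ->
  measurable_fun setT F ->
  (forall t, `|F t| <= C * ((enorm (row t - v) `^ (a * m.+1%:R))^-1 * weight (row t))) ->
  rintg mu F.
Proof.
move=> a01 C0 mF FC; have /andP[a0 _] := a01.
apply: (@rintg_prod_bound _ _ (fun j => sing_weight a (v ord0 j)) C) => //.
- by move=> j; exact: measurable_sing_weight.
- by move=> j u; exact: sing_weight_ge0.
- by move=> j; exact: sing_weight_lty.
- move=> t; apply: (@le_trans _ _ (C%:E * ((enorm (row t - v) `^ (a * m.+1%:R))^-1 *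
     weight (row t))%:E)%E); first by rewrite -EFinM lee_fin.
  rewrite lee_wpmul2l ?lee_fin//; have := prod_sing_weight (row t) v a0.
  rewrite (eq_bigr (fun j => sing_weight a (v ord0 j) (tnth t j)))// => j _.
  by rewrite row_of_tupleE.
Qed.

(** The Riesz kernel with its singularity, of order m, at v. *)
Definition riesz v j (t : T) : R := (row t - v) ord0 j / enorm (row t - v) ^+ m.+1.

Definition riesz_dual j (t : T) : R := row t ord0 j / enorm (row t) ^+ 2.

Lemma measurable_riesz v j : measurable_fun setT (riesz v j).
Proof.
apply: measurable_funM; first exact: measurable_coord_sub.
by apply: measurable_funV; apply: measurable_funX; exact: measurable_enorm_sub.
Qed.

Lemma measurable_enorm_row : measurable_fun setT (fun t : T => enorm (row t)).
Proof.
have := measurable_enorm_sub 0.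
by congr measurable_fun; apply/funext => t; rewrite subr0.
Qed.

Lemma measurable_riesz_dual j : measurable_fun setT (riesz_dual j).
Proof.
apply: measurable_funM; first exact: measurable_row_coord.
by apply: measurable_funV; apply: measurable_funX; exact: measurable_enorm_row.
Qed.

Lemma coord_div_enorm y j k : `|y ord0 j / enorm y ^+ k.+1| <= (enorm y ^+ k)^-1.
Proof.
have [y0|y0] := eqVneq (enorm y) 0.
  by rewrite y0 expr0n invr0 mulr0 normr0 invr_ge0 exprn_ge0.
rewrite normrM normfV [ `|enorm y ^+ _| ]ger0_norm ?exprn_ge0 ?enorm_ge0//.
have e0 : 0 < enorm y by rewrite lt_def y0 enorm_ge0.
rewrite exprS invfM mulrA ler_piMl ?invr_ge0 ?exprn_ge0 ?enorm_ge0//.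
by rewrite ler_pdivrMr// mul1r ler_coord_enorm.
Qed.

Lemma rintg_riesz_mul v j (F : T -> R) (C : R) : measurable_fun setT F -> 0 <= C ->
  (forall t, `|F t| <= C * weight (row t)) -> rintg mu (fun t => F t * riesz v j t).
Proof.
move=> mF C0 FC; have m0 : 0 < m%:R :> R by rewrite ltr0n.
apply: (@rintg_sing_bound (m%:R / m.+1%:R) C v) => //.
- by rewrite divr_gt0//= ltr_pdivrMr// mul1r ltr_nat.
- by apply: measurable_funM => //; exact: measurable_riesz.
move=> t; rewrite divfK// powR_mulrn ?enorm_ge0// normrM mulrCA mulrC.
by apply: ler_pM => //; exact: coord_div_enorm.
Qed.

Lemma rintg_riesz_dual_mul j (F : T -> R) (C : R) : measurable_fun setT F -> 0 <= C ->
  (forall t, `|F t| <= C * weight (row t)) -> rintg mu (fun t => F t * riesz_dual j t).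
Proof.
move=> mF C0 FC.
apply: (@rintg_sing_bound (m.+1%:R^-1) C 0) => //.
- by rewrite invr_gt0//= ltr0n /= invf_lt1// ltr1n ltnS.
- by apply: measurable_funM => //; exact: measurable_riesz_dual.
move=> t; rewrite mulVf// powRr1 ?enorm_ge0// normrM mulrCA mulrC subr0.
apply: ler_pM => //; have := coord_div_enorm (row t) j 1; by rewrite expr1.
Qed.

Lemma cintg_mul_of_rintg (f : T -> R[i]) (rho : T -> R) :
  cmeas f -> measurable_fun setT rho ->
  rintg mu (fun t => Normc.normc (f t) * rho t) ->
  cintg mu (fun t => f t * (rho t)%:C).
Proof.
move=> mf mr ifr.
have : rintg mu (fun t => `|Normc.normc (f t) * rho t|).
  by have := integrable_norm ifr; apply: eq_integrable.
move=> H; apply: (cintg_dominated _ H); first by apply: cmeasM => //; exact: cmeas_real.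
by move=> t; rewrite Normc.normcM normc_real normrM [ `|Normc.normc _| ]ger0_norm ?normc_ge0.
Qed.

Lemma cintg_mul_bounded (f g : T -> R[i]) (C : R) : cmeas f ->
  (forall t, Normc.normc (f t) <= C) -> cintg mu g -> cintg mu (fun t => f t * g t).
Proof.
move=> mf fC ig; apply: (cintg_dominated _ (rintgZ C (rintg_normc ig))).
  by apply: cmeasM => //; exact: cintg_cmeas ig.
by move=> t; rewrite Normc.normcM ler_wpM2r ?normc_ge0.
Qed.

Lemma weight_le1 y : weight y <= 1.
Proof.
rewrite /weight -[leRHS](@big1 R 1 *%R _ (index_enum 'I_m.+1) xpredT (fun=> 1))//.
apply: ler_prod => j _; rewrite invr_ge0 addr_ge0 ?sqr_ge0//=.
by rewrite invf_le1 ?ltr_pwDl ?sqr_ge0// lerDl sqr_ge0.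
Qed.

(** The interchange of integrals behind a superposition
    c rho t = int K tau t dtau. *)
Lemma cintg_superposition (F : T -> R[i]) (K : RM -> T -> R) (rho : T -> R) (c : R) :
  cmeas F -> measurable_fun setT (fun z : RM * T => K z.1 z.2) ->
  (forall t, rintg mu1 (K ^~ t)) ->
  (forall t, rint mu1 (fun tau => `|K tau t|) = c * `|rho t|) ->
  rintg mu (fun t => Normc.normc (F t) * rho t) ->
  cintg (mu1 \x mu)%E (fun z => F z.2 * (K z.1 z.2)%:C).
Proof.
move=> mF mK iK cK iFr.
have mF2 : cmeas (fun z : RM * T => F z.2) by exact: (cmeas_comp mF measurable_snd).
pose N (z : RM * T) := Normc.normc (F z.2) * `|K z.1 z.2|.
have mN : measurable_fun setT N.
  apply: measurable_funM; first exact: measurable_normc mF2.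
  exact: measurableT_comp.
apply: (@cintg_dominated _ _ _ _ _ N).
- by apply: cmeasM => //; exact: cmeas_real.
- apply: rintg_tonelli2 => //.
  have iA : rintg mu (fun t => c * `|Normc.normc (F t) * rho t|).
    by apply: rintgZ; have := integrable_norm iFr; apply: eq_integrable.
  have := integrable_lty measurableT iA; congr (_ < _)%E.
  apply: eq_integral => t _ /=.
  have iKn : rintg mu1 (fun tau => `|K tau t|).
    by have := integrable_norm (iK t); apply: eq_integrable.
  rewrite normrM [ `|Normc.normc (F t)| ]ger0_norm ?normc_ge0// mulrCA -cK -rintZ//.
  rewrite EFin_rint; last exact: rintgZ.
  apply: eq_integral => tau _; rewrite /N /= normrM normr_id.
  by rewrite ger0_norm ?normc_ge0.
- by move=> z; rewrite Normc.normcM normc_real.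
Qed.

Lemma cint_superposition (F : T -> R[i]) (K : RM -> T -> R) (rho : T -> R) (c : R) :
  cmeas F -> measurable_fun setT (fun z : RM * T => K z.1 z.2) ->
  measurable_fun setT rho -> (forall t, rintg mu1 (K ^~ t)) ->
  (forall t, rint mu1 (K ^~ t) = c * rho t) ->
  (forall t, rint mu1 (fun tau => `|K tau t|) = c * `|rho t|) ->
  rintg mu (fun t => Normc.normc (F t) * rho t) ->
  cintg mu1 (fun tau => cint mu (fun t => F t * (K tau t)%:C)) /\
  c%:C * cint mu (fun t => F t * (rho t)%:C) =
  cint mu1 (fun tau => cint mu (fun t => F t * (K tau t)%:C)).
Proof.
move=> mF mK mr iK eK nK ir.
have H := cintg_superposition mF mK iK nK ir; split; first exact: (cintg_fubini1 H).
rewrite -cintZ; last exact: (cintg_mul_of_rintg mF mr ir).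
rewrite (cint_fubini H); apply: eq_cint => t /=.
rewrite cintZ; last exact: cintg_real (iK t).
by rewrite cint_real eK rmorphM /= mulrCA.
Qed.

Let G : R := Gamma (m.+1%:R / 2).

Let G_gt0 : 0 < G.
Proof. by have := Gamma_half_gt0 R m.-1; rewrite prednK. Qed.

(** The superpositions of Gaussians whose integrals over tau are multiples of
    riesz and riesz_dual. *)
Let K v j (tau : RM) (t : T) : R :=
  hpos tau * gamma_fun m.-1 (enorm (row t - v) ^+ 2) tau * (row t - v) ord0 j.

Let K' j (tau : RM) (t : T) : R :=
  hpos tau * inverse_gaussian (enorm (row t) ^+ 2 / 4) tau * row t ord0 j.

Let enorm_neq0 (y : V) j : y ord0 j != 0 -> 0 < enorm y.
Proof. by move=> yj; apply: lt_le_trans (ler_coord_enorm y j); rewrite normr_gt0. Qed.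

(** Nothing is asked of w when c = 0: at the singular point of a kernel, where c
    vanishes, the weights below are not integrable. *)
Let scaled_int (w : RM -> R) (r c : R) : (forall tau, 0 <= w tau) ->
  (c != 0 -> rintg mu1 w /\ rint mu1 w = r) ->
  rintg mu1 (fun tau => w tau * c) /\
  rint mu1 (fun tau => w tau * c) = r * c /\
  rint mu1 (fun tau => `|w tau * c|) = r * `|c|.
Proof.
move=> w0; have [-> _|c0 /(_ isT)[iw wr]] := eqVneq c 0.
  have -> : (fun tau => `|w tau * 0|) = fun=> 0.
    by apply/funext => tau; rewrite mulr0 normr0.
  have -> : (fun tau => w tau * 0) = fun=> 0 by apply/funext => tau; rewrite mulr0.
  by rewrite normr0 mulr0 rint0; split; [exact: rintg0|].
have E (x : R) : (fun tau => w tau * x) = (fun tau => x * w tau).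
  by apply/funext => tau; rewrite mulrC.
have -> : (fun tau => `|w tau * c|) = (fun tau => w tau * `|c|).
  by apply/funext => tau; rewrite normrM ger0_norm.
by rewrite !E !rintZ// wr; split; [exact: rintgZ|rewrite !(mulrC r)].
Qed.

Let mul_div_norm (g c e : R) : 0 <= e ->
  g * (c / e) = g / e * c /\ g * `|c / e| = g / e * `|c|.
Proof. by move=> e0; rewrite normrM normfV (ger0_norm e0); split; ring. Qed.

Let K_int v j t : rintg mu1 (K v j ^~ t) /\
  rint mu1 (K v j ^~ t) = G * riesz v j t /\
  rint mu1 (fun tau => `|K v j tau t|) = G * `|riesz v j t|.
Proof.
have [-> ->] := mul_div_norm G ((row t - v) ord0 j)
  (exprn_ge0 m.+1 (enorm_ge0 (row t - v))).
apply: (@scaled_int (fun tau => hpos tau * gamma_fun m.-1 (enorm (row t - v) ^+ 2) tau)).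
  by move=> tau; rewrite mulr_ge0 ?hpos_ge0 ?gamma_fun_ge0.
move=> /enorm_neq0 e0; have e20 : 0 < enorm (row t - v) ^+ 2 by exact: exprn_gt0.
split; first exact: gamma_fun_integrable.
by rewrite rint_gamma_fun// prednK// sqrtr_sqr gtr0_norm.
Qed.

Let K'_int j t : rintg mu1 (K' j ^~ t) /\
  rint mu1 (K' j ^~ t) = 4 * riesz_dual j t /\
  rint mu1 (fun tau => `|K' j tau t|) = 4 * `|riesz_dual j t|.
Proof.
have [-> ->] := mul_div_norm 4 (row t ord0 j) (exprn_ge0 2 (enorm_ge0 (row t))).
apply: (@scaled_int (fun tau => hpos tau * inverse_gaussian (enorm (row t) ^+ 2 / 4) tau)).
  by move=> tau; rewrite mulr_ge0 ?hpos_ge0 ?inverse_gaussian_ge0.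
move=> /enorm_neq0 e0; have e20 : 0 < enorm (row t) ^+ 2 by exact: exprn_gt0.
by have := inverse_gaussian_integral (divr_gt0 e20 (ltr0n _ 4)); rewrite invf_div.
Qed.

Let measurable_K v j : measurable_fun setT (fun z : RM * T => K v j z.1 z.2).
Proof.
apply: measurable_funM; last first.
  exact: (measurableT_comp (measurable_coord_sub v j) measurable_snd).
apply: measurable_funM.
  apply: (@measurableT_comp _ _ _ _ _ _ (@hpos R : RM -> R)); last exact: measurable_fst.
  exact: measurable_hpos.
apply: measurable_funM.
  apply: measurable_funX; apply: (@measurableT_comp _ _ _ _ _ _ (@Num.sqrt R : RM -> R)).
    exact: continuous_measurable_fun (@sqrt_continuous R).
  exact: measurable_fst.
do 2 apply: measurableT_comp => //; apply: measurable_funM; first exact: measurable_fst.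
apply: measurable_funX.
exact: (measurableT_comp (measurable_enorm_sub v) measurable_snd).
Qed.

Let measurable_K' j : measurable_fun setT (fun z : RM * T => K' j z.1 z.2).
Proof.
apply: measurable_funM; last first.
  exact: (measurableT_comp (measurable_row_coord j) measurable_snd).
apply: measurable_funM.
  apply: (@measurableT_comp _ _ _ _ _ _ (@hpos R : RM -> R)); last exact: measurable_fst.
  exact: measurable_hpos.
apply: measurable_funM.
  by apply: measurable_funV; apply: measurable_funX; exact: measurable_fst.
do 2 apply: measurableT_comp => //; apply: measurable_funM; last first.
  by apply: measurable_funV; exact: measurable_fst.
apply: measurable_funM => //; apply: measurable_funX.
exact: (measurableT_comp measurable_enorm_row measurable_snd).
Qed.

Let cmeas_phi (phi : V -> R[i]) v : schwartz phi ->
  cmeas (fun t : T => phi (row t) * e_ (dotp v (row t))).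
Proof. by move=> pS; apply: cmeasM; [exact: schwartz_cont|exact: cmeas_character]. Qed.

Let cintg_phi_K' (phi : V -> R[i]) v j (tau : R) : schwartz phi -> 0 < tau ->
  cintg mu (fun t => phi (row t) * e_ (dotp v (row t)) * (K' j tau t)%:C).
Proof.
move=> pS tau0; have [D D0 HD] := schwartz_bound pS.
have t40 : 0 < (4 * tau)^-1 by rewrite invr_gt0 mulr_gt0.
have ig := (riesz_gaussian_fourier 0 0 j t40).1.
have := cintg_mul_bounded (cmeas_phi v pS) (C := D) _ (cintgZ ((tau ^+ 2)^-1 : R)%:C ig).
rewrite (_ : (fun _ => _ * (_ * _)) =
  (fun t => phi (row t) * e_ (dotp v (row t)) * (K' j tau t)%:C)).
  apply=> t; rewrite Normc.normcM normc_cexp_Ni mulr1.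
  by rewrite (le_trans (HD _))// ler_piMr// weight_le1.
apply/funext => t; rewrite -rmorphM subr0; congr (_ * _%:C).
rewrite /K' hposE tau0 mul1r /inverse_gaussian.
have -> : (4 * tau)^-1 * enorm (row t) ^+ 2 = enorm (row t) ^+ 2 / 4 / tau.
  by field; rewrite gt_eqF.
by rewrite [row t ord0 j * _]mulrC mulrA.
Qed.

Let slice_constant (k : nat) (r tau p x E : R) : 0 < tau -> r != 0 ->
  x / (2 * tau) * (p / (r ^+ k * tau) * E) =
  p / 2 / r ^+ k * (tau ^- 2 * E * x).
Proof.
move=> t0 r0; have rk : r ^+ k != 0 by rewrite expf_neq0.
by field; rewrite gt_eqF.
Qed.

(** For each tau the two Gaussian moments correspond under the Fourier transform,
    up to a constant from which tau cancels. *)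
Let riesz_slice (phi : V -> R[i]) v j (tau : R) : schwartz phi ->
  cint mu (fun t => fourier phi (row t) * (K v j tau t)%:C) =
  - 'i * (Num.sqrt pi ^+ m.+1 / 2 : R)%:C *
  cint mu (fun t => phi (row t) * e_ (dotp v (row t)) * (K' j tau t)%:C).
Proof.
move=> pS; have [C C0 HC] := fourier_decay pS.
have [tau0|tau0] := ltP 0 tau; last first.
  rewrite (@eq_cint _ _ _ _ _ (fun=> 0)) ?cint0; last first.
    by move=> t; rewrite /K hposE ltNge tau0 !mul0r mulr0.
  rewrite (@eq_cint _ _ _ _ _ (fun=> 0)) ?cint0 ?mulr0//.
  by move=> t; rewrite /K' hposE ltNge tau0 !mul0r !mulr0.
have gP x := riesz_gaussian_fourier v x j tau0.
have ig := (gP 0).1.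
rewrite (@eq_cint _ _ _ _ _ (fun t => (Num.sqrt tau ^+ m.-1)%:C *
  (fourier phi (row t) *
   ((row t - v) ord0 j * expR (- (tau * enorm (row t - v) ^+ 2)))%:C))); last first.
  move=> t; rewrite mulrCA -rmorphM; congr (_ * _%:C).
  rewrite /K hposE tau0 mul1r /gamma_fun -mulrA; congr (_ * _).
  by rewrite mulrC.
rewrite cintZ; last first.
  apply: (@cintg_mul_bounded _ _ C _ _ ig); first exact: cmeas_fourier.
  by move=> t; rewrite (le_trans (HC _))// ler_piMr// weight_le1.
rewrite (fourier_multiplication pS ig).
have s0 : Num.sqrt tau != 0 by rewrite gt_eqF ?sqrtr_gt0.
have sE : Num.sqrt tau ^+ m.+1 = Num.sqrt tau ^+ m.-1 * tau.
  by rewrite -[in LHS](prednK m_gt0) -addn2 exprD sqr_sqrtr ?(ltW tau0).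
rewrite (@eq_cint _ _ _ _ _ (fun t =>
  (- 'i * (Num.sqrt pi ^+ m.+1 / 2 / Num.sqrt tau ^+ m.-1)%:C) *
  (phi (row t) * e_ (dotp v (row t)) * (K' j tau t)%:C))); last first.
  move=> t; rewrite (gP (row t)).2 /K' hposE tau0 mul1r /inverse_gaussian.
  set E := expR _; set x := row t ord0 j.
  have <- : E = expR (- (enorm (row t) ^+ 2 / 4 / tau)).
    by rewrite /E invfM mulrA.
  rewrite sqrtrM ?pi_ge0// sqrtrV ?(ltW tau0)// exprMn exprVn sE.
  have K1 (a b u w q r s : R[i]) : b * r = q * s ->
    a * (u * (w * b) * r) = w * q * (a * u * s).
    by move=> H; transitivity (a * u * w * (b * r)); [ring|rewrite H; ring].
  apply: K1; rewrite -[LHS]rmorphM -[RHS]rmorphM; congr (_%:C).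
  exact: slice_constant.
rewrite cintZ; last exact: cintg_phi_K'.
rewrite mulrA; congr (_ * _); rewrite mulrCA -rmorphM.
by congr (_ * _%:C); rewrite mulrC divfK// expf_neq0.
Qed.

(** Both sides are integrals over tau of those compared in riesz_slice. *)
Lemma riesz_fourier (phi : V -> R[i]) v j : schwartz phi ->
  [/\ cintg mu (fun t => fourier phi (row t) * (riesz v j t)%:C),
      cintg mu (fun t => phi (row t) * e_ (dotp v (row t)) * (riesz_dual j t)%:C) &
      cint mu (fun t => fourier phi (row t) * (riesz v j t)%:C) =
      - 'i * (2 * Num.sqrt pi ^+ m.+1 / G)%:C *
      cint mu (fun t => phi (row t) * e_ (dotp v (row t)) * (riesz_dual j t)%:C)].
Proof.
move=> pS; have [C C0 HC] := fourier_decay pS; have [D D0 HD] := schwartz_bound pS.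
have mF := cmeas_fourier pS; have mP := cmeas_phi v pS.
have i1 : rintg mu (fun t => Normc.normc (fourier phi (row t)) * riesz v j t).
  apply: (@rintg_riesz_mul v j _ C) => //; first exact: measurable_normc.
  by move=> t; rewrite ger0_norm ?normc_ge0.
have i2 : rintg mu (fun t => Normc.normc (phi (row t) * e_ (dotp v (row t))) *
    riesz_dual j t).
  apply: (@rintg_riesz_dual_mul j _ D) => //; first exact: measurable_normc.
  by move=> t; rewrite ger0_norm ?normc_ge0// Normc.normcM normc_cexp_Ni mulr1.
have [_ E1] := cint_superposition mF (measurable_K v j) (measurable_riesz v j)
  (fun t => (K_int v j t).1) (fun t => (K_int v j t).2.1) (fun t => (K_int v j t).2.2) i1.
have [H2 E2] := cint_superposition mP (measurable_K' j) (measurable_riesz_dual j)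
  (fun t => (K'_int j t).1) (fun t => (K'_int j t).2.1) (fun t => (K'_int j t).2.2) i2.
split; [exact: (cintg_mul_of_rintg mF (measurable_riesz v j) i1)
       |exact: (cintg_mul_of_rintg mP (measurable_riesz_dual j) i2)|].
have G0 : G%:C != 0 :> R[i].
  by rewrite -[0]/(0%:C) (inj_eq (@complexI R)) gt_eqF.
apply: (mulfI G0); rewrite E1.
transitivity (- 'i * (Num.sqrt pi ^+ m.+1 / 2 : R)%:C * cint mu1 (fun tau =>
    cint mu (fun t => phi (row t) * e_ (dotp v (row t)) * (K' j tau t)%:C))).
  by rewrite -(cintZ _ H2); apply: eq_cint => tau; exact: riesz_slice.
rewrite -E2 mulrA [in RHS]mulrA; congr (_ * _).
rewrite [in RHS]mulrCA -[LHS]mulrA -!rmorphM; congr (_ * _%:C).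
by field; rewrite gt_eqF.
Qed.

End Riesz.

(** * The Fourier transform of the kernel at a real point *)

Section KernelFourier.
Variables (R : realType) (n : nat).
Local Notation V := 'rV[R]_n.+1.
Local Notation Cl := (cliff R[i] n).
Local Notation T := (n.+1.-tuple (measurableTypeR R)).
Local Notation row := (@row_of_tuple R n).
Local Notation mu := (lebesgue_tuple R n.+1).
Local Notation e_ x := (cexp (- 'i * x%:C)).

(** pv (pconj x) is the combination of these with the coordinates of x. *)
Definition conj_unit (j : 'I_n.+1) : Cl :=
  oapp (fun l => - cliff_gen R[i] l) 1 (unlift ord0 j).

Lemma pv_pconj (x : V) : pv (pconj x) = \sum_j (x ord0 j)%:C *: conj_unit j.
Proof.
rewrite /pv /pconj spart_paravec vpart_paravec big_ord_recl /conj_unit unlift_none /=.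
congr (_ + _); apply: eq_bigr => l _; rewrite liftK /= !mxE.
by rewrite rmorphN scaleNr scalerN.
Qed.

Lemma enorm_sub_real_pv (s : R) (x : V) :
  enorm (x - real_pv n s) ^+ 2 = s ^+ 2 - 2 * spart x * s + enorm x ^+ 2.
Proof.
rewrite !enorm_para.
have -> : vpart (x - real_pv n s) = vpart x.
  by apply/rowP => l; rewrite !mxE liftK /= mxE subr0.
have -> : spart (x - real_pv n s) = spart x - s.
  by rewrite /spart !mxE unlift_none.
by ring.
Qed.

Lemma powR_sqr_half (e : R) k : 0 <= e -> (e ^+ 2) `^ (k%:R / 2) = e ^+ k.
Proof.
move=> e0; rewrite -(powR_mulrn 2 e0) -powRrM mulrC divfK ?pnatr_eq0//.
by rewrite powR_mulrn.
Qed.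

Lemma Fn_riesz (s : R) (t : T) :
  Fn s (row t) = \sum_j (riesz (real_pv n s) j t)%:C *:
    (- gamma_n R n *: conj_unit j).
Proof.
rewrite /Fn -enorm_sub_real_pv powRN powR_sqr_half ?enorm_ge0//.
have -> : pv (real_pv n s) = pv (pconj (real_pv n s)) :> Cl.
  by rewrite /pconj spart_paravec vpart_paravec oppr0.
rewrite !pv_pconj -sumrB scaler_sumr; apply: eq_bigr => j _.
rewrite -scalerBl -rmorphB !scalerA; congr (_ *: _).
rewrite /riesz rmorphM !mxE /=.
set a := oapp _ _ _; set E := (enorm _ ^+ _)^-1.
by rewrite -[a - _]opprB [(- (_ - a))%:C]rmorphN; ring.
Qed.

Lemma e_dotp_real_pv (s : R) (xi : V) :
  e_ (dotp (real_pv n s) xi) = cexp (- 'i * s%:C * (spart xi)%:C).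
Proof.
rewrite -mulrA -rmorphM; congr (cexp (_ * _%:C)).
rewrite /dotp big_ord_recl big1 ?addr0; last first.
  by move=> l _; rewrite !mxE liftK /= mxE mul0r.
by rewrite mxE unlift_none.
Qed.

(** The claimed transform, with a constant k left free. *)
Definition kernel_hat (k : R[i]) (s : R) (xi : V) : Cl :=
  k *: (((spart xi ^+ 2 + enorm (vpart xi) ^+ 2)^-1)%:C *: pv (pconj xi) *
    (cexp (- 'i * s%:C * (spart xi)%:C))%:A).

Lemma kernel_hat_riesz_dual k s (t : T) :
  kernel_hat k s (row t) = \sum_j (e_ (dotp (real_pv n s) (row t)) *
    (riesz_dual j t)%:C) *: (k *: conj_unit j).
Proof.
rewrite /kernel_hat -enorm_para pv_pconj -e_dotp_real_pv -scalerAr mulr1.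
rewrite !scaler_sumr; apply: eq_bigr => j _; rewrite !scalerA; congr (_ *: _).
rewrite /riesz_dual rmorphM /=.
have swap (a b c d : R[i]) : a * b * (c * d) = b * (d * c) * a by ring.
exact: swap.
Qed.

Lemma scale_coord (c : R[i]) (f : Cl) A : (c *: f) A = c * f A.
Proof. by rewrite ffunE. Qed.

Lemma cRe_realM (a : R) (z : R[i]) : complex.Re (a%:C * z) = a * complex.Re z.
Proof. by rewrite cReM /= mul0r subr0. Qed.

Lemma cIm_realM (a : R) (z : R[i]) : complex.Im (a%:C * z) = a * complex.Im z.
Proof. by rewrite cImM /= mul0r addr0. Qed.

(** Integration of a combination of constants of the Clifford algebra reduces to
    the integration of the complex coefficients. *)
Lemma comps_sum (J : finType) (a : J -> T -> R[i]) (b : J -> Cl) (f : V -> Cl) :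
  (forall t, f (row t) = \sum_j a j t *: b j) -> (forall j, cintg mu (a j)) ->
  cl_comps (@rintegrable R n) f /\ cl_integral f = \sum_j cint mu (a j) *: b j.
Proof.
move=> fE ai.
have E A : (fun t => f (row t) A) = (fun t => \sum_j b j A * a j t).
  apply/funext => t; rewrite fE sum_ffunE; apply: eq_bigr => j _.
  by rewrite !ffunE mulrC.
have iA A : cintg mu (fun t => f (row t) A).
  by rewrite E; apply: cintg_sum => j; exact: cintgZ.
split=> [A|]; first exact: iA.
apply/ffunP => A; rewrite ffunE [LHS](_ : _ = cint mu (fun t => f (row t) A))//.
rewrite E cint_sum; last by move=> j; exact: cintgZ.
rewrite sum_ffunE; apply: eq_bigr => j _.
by rewrite cintZ// ffunE mulrC.
Qed.

Lemma measurable_compact_row (K : set V) : compact K -> measurable (row @^-1` K).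
Proof.
move=> cK; rewrite -[K]setCK preimage_setC; apply: measurableC.
apply: (@measurable_open_row _ _ (~` K)); apply: closed_openC.
by apply: compact_closed => //; exact: norm_hausdorff.
Qed.

(** The indicator of a compact set is dominated by the weight, and local
    integrability thus reduces to rintg_riesz_dual_mul. *)
Lemma compact_weight (K : set V) : compact K ->
  exists2 C : R, 0 <= C & forall x, K x -> 1 <= C * weight x.
Proof.
move=> /compact_bounded[N [_ HN]].
pose M := `|N| + 1; exists (\prod_(j < n.+1) (1 + M ^+ 2)).
  by apply: prodr_ge0 => j _; rewrite addr_ge0 ?sqr_ge0.
move=> x Kx; rewrite /weight -big_split /=.
rewrite -[leLHS](@big1 R 1 *%R _ (index_enum 'I_n.+1) xpredT (fun=> 1))//.
apply: ler_prod => j _; rewrite ler01/= /inv1sqr ler_pdivlMr ?ltr_pwDl ?sqr_ge0// mul1r.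
rewrite lerD2l -[leLHS]real_normK ?num_real// lerXn2r ?nnegrE ?addr_ge0//.
have : `|x| <= M by apply: HN => //; rewrite ltr_pwDr// ler_norm.
apply: le_trans; rewrite [leRHS]mx_normrE.
exact: (le_bigmax _ (fun ij : 'I_1 * 'I_n.+1 => `|x ij.1 ij.2|) (ord0, j)).
Qed.

(** At the singular point x = s the numerator vanishes on both sides. *)
Lemma FL_eq_Fn (s : R) : @FL R n (real_pv n s) = Fn s.
Proof.
apply/funext => x; have [->|xs] := eqVneq x (real_pv n s); last exact: FL_real.
rewrite /FL /Fn /pconj spart_paravec vpart_paravec oppr0 -/(real_pv n s) subrr.
by rewrite mul0r !scaler0.
Qed.

Lemma FR_eq_Fn (s : R) : @FR R n (real_pv n s) = Fn s.
Proof.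
apply/funext => x; have [->|xs] := eqVneq x (real_pv n s); last exact: FR_real.
rewrite /FR /Fn /pconj spart_paravec vpart_paravec oppr0 -/(real_pv n s) subrr.
by rewrite mulr0 !scaler0.
Qed.

Hypothesis n_gt0 : (0 < n)%N.

Lemma compact_riesz_dual (K : set V) j : compact K ->
  rintg mu (fun t => \1_(row @^-1` K) t * riesz_dual j t).
Proof.
move=> cK; have [C C0 HC] := compact_weight cK.
apply: (@rintg_riesz_dual_mul _ _ _ _ _ C) => //.
  exact: (@measurable_indic _ _ _ _ _ (measurable_compact_row cK)).
move=> t; rewrite indicE; case: (boolP (t \in _)) => [|_].
  by rewrite inE => /HC; rewrite normr1.
by rewrite normr0 mulr_ge0// ltW// weight_gt0.
Qed.

Lemma kernel_hat_locally_integrable k s :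
  cl_comps (@rlocally_integrable R n) (kernel_hat k s).
Proof.
pose a (j : 'I_n.+1) (t : T) :=
  e_ (dotp (real_pv n s) (row t)) * (riesz_dual j t)%:C.
have me := @cmeas_character R n (real_pv n s).
have ma A : cmeas (fun t => kernel_hat k s (row t) A).
  rewrite (_ : (fun _ => _) = (fun t => \sum_j a j t * (k *: conj_unit j) A)).
    elim: (index_enum _) => [|j r IH].
      by under eq_fun do rewrite big_nil; exact: cmeas_cst.
    under eq_fun do rewrite big_cons; apply: cmeasD IH; apply: cmeasM.
      by apply: cmeasM => //; apply: cmeas_real; exact: measurable_riesz_dual.
    exact: cmeas_cst.
  apply/funext => t; rewrite kernel_hat_riesz_dual sum_ffunE.
  by apply: eq_bigr => j _; rewrite [LHS]ffunE.
have loc (K : set V) (c : V -> R) : compact K ->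
    rintegrable (fun x => \1_K x * c x) ->
    (\int[mu]_(t in row @^-1` K) `|c (row t)|%:E < +oo)%E.
  move=> cK ic; rewrite integral_mkcond.
  have := integrable_lty measurableT (integrable_norm ic); congr (_ < _)%E.
  apply: eq_integral => t _; rewrite /patch /= indicE.
  have -> : (t \in row @^-1` K) = (row t \in K) by [].
  by case: ifP => _; rewrite ?mul1r ?mul0r ?normr0.
have iK (K : set V) : compact K -> cl_comps (@rintegrable R n)
    (fun x => (\1_K x)%:C *: kernel_hat k s x).
  move=> cK; apply: (comps_sum (a := fun j t => e_ (dotp (real_pv n s) (row t)) *
    (\1_(row @^-1` K) t * riesz_dual j t)%:C) (b := fun j => k *: conj_unit j) _ _).1.
    move=> t; rewrite kernel_hat_riesz_dual scaler_sumr; apply: eq_bigr => j _.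
    rewrite scalerA [(_ * riesz_dual j t)%:C]rmorphM /= mulrCA.
    by rewrite !indicE.
  move=> j; apply: (@cintg_mul_bounded _ _ _ _ 1) => //.
    by move=> t; rewrite normc_cexp_Ni.
  exact: cintg_real (compact_riesz_dual j cK).
move=> A; split.
  split; [exact: (ma A).1|move=> K cK].
  apply: (loc K (fun x => complex.Re (kernel_hat k s x A)) cK).
  have := (iK K cK A).1; congr rintegrable; apply/funext => x.
  by rewrite scale_coord cRe_realM.
split; [exact: (ma A).2|move=> K cK].
apply: (loc K (fun x => complex.Im (kernel_hat k s x A)) cK).
have := (iK K cK A).2; congr rintegrable; apply/funext => x.
by rewrite scale_coord cIm_realM.
Qed.

Lemma gamma_dual_constant :
  'i * 'i ^+ n.-1 * (2 ^+ n * pi `^ (n.+1%:R / 2) * Gamma (n.+1%:R / 2 : R))%:C =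
  - gamma_n R n *
    (- 'i * (2 * Num.sqrt pi ^+ n.+1 / Gamma (n.+1%:R / 2 : R))%:C).
Proof.
have G0 : Gamma (n.+1%:R / 2 : R) != 0.
  by rewrite gt_eqF//; have := Gamma_half_gt0 R n.-1; rewrite prednK.
have -> : pi `^ (n.+1%:R / 2) = Num.sqrt pi ^+ n.+1 :> R.
  by rewrite -[in LHS](@sqr_sqrtr R pi) ?pi_ge0// powR_sqr_half ?sqrtr_ge0.
rewrite /gamma_n; set g := Gamma _ in G0 *.
have shape (a b c d : R[i]) : - (b * c) * (- a * d) = a * b * (c * d) by ring.
rewrite shape -rmorphM; congr (_ * _%:C).
by rewrite -{1}(prednK n_gt0) exprS; field.
Qed.

Lemma Fn_fourier k s :
  k = - gamma_n R n *
    (- 'i * (2 * Num.sqrt pi ^+ n.+1 / Gamma (n.+1%:R / 2 : R))%:C) ->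
  is_fourier_transform (@Fn R n s) (kernel_hat k s).
Proof.
move=> kE; split; first exact: kernel_hat_locally_integrable.
move=> phi pS.
have rf j := riesz_fourier n_gt0 (real_pv n s) j pS.
have i1 j : cintg mu (fun t => fourier phi (row t) * (riesz (real_pv n s) j t)%:C).
  by case: (rf j).
have i2 j : cintg mu (fun t => phi (row t) * e_ (dotp (real_pv n s) (row t)) *
    (riesz_dual j t)%:C) by case: (rf j).
have e1 t : fourier phi (row t) *: Fn s (row t) =
    \sum_j (fourier phi (row t) * (riesz (real_pv n s) j t)%:C) *:
      (- gamma_n R n *: conj_unit j).
  rewrite Fn_riesz scaler_sumr; apply: eq_bigr => j _; exact: scalerA.
have e2 t : phi (row t) *: kernel_hat k s (row t) =
    \sum_j (phi (row t) * e_ (dotp (real_pv n s) (row t)) * (riesz_dual j t)%:C) *: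
      (k *: conj_unit j).
  rewrite kernel_hat_riesz_dual scaler_sumr; apply: eq_bigr => j _.
  by rewrite scalerA mulrA.
have [c1 E1] := comps_sum (f := fun x => fourier phi x *: Fn s x) e1 i1.
have [c2 E2] := comps_sum (f := fun x => phi x *: kernel_hat k s x) e2 i2.
split; [exact: c1|exact: c2|refine (etrans E1 (etrans _ (esym E2)))].
apply: eq_bigr => j _; have [_ _ Ej] := rf j.
rewrite Ej !scalerA kE; congr (_ *: _).
have shape (x y z : R[i]) : x * y * z = y * (z * x) by ring.
exact: shape.
Qed.

End KernelFourier.

(** * Uniqueness for the Cauchy-Riemann system *)

Section CauchyRiemann.
Variable R : realType.
Local Notation mu1 := (@lebesgue_measure R).
Local Notation RM := (measurableTypeR R).
Implicit Types (a b p q X Y Z : R -> R -> R) (c u v N : R).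

Definition jointly_continuous a : Prop := continuous (fun z : R * R => a z.1 z.2).

(** a + i b is holomorphic in u + i v, with derivative p - i q. *)
Definition cr_pair a b p q : Prop :=
  [/\ forall u v, hasd (a ^~ v) u (p u v), forall u v, hasd (a u) v (q u v),
      forall u v, hasd (b ^~ v) u (- q u v), forall u v, hasd (b u) v (p u v) &
      [/\ jointly_continuous a, jointly_continuous b,
          jointly_continuous p & jointly_continuous q]].

(** Restrictions to lines, shifts and reflections are instances. *)
Lemma jcont_comp2 (S : topologicalType) a (f g : S -> R) : jointly_continuous a ->
  continuous f -> continuous g -> continuous (fun s => a (f s) (g s)).
Proof.
move=> ca cf cg s; apply: (@continuous_comp _ _ _ (fun s : S => (f s, g s))
  (fun z : R * R => a z.1 z.2)); last exact: ca.
exact: (cvg_pair (cf s) (cg s)).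
Qed.

Lemma jcont_left a v : jointly_continuous a -> continuous (a ^~ v).
Proof.
move=> ca; apply: (jcont_comp2 (f := fun u => u) (g := fun=> v) ca).
  by move=> u; exact: cvg_id.
by move=> u; exact: cvg_cst.
Qed.

Lemma jcontD a b : jointly_continuous a -> jointly_continuous b ->
  jointly_continuous (fun u v => a u v + b u v).
Proof. by move=> ca cb z; apply: cvgD; [exact: ca|exact: cb]. Qed.

Lemma jcontN a : jointly_continuous a -> jointly_continuous (fun u v => - a u v).
Proof. by move=> ca z; apply: cvgN; exact: ca. Qed.

Lemma jcontM a b : jointly_continuous a -> jointly_continuous b ->
  jointly_continuous (fun u v => a u v * b u v).
Proof. by move=> ca cb z; apply: cvgM; [exact: ca|exact: cb]. Qed.

Lemma jcont_cst c : jointly_continuous (fun _ _ => c).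
Proof. by move=> z; exact: cvg_cst. Qed.

Lemma jcont_fst : jointly_continuous (fun u _ => u).
Proof. by move=> z; exact: cvg_fst. Qed.

Lemma jcont_snd : jointly_continuous (fun _ v => v).
Proof. by move=> z; exact: cvg_snd. Qed.

Lemma jcont_comp (h : R -> R) a : continuous h -> jointly_continuous a ->
  jointly_continuous (fun u v => h (a u v)).
Proof.
by move=> ch ca z; apply: (@continuous_comp _ _ _ (fun z : R * R => a z.1 z.2) h);
  [exact: ca|exact: ch].
Qed.

Lemma box_bounded a r : jointly_continuous a ->
  exists2 M : R, 0 <= M & forall u v, `|u| <= r -> `|v| <= r -> `|a u v| <= M.
Proof.
move=> ca; pose K : set (R * R) := `[- r, r]%classic `*` `[- r, r]%classic.
have cK : compact K by apply: compact_setX; exact: segment_compact.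
have /compact_bounded[M [_ HM]] : compact ((fun z : R * R => a z.1 z.2) @` K).
  by apply: continuous_compact => //; exact: continuous_subspaceT.
exists (`|M| + 1) => [|u v ur vr]; first by rewrite addr_ge0.
apply: (HM (`|M| + 1)); first by rewrite ltr_pwDr// ler_norm.
by exists (u, v) => //; split; rewrite /= in_itv /= -ler_norml.
Qed.

Lemma integrable_segment (f : R -> R) (s t : R) : continuous f ->
  mu1.-integrable `[s, t] (EFin \o f).
Proof.
move=> cf; apply: continuous_compact_integrable; first exact: segment_compact.
exact: continuous_subspaceT.
Qed.

(** Green's formula on the strip c - 1 <= u <= c + 1, in the form that is needed:
    the integral over a horizontal segment varies with v only by the values of
    the conjugate function at the two ends. *)
Lemma segment_integral_bound X Y Z c (v0 B : R) : 0 < v0 ->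
  (forall u v, hasd (X u) v (Z u v)) -> (forall u v, hasd (Y ^~ v) u (- Z u v)) ->
  jointly_continuous X -> jointly_continuous Z -> (forall u, X u 0 = 0) ->
  (forall v, 0 <= v <= v0 -> `|Y (c - 1) v| <= B /\ `|Y (c + 1) v| <= B) ->
  `|Rintegral mu1 `[c - 1, c + 1] (X ^~ v0)| <= 2 * B * v0.
Proof.
move=> v00 dX dY cX cZ X0 HB.
pose j v := Rintegral mu1 `[c - 1, c + 1] (X ^~ v).
have cc : c - 1 < c + 1 by lra.
have dj v : hasd j v (Y (c - 1) v - Y (c + 1) v).
  pose f (v : R) (u : RM) := X u v.
  have [M M0 HM] := box_bounded (`|c| + `|v| + 2) cZ.
  have pE w u : partial1of2 f w u = Z u w.
    by rewrite partial1of2E; have [_] := dX u w.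
  have vI : `]v - 1, v + 1[%classic v by rewrite /= in_itv /= gtrBl ltrDl ltr01.
  have H1 w : `]v - 1, v + 1[%classic w ->
      mu1.-integrable `[c - 1, c + 1] (EFin \o f w).
    by move=> _; apply: integrable_segment; exact: jcont_left.
  have H2 w (u : RM) : `]v - 1, v + 1[%classic w -> `[c - 1, c + 1]%classic u ->
      derivable (f ^~ u) w 1.
    by move=> _ _; exact: hasd_derivable (dX u w).
  have H3 w (u : RM) : `]v - 1, v + 1[%classic w -> `[c - 1, c + 1]%classic u ->
      `|partial1of2 f w u| <= M.
    rewrite /= !in_itv /= => /andP[w1 w2] /andP[u1 u2]; rewrite pE; apply: HM.
      by rewrite ler_norml; have := ler_norm c; have := ler_norm (- c);
        rewrite normrN; have := normr_ge0 v; lra.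
    by rewrite ler_norml; have := ler_norm v; have := ler_norm (- v);
      rewrite normrN; have := normr_ge0 c; lra.
  have iM : mu1.-integrable `[c - 1, c + 1] (EFin \o (fun=> M : R)).
    by apply: integrable_segment; exact: cst_continuous.
  have mB : measurable (`[c - 1, c + 1]%classic : set RM) by exact: measurable_itv.
  have D1 := derivable_under_integral mB vI H1 H2 (fun=> M0) iM H3.
  have D2 := differentiation_under_integral mB vI H1 H2 (fun=> M0) iM H3.
  split; first exact: D1.
  rewrite -derive1E [LHS]D2.
  rewrite (_ : Rintegral _ _ _ = Rintegral mu1 `[c - 1, c + 1] (Z ^~ v)); last first.
    by apply: eq_Rintegral => u _; exact: pE.
  rewrite (integral_hasd cc (_ : forall u, hasd (fun u => - Y u v) u (Z u v)) _).
  - by rewrite opprK addrC.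
  - by move=> u; apply: hasd_eq (hasdN (dY u v)) _; rewrite opprK.
  - exact: jcont_left.
have j0 : j 0 = 0.
  rewrite /j (@eq_Rintegral _ _ _ _ _ (fun=> 0))//.
  by rewrite Rintegral_cst//= mul0r.
have [x x0 E] := MVT v00 (fun x _ => dj x)
  (continuous_subspaceT (hasd_continuous (fun x => ex_intro _ _ (dj x)))).
have -> : Rintegral mu1 `[c - 1, c + 1] (X ^~ v0) = j v0 - j 0 by rewrite j0 subr0.
rewrite E subr0 normrM.
rewrite [ `|v0| ]gtr0_norm//.
rewrite ler_wpM2r ?(ltW v00)//.
have [] := HB x; first by move: x0; rewrite in_itv /= => /andP[/ltW -> /ltW ->].
move=> h1 h2; rewrite (le_trans (ler_normB _ _))//; lra.
Qed.

(** Near c the function is at least f c / 2, and far from c the quadratic term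
    outweighs the bound M. *)
Lemma quadratic_minorant (f : R -> R) c (M : R) : continuous f -> 0 < f c ->
  (forall u, c - 1 <= u <= c + 1 -> `|f u| <= M) -> exists2 C : R, 0 <= C &
  forall u, c - 1 <= u <= c + 1 -> f c / 2 - C * (u - c) ^+ 2 <= f u.
Proof.
move=> cf fc HM.
have M0 : 0 <= M by apply: le_trans (HM c _) => //; lra.
have : \forall u \near c, f c / 2 < f u.
  by have := cf c; move/cvgr_gt; apply; lra.
move=> /nbhs_ballP[e /= e0 He].
exists ((f c / 2 + M) / e ^+ 2).
  by rewrite divr_ge0 ?sqr_ge0// addr_ge0// divr_ge0// ltW.
move=> u u1; have [ue|ue] := ltP `|u - c| e.
  apply: (@le_trans _ _ (f c / 2)); last by apply/ltW/He; rewrite /ball /= distrC.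
  rewrite gerBl mulr_ge0 ?sqr_ge0// divr_ge0 ?sqr_ge0// addr_ge0// divr_ge0// ltW//.
have : f c / 2 + M <= (f c / 2 + M) / e ^+ 2 * (u - c) ^+ 2.
  rewrite mulrAC ler_pdivlMr ?exprn_gt0// ler_wpM2l//.
    by rewrite addr_ge0// divr_ge0// ltW.
  by rewrite -[leRHS]real_normK ?num_real// lerXn2r ?nnegrE ?(ltW e0).
have := HM _ u1; rewrite ler_norml => /andP[]; lra.
Qed.

(** In (f c / 2 - C x^2) e^(- N x^2) the term x^2 is removed through the derivative
    (1 - 2 N x^2) e^(- N x^2) of x e^(- N x^2), and e^(- N x^2) is compared with
    its tangent at x^2 = 1 / 2. *)
Lemma gaussian_integral_minorant (f : R -> R) c (al C N : R) : 0 < al -> 0 <= C ->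
  continuous f -> 0 < N -> 2 * C / al <= N ->
  (forall u, c - 1 <= u <= c + 1 -> al / 2 - C * (u - c) ^+ 2 <= f u) ->
  al / 2 * expR (- (N / 2)) <=
  Rintegral mu1 `[c - 1, c + 1] (fun u => expR (- (N * (u - c) ^+ 2)) * f u).
Proof.
move=> al0 C0 cf N0 NC Hf; pose e := expR (- (N / 2)).
pose E (u : R) := expR (- (N * (u - c) ^+ 2)).
pose H (u : R) := al / 4 * e * ((1 + N / 2) * (u - c) - N / 3 * (u - c) ^+ 3) +
  C / (2 * N) * ((u - c) * E u).
pose g (u : R) := al / 4 * e * ((1 + N / 2) - N * (u - c) ^+ 2) +
  C / (2 * N) * ((1 - 2 * N * (u - c) ^+ 2) * E u).
have dH u : hasd H u (g u) by hasd_by (rewrite /g /E expr1; field; rewrite gt_eqF).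
have cE : continuous E.
  by apply: hasd_continuous => u; eexists; rewrite /E; hasd.
have cg : continuous g.
  by apply: hasd_continuous => u; eexists; rewrite /g /E; hasd.
have cc : c - 1 < c + 1 by lra.
have Hg : al / 2 * e <= Rintegral mu1 `[c - 1, c + 1] g.
  rewrite (integral_hasd cc dH cg) /H.
  have -> : c + 1 - c = 1 by ring.
  have -> : c - 1 - c = -1 by ring.
  have -> : (-1) ^+ 3 = -1 :> R by ring.
  have k0 : 0 <= C / (2 * N) by rewrite divr_ge0// mulr_ge0// ltW.
  rewrite expr1n; move: (C / (2 * N)) k0 => k k0.
  have h1 : 0 <= k * E (c + 1) by rewrite mulr_ge0 ?expR_ge0.
  have h2 : 0 <= k * E (c - 1) by rewrite mulr_ge0 ?expR_ge0.
  have h3 : 0 <= al * e * N by rewrite !mulr_ge0 ?expR_ge0 ?ltW.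
  move: (E _) (E _) h1 h2 => x y h1 h2; clear -h1 h2 h3; lra.
suff gf : forall u : R, c - 1 <= u <= c + 1 -> g u <= E u * f u.
  apply: (le_trans Hg); apply: le_Rintegral => //.
  - exact: integrable_segment.
  - apply: integrable_segment => u; apply: cvgM; first exact: cE.
    exact: cf.

move=> u u1; apply: (@le_trans _ _ (E u * (al / 2 - C * (u - c) ^+ 2))); last first.
  by rewrite ler_wpM2l ?expR_ge0// Hf.
have eE : e * (1 + (N / 2 - N * (u - c) ^+ 2)) <= E u.
  have -> : E u = e * expR (N / 2 - N * (u - c) ^+ 2).
    by rewrite -expRD; congr expR; ring.
  by rewrite ler_wpM2l ?expR_ge0// expR_ge1Dx.
have CN : C / (2 * N) <= al / 4.
  rewrite ler_pdivrMr ?mulr_gt0//; move: NC; rewrite ler_pdivrMr//; lra.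
have h1 : al / 4 * (e * (1 + (N / 2 - N * (u - c) ^+ 2))) <= al / 4 * E u.
  by rewrite ler_wpM2l// divr_ge0// ltW.
have h2 : C / (2 * N) * E u <= al / 4 * E u by rewrite ler_wpM2r// expR_ge0.
have -> : g u = al / 4 * (e * (1 + (N / 2 - N * (u - c) ^+ 2))) +
    C / (2 * N) * E u - C * (u - c) ^+ 2 * E u.
  by rewrite /g; field; rewrite gt_eqF.
clear -h1 h2; lra.
Qed.

(** Let F = a + i b, w = c + i v0 and suppose Re F(w) > 0. Let X and Y be the real
    and imaginary parts of F(z) e^(- N (z - w)^2). Since F vanishes for v = 0, the
    integral of X over the segment v = v0 is controlled by Y on the vertical sides
    |u - c| = 1, where the Gaussian is at most e^(- 3 N / 4) because v0 <= 1/2. On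
    the segment itself the Gaussian is real and the integral is at least
    (Re F(w) / 2) e^(- N / 2), a contradiction for large N. *)
Lemma cr_strip_le0 a b p q c v0 : cr_pair a b p q ->
  (forall u, a u 0 = 0) -> (forall u, b u 0 = 0) -> 0 < v0 <= 1 / 2 -> a c v0 <= 0.
Proof.
move=> [au av bu bv [ca cb cp cq]] a0 b0 /andP[v00 v01].
rewrite leNgt; apply/negP => al0.
have [M1 M10 HM1] := box_bounded (`|c| + 1) ca.
have [M2 M20 HM2] := box_bounded (`|c| + 1) cb.
pose M := M1 + M2.
have [C C0 HC] : exists2 C : R, 0 <= C &
    forall u, c - 1 <= u <= c + 1 -> a c v0 / 2 - C * (u - c) ^+ 2 <= a u v0.
  apply: (quadratic_minorant (M := M1)) => //; first exact: jcont_left.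
  move=> u /andP[u1 u2]; apply: HM1; rewrite ler_norml.
    by have := ler_norm c; have := ler_norm (- c); rewrite normrN; lra.
  by have := normr_ge0 c; lra.
pose al := a c v0.
pose N := 2 * C / al + 32 * M / al + 1.
have M0 : 0 <= M by exact: addr_ge0.
have N0 : 0 < N by rewrite ltr_pwDr// addr_ge0// divr_ge0 ?mulr_ge0 ?(ltW al0).
pose E u v := expR (- (N * ((u - c) ^+ 2 - (v - v0) ^+ 2))).
pose th u v := 2 * N * (u - c) * (v - v0).
pose X u v := E u v * (a u v * cos (th u v) + b u v * sin (th u v)).
pose Y u v := E u v * (b u v * cos (th u v) - a u v * sin (th u v)).
pose Z u v := E u v * (2 * N * (v - v0) * (a u v * cos (th u v) + b u v * sin (th u v))
  + 2 * N * (u - c) * (b u v * cos (th u v) - a u v * sin (th u v))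
  + q u v * cos (th u v) + p u v * sin (th u v)).
have dX u v : hasd (X u) v (Z u v).
  have h1 := av u v; have h2 := bv u v; rewrite /X /E /th.
  hasd_by (rewrite /Z /E /th expr1; ring).
have dY u v : hasd (Y ^~ v) u (- Z u v).
  have h1 := au u v; have h2 := bu u v; rewrite /Y /E /th.
  hasd_by (rewrite /Z /E /th expr1; ring).
have jf w : jointly_continuous (fun u _ => u - w).
  by apply: jcontD; [exact: jcont_fst|exact: jcont_cst].
have js w : jointly_continuous (fun _ v => v - w).
  by apply: jcontD; [exact: jcont_snd|exact: jcont_cst].
have cth : jointly_continuous th.
  apply: jcontM => //; apply: jcontM => //; exact: jcont_cst.
have cE : jointly_continuous E.
  apply: (jcont_comp (h := @expR R)); first exact: continuous_expR.
  apply: jcontN; apply: jcontM; first exact: jcont_cst.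
  by apply: jcontD; [exact: jcontM|apply: jcontN; exact: jcontM].
have cc := jcont_comp (@continuous_cos R) cth.
have cs := jcont_comp (@continuous_sin R) cth.
have cX : jointly_continuous X.
  by apply: jcontM => //; apply: jcontD; exact: jcontM.
have cY' : jointly_continuous (fun u v => b u v * cos (th u v) - a u v * sin (th u v)).
  by apply: jcontD; [exact: jcontM|apply: jcontN; exact: jcontM].
have cZ : jointly_continuous Z.
  apply: jcontM => //; apply: jcontD; last exact: jcontM.
  apply: jcontD; last exact: jcontM.
  apply: jcontD; apply: jcontM => //.
  - by apply: jcontM => //; exact: jcont_cst.
  - by apply: jcontD; exact: jcontM.
  - by apply: jcontM => //; exact: jcont_cst.
have X0 u : X u 0 = 0 by rewrite /X a0 b0 !mul0r addr0 mulr0.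
have Y1 s v : `|s - c| = 1 -> 0 <= v <= v0 -> `|Y s v| <= M * expR (- (3 / 4 * N)).
  move=> s1 /andP[v1 v2]; rewrite normrM ger0_norm ?expR_ge0// mulrC.
  apply: ler_pM; rewrite ?expR_ge0//.
    have sc : `|s| <= `|c| + 1.
      by rewrite -(subrK c s) -s1 addrC (le_trans (ler_normD _ _)).
    have vc : `|v| <= `|c| + 1.
      by rewrite ger0_norm//; have := normr_ge0 c; lra.
    rewrite (le_trans (ler_normB _ _))// addrC /M.
    by apply: lerD; rewrite normrM (le_trans (ler_piMr _ _)) ?cos_max ?sin_max//;
      [exact: HM1|exact: HM2].
  rewrite ler_expR lerN2 -[(s - c) ^+ 2]real_normK ?num_real// s1 mulrC.
  rewrite ler_wpM2l ?(ltW N0)//; nra.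
have H := segment_integral_bound v00 dX dY cX cZ X0.
have s1 : `|c - 1 - c| = 1.
  have -> : c - 1 - c = -1 by ring.
  by rewrite normrN1.
have s2 : `|c + 1 - c| = 1 by rewrite addrAC subrr add0r normr1.
have {}H := H c _ (fun v hv => conj (Y1 (c - 1) v s1 hv) (Y1 (c + 1) v s2 hv)).
(* N is large enough for the lower bound, and for the comparison at the end. *)
have L := gaussian_integral_minorant al0 C0 (jcont_left (v := v0) ca) N0 _ HC.
have NC : 2 * C / al <= N.
  by rewrite /N -addrA lerDl addr_ge0// divr_ge0 ?mulr_ge0// ltW.
have XE : Rintegral mu1 `[c - 1, c + 1] (X ^~ v0) = Rintegral mu1 `[c - 1, c + 1]
    (fun u => expR (- (N * (u - c) ^+ 2)) * a u v0).
  apply: eq_Rintegral => u _; rewrite /X /E /th subrr mulr0 cos0 sin0 mulr1 mulr0.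
  by rewrite addr0 expr0n /= subr0.
rewrite XE in H; have {}H := le_trans (le_trans (L NC) (ler_norm _)) H.
have EN : expR (- (N / 2)) = expR (- (3 / 4 * N)) * expR (N / 4) :> R.
  by rewrite -expRD; congr expR; field.
have e0 := expR_gt0 (- (3 / 4 * N)).
have : al / 2 * expR (N / 4) <= M.
  rewrite -(ler_pM2r e0).
  have -> : al / 2 * expR (N / 4) * expR (- (3 / 4 * N)) = al / 2 * expR (- (N / 2)).
    by rewrite EN; ring.
  rewrite (le_trans H)//.
  by rewrite mulrAC ler_piMl ?mulr_ge0 ?(ltW e0)//; lra.
apply/negP; rewrite -ltNge.
have e1 := expR_ge1Dx (N / 4).
apply: (@lt_le_trans _ _ (al / 2 * (1 + N / 4))); last first.
  by rewrite ler_wpM2l// divr_ge0// ltW.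
have -> : al / 2 * (1 + N / 4) = 4 * M + (C / 4 + al / 2 + al / 8).
  by rewrite /N; field; rewrite gt_eqF.
clear -M0 C0 al0; rewrite /al; lra.
Qed.

Lemma cr_opp a b p q : cr_pair a b p q ->
  cr_pair (fun u v => - a u v) (fun u v => - b u v)
          (fun u v => - p u v) (fun u v => - q u v).
Proof.
move=> [au av bu bv [ca cb cp cq]]; split=> [u v|u v|u v|u v|].
- exact: hasdN.
- exact: hasdN.
- exact: (hasdN (bu u v)).
- exact: hasdN.
- by split; exact: jcontN.
Qed.

Lemma cr_rotate a b p q : cr_pair a b p q ->
  cr_pair b (fun u v => - a u v) (fun u v => - q u v) p.
Proof.
move=> [au av bu bv [ca cb cp cq]]; split=> [u v|u v|u v|u v|] //.
- exact: (hasdN (au u v)).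
- exact: (hasdN (av u v)).
- by split=> //; exact: jcontN.
Qed.

Lemma cr_shift a b p q w : cr_pair a b p q ->
  cr_pair (fun u v => a u (v + w)) (fun u v => b u (v + w))
          (fun u v => p u (v + w)) (fun u v => q u (v + w)).
Proof.
move=> [au av bu bv [ca cb cp cq]].
have dv (f : R -> R) v x : hasd f (v + w) x -> hasd (fun v => f (v + w)) v x.
  move=> h; apply: (@hasd_eq _ _ _ (x * (1 + 0))); last by rewrite addr0 mulr1.
  by apply: (hasd_comp (f := f)) => //; hasd.
have jc (f : R -> R -> R) : jointly_continuous f ->
    jointly_continuous (fun u v => f u (v + w)).
  move=> cf; apply: (jcont_comp2 cf); first exact: jcont_fst.
  by move=> z; apply: cvgD; [exact: cvg_snd|exact: cvg_cst].
split=> [u v|u v|u v|u v|].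
- exact: au.
- exact: dv.
- exact: bu.
- exact: dv.
- by split; exact: jc.
Qed.

Lemma cr_reflect a b p q : cr_pair a b p q ->
  cr_pair (fun u v => a u (- v)) (fun u v => - b u (- v))
          (fun u v => p u (- v)) (fun u v => - q u (- v)).
Proof.
move=> [au av bu bv [ca cb cp cq]].
have dv (f : R -> R) v x : hasd f (- v) x -> hasd (fun v => f (- v)) v (- x).
  move=> h; apply: (@hasd_eq _ _ _ (x * - 1)); last by rewrite mulrN1.
  by apply: (hasd_comp (f := f)) => //; hasd.
have jc (f : R -> R -> R) : jointly_continuous f ->
    jointly_continuous (fun u v => f u (- v)).
  move=> cf; apply: (jcont_comp2 cf); first exact: jcont_fst.
  by move=> z; apply: cvgN; exact: cvg_snd.
split=> [u v|u v|u v|u v|].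
- exact: au.
- exact: dv.
- exact: (hasdN (bu u _)).
- by rewrite -[p u (- v)]opprK; apply: hasdN; exact: dv.
- by split; [|apply: jcontN| |apply: jcontN]; exact: jc.
Qed.

(** The sign and the roles of a and b are exchanged by multiplying F by -1 and
    by - i. *)
Lemma cr_strip a b p q w c v : cr_pair a b p q ->
  (forall u, a u w = 0) -> (forall u, b u w = 0) -> w <= v <= w + 1 / 2 ->
  a c v = 0 /\ b c v = 0.
Proof.
move=> h aw bw /andP[]; rewrite le_eqVlt => /orP[/eqP <- _|wv vw].
  by rewrite aw bw.
have vv : 0 < v - w <= 1 / 2 by apply/andP; split; lra.
have le0 a' b' p' q' : cr_pair a' b' p' q' -> (forall u, a' u w = 0) ->
    (forall u, b' u w = 0) -> a' c v <= 0.
  move=> h' aw' bw'.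
  have := cr_strip_le0 c (cr_shift w h') _ _ vv; rewrite subrK; apply=> u;
    by rewrite add0r.
have eq0 a' b' p' q' : cr_pair a' b' p' q' -> (forall u, a' u w = 0) ->
    (forall u, b' u w = 0) -> a' c v = 0.
  move=> h' aw' bw'; apply/eqP; rewrite eq_le (le0 _ _ _ _ h')//=.
  by rewrite -oppr_le0; apply: (le0 _ _ _ _ (cr_opp h')) => u; rewrite ?aw' ?bw' oppr0.
split; first exact: (eq0 _ _ _ _ h).
by apply: (eq0 _ _ _ _ (cr_rotate h)) => // u; rewrite aw oppr0.
Qed.

Lemma cr_upper a b p q : cr_pair a b p q ->
  (forall u, a u 0 = 0) -> (forall u, b u 0 = 0) ->
  forall u v, 0 <= v -> a u v = 0 /\ b u v = 0.
Proof.
move=> h a0 b0 u v v0.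
suff H k : forall u v, 0 <= v <= k%:R / 2 -> a u v = 0 /\ b u v = 0.
  apply: (H (Num.truncn (2 * v)).+1); rewrite v0/= ler_pdivlMr// mulrC.
  by apply/ltW/truncnS_gt; rewrite num_real.
elim: k => [|k IH] {}u {v0}v.
  by rewrite mul0r -eq_le => /eqP <-.
move=> /andP[v0 vk]; have [vk'|vk'] := leP v (k%:R / 2).
  by apply: IH; rewrite v0.
have k0 : 0 <= (k%:R / 2 : R) <= k%:R / 2.
  by apply/andP; split=> //; rewrite divr_ge0.
apply: (cr_strip (w := k%:R / 2) u h).
- by move=> x; have [] := IH x _ k0.
- by move=> x; have [] := IH x _ k0.
- rewrite (ltW vk')/=; move: vk; rewrite -natr1; lra.
Qed.

(** Strips of height 1/2 are stacked upwards, and the lower half-plane is reached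
    by the reflection z |-> conj z, F |-> conj F. *)
Lemma cr_unique a b p q : cr_pair a b p q ->
  (forall u, a u 0 = 0) -> (forall u, b u 0 = 0) ->
  forall u v, a u v = 0 /\ b u v = 0.
Proof.
move=> h a0 b0 u v; have [v0|v0] := leP 0 v; first exact: (cr_upper h a0 b0 u v0).
have Nv0 : 0 <= - v by rewrite oppr_ge0 ltW.
have [] := cr_upper (cr_reflect h) _ _ u Nv0.
- by move=> x; rewrite oppr0.
- by move=> x; rewrite oppr0 b0 oppr0.
by rewrite opprK => -> /eqP; rewrite oppr_eq0 => /eqP ->.
Qed.

End CauchyRiemann.

(** * Uniqueness of slice monogenic extensions *)

Section SliceUniqueness.
Variables (R : realType) (n : nat).
Local Notation V := 'rV[R]_n.+1.
Local Notation Cl := (cliff R[i] n).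
Local Notation P := (R^o * R^o)%type.
Implicit Types (f g : P -> Cl) (h : V -> Cl).

Lemma rC1_hasd (g : P -> R) : rC1 setT g ->
  (forall u v, hasd (fun x => g (x, v)) u ('D_((1, 0) : P) (g : P -> R^o) (u, v))) /\
  (forall u v, hasd (fun y => g (u, y)) v ('D_((0, 1) : P) (g : P -> R^o) (u, v))).
Proof.
move=> [dg _ _].
have Eu (x y : R) : (0, y) + x *: (1, 0) = (x, y) :> P.
  by rewrite -[LHS]/(0 + x * 1, y + x * 0) mulr1 mulr0 add0r addr0.
have Ev (x y : R) : (x, 0) + y *: (0, 1) = (x, y) :> P.
  by rewrite -[LHS]/(x + y * 0, 0 + y * 1) mulr1 mulr0 add0r addr0.
split=> u v.
  have := @derivative_line R _ g ((0, v) : P) ((1, 0) : P) u (dg _ I).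
  rewrite (_ : (fun _ => g _) = (fun x => g (x, v))) ?Eu//.
  by apply/funext => x; rewrite Eu.
have := @derivative_line R _ g ((u, 0) : P) ((0, 1) : P) v (dg _ I).
rewrite (_ : (fun _ => g _) = (fun y => g (u, y))) ?Ev//.
by apply/funext => x; rewrite Ev.
Qed.

Lemma jcont_pair (g : P -> R) : {in setT, forall p, {for p, continuous g}} ->
  jointly_continuous (fun u v => g (u, v)).
Proof.
move=> cg z; rewrite (_ : (fun z : R * R => _) = (g : R * R -> R)).
  exact: (cg z (in_setT z)).
by apply/funext => -[].
Qed.

Lemma rC1_jcont (g : P -> R) : rC1 setT g ->
  [/\ jointly_continuous (fun u v => g (u, v)),
    jointly_continuous (fun u v => 'D_((1, 0) : P) (g : P -> R^o) (u, v)) &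
    jointly_continuous (fun u v => 'D_((0, 1) : P) (g : P -> R^o) (u, v))].
Proof.
move=> [dg cu cv]; split.
- by apply: (@jcont_pair g) => p _; exact: (differentiable_continuous (dg p I)).
- by apply: (@jcont_pair (fun p => 'D_((1, 0) : P) (g : P -> R^o) p)) => p _; exact: (cu p I).
- by apply: (@jcont_pair (fun p => 'D_((0, 1) : P) (g : P -> R^o) p)) => p _; exact: (cv p I).
Qed.

Lemma cr_sub (a b p q a' b' p' q' : R -> R -> R) :
  cr_pair a b p q -> cr_pair a' b' p' q' ->
  cr_pair (fun u v => a u v - a' u v) (fun u v => b u v - b' u v)
          (fun u v => p u v - p' u v) (fun u v => q u v - q' u v).
Proof.
move=> [au av bu bv [ca cb cp cq]] [au' av' bu' bv' [ca' cb' cp' cq']].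
have dB (f g : R -> R) x y z : hasd f x y -> hasd g x z ->
    hasd (fun x => f x - g x) x (y - z).
  by move=> hf hg; apply: hasdD => //; exact: hasdN.
have cB (f g : R -> R -> R) : jointly_continuous f -> jointly_continuous g ->
    jointly_continuous (fun u v => f u v - g u v).
  by move=> cf cg; apply: jcontD => //; exact: jcontN.
split=> [u v|u v|u v|u v|]; [exact: dB|exact: dB| |exact: dB|by split; exact: cB].
by rewrite opprB addrC -[X in hasd _ _ (_ + X)]opprK; exact: dB.
Qed.

Lemma rC1_cr (a b : P -> R) : rC1 setT a -> rC1 setT b ->
  (forall u v, 'D_((1, 0) : P) (b : P -> R^o) (u, v) =
     - 'D_((0, 1) : P) (a : P -> R^o) (u, v)) ->
  (forall u v, 'D_((0, 1) : P) (b : P -> R^o) (u, v) =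
     'D_((1, 0) : P) (a : P -> R^o) (u, v)) ->
  cr_pair (fun u v => a (u, v)) (fun u v => b (u, v))
    (fun u v => 'D_((1, 0) : P) (a : P -> R^o) (u, v))
    (fun u v => 'D_((0, 1) : P) (a : P -> R^o) (u, v)).
Proof.
move=> ha hb e1 e2; have [au av] := rC1_hasd ha; have [bu bv] := rC1_hasd hb.
have [ca cp cq] := rC1_jcont ha; have [cb _ _] := rC1_jcont hb.
split=> [||u v|u v|]; [exact: au|exact: av|rewrite -e1; exact: bu
  |rewrite -e2; exact: bv|by split].
Qed.

Lemma slice_pair_cr f0 f1 A : slice_pair setT f0 f1 ->
  cr_pair (fun u v => complex.Re (f0 (u, v) A)) (fun u v => complex.Re (f1 (u, v) A))
    (fun u v => 'D_((1, 0) : P) (fun q => complex.Re (f0 q A) : R^o) (u, v))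
    (fun u v => 'D_((0, 1) : P) (fun q => complex.Re (f0 q A) : R^o) (u, v)) /\
  cr_pair (fun u v => complex.Im (f0 (u, v) A)) (fun u v => complex.Im (f1 (u, v) A))
    (fun u v => 'D_((1, 0) : P) (fun q => complex.Im (f0 q A) : R^o) (u, v))
    (fun u v => 'D_((0, 1) : P) (fun q => complex.Im (f0 q A) : R^o) (u, v)).
Proof.
move=> [c0 c1 H].
have [r0 i0] := c0 A; have [r1 i1] := c1 A.
have CR u v : cl_deriv (1, 0) f0 (u, v) A = cl_deriv (0, 1) f1 (u, v) A /\
    cl_deriv (1, 0) f1 (u, v) A = - cl_deriv (0, 1) f0 (u, v) A.
  have [_ _ E1 E2] := H u v I; split.
    by apply/eqP; rewrite -subr_eq0; move/ffunP/(_ A): E1; rewrite !ffunE => ->.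
  by apply/eqP; rewrite -addr_eq0 addrC; move/ffunP/(_ A): E2; rewrite !ffunE => ->.
have Re_eq (z w : R[i]) : z = w -> complex.Re z = complex.Re w by move=> ->.
have Im_eq (z w : R[i]) : z = w -> complex.Im z = complex.Im w by move=> ->.
have E1 u v := (CR u v).1; have E2 u v := (CR u v).2.
split.
  apply: (rC1_cr r0 r1) => u v.
    by move: (Re_eq _ _ (E2 u v)); rewrite !ffunE.
  by move: (Re_eq _ _ (E1 u v)); rewrite !ffunE.
apply: (rC1_cr i0 i1) => u v.
  by move: (Im_eq _ _ (E2 u v)); rewrite !ffunE.
by move: (Im_eq _ _ (E1 u v)); rewrite !ffunE.
Qed.

(** Parity at v = 0. *)
Lemma slice_pair_odd f0 f1 u : slice_pair setT f0 f1 -> f1 (u, 0) = 0.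
Proof.
move=> [_ _ H]; have [_ + _ _] := H u 0 I; rewrite oppr0 => E.
have odd (x : R) : x = - x -> x = 0 by lra.
apply/ffunP => A; rewrite [RHS]ffunE; move/ffunP/(_ A): E; rewrite ffunE => E.
apply: complexP; apply: odd.
  by rewrite {1}E cReN.
by rewrite {1}E cImN.
Qed.

(** The components of the difference of two pairs are Cauchy-Riemann pairs that
    vanish on the real axis. *)
Lemma slice_pair_unique f0 f1 g0 g1 :
  slice_pair setT f0 f1 -> slice_pair setT g0 g1 ->
  (forall u, f0 (u, 0) = g0 (u, 0)) -> forall p, f0 p = g0 p /\ f1 p = g1 p.
Proof.
move=> hf hg E [u v].
have E1 w : f1 (w, 0) = g1 (w, 0) by rewrite (slice_pair_odd w hf) (slice_pair_odd w hg).
have Z A : f0 (u, v) A = g0 (u, v) A /\ f1 (u, v) A = g1 (u, v) A.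
  have [fr fi] := slice_pair_cr A hf; have [gr gi] := slice_pair_cr A hg.
  have [|| /eqP r0 /eqP r1] := cr_unique (cr_sub fr gr) _ _ u v.
  - by move=> w; rewrite E subrr.
  - by move=> w; rewrite E1 subrr.
  have [|| /eqP i0 /eqP i1] := cr_unique (cr_sub fi gi) _ _ u v.
  - by move=> w; rewrite E subrr.
  - by move=> w; rewrite E1 subrr.
  move: r0 r1 i0 i1; rewrite !subr_eq0 => /eqP r0 /eqP r1 /eqP i0 /eqP i1.
  by split; apply: complexP.
by split; apply/ffunP => A; have [] := Z A.
Qed.

Lemma slice_domainT : slice_domain [set: V] = setT.
Proof. by apply/seteqP; split. Qed.

Hypothesis n_gt0 : (0 < n)%N.

(** For n = 0 the sphere is empty and slice monogenicity is a void condition. *)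
Lemma unit_sphere_nonempty : exists I : 'rV[R]_n, unit_sphere I.
Proof.
exists (delta_mx ord0 (Ordinal n_gt0)); rewrite /unit_sphere /= /enorm.
rewrite (bigD1 (Ordinal n_gt0))//= mxE !eqxx expr1n big1 ?addr0 ?sqrtr1// => j ji.
by rewrite mxE (negbTE ji) andbF expr0n.
Qed.

Lemma paravec_polar (x : V) :
  exists u v I, unit_sphere I /\ x = paravec u (v *: I).
Proof.
have xE : x = paravec (spart x) (vpart x).
  by apply/rowP => j; rewrite mxE; case: unliftP => [l|] -> //=; rewrite mxE.
have [w0|w0] := eqVneq (vpart x) 0.
  have [I uI] := unit_sphere_nonempty; exists (spart x), 0, I; split=> //.
  by rewrite {1}xE w0 scale0r.
have e0 : enorm (vpart x) != 0.
  apply: contra w0 => /eqP e0; apply/eqP/rowP => j; rewrite [RHS]mxE; apply/eqP.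
  rewrite -sqrf_eq0; move: (enorm_sqr (vpart x)); rewrite e0 expr0n /=.
  by move=> /esym/psumr_eq0P ->// i _; exact: sqr_ge0.
exists (spart x), (enorm (vpart x)), ((enorm (vpart x))^-1 *: vpart x); split.
  rewrite /unit_sphere /= -[RHS](mulVf e0) -{2}[(enorm _)^-1]ger0_norm; last first.
    by rewrite invr_ge0 sqrtr_ge0.
  rewrite -sqrtr_sqr -{3}/(enorm _) /enorm -sqrtrM ?sqr_ge0//; congr Num.sqrt.
  by rewrite mulr_sumr; apply: eq_bigr => j _; rewrite mxE exprMn.
by rewrite scalerA divff// scale1r.
Qed.

(** Side is multiplication from the left or from the right. *)
Lemma slice_unique (side : Cl -> Cl -> Cl) (h h' : V -> Cl) :
  (forall a, side a 0 = 0) ->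
  (exists f0 f1, slice_pair (slice_domain [set: V]) f0 f1 /\ forall u v I,
     unit_sphere I -> setT (paravec u (v *: I)) ->
     h (paravec u (v *: I)) = f0 (u, v) + side (pv (paravec 0 I)) (f1 (u, v))) ->
  (exists f0 f1, slice_pair (slice_domain [set: V]) f0 f1 /\ forall u v I,
     unit_sphere I -> setT (paravec u (v *: I)) ->
     h' (paravec u (v *: I)) = f0 (u, v) + side (pv (paravec 0 I)) (f1 (u, v))) ->
  (forall s : R, h (real_pv n s) = h' (real_pv n s)) -> h = h'.
Proof.
rewrite slice_domainT => side0 [f0 [f1 [hf Ef]]] [g0 [g1 [hg Eg]]] hh'.
have [J uJ] := unit_sphere_nonempty.
have realE s : real_pv n s = paravec s (0 *: J) by rewrite scale0r.
have E u : f0 (u, 0) = g0 (u, 0).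
  have := hh' u; rewrite realE Ef// Eg// (slice_pair_odd u hf) (slice_pair_odd u hg).
  by rewrite side0 !addr0.
apply/funext => x; have [u [v [I [uI ->]]]] := paravec_polar x.
by rewrite Ef// Eg//; have [-> ->] := slice_pair_unique hf hg E (u, v).
Qed.

Lemma left_slice_unique h h' :
  left_slice_monogenic setT h -> left_slice_monogenic setT h' ->
  (forall s : R, h (real_pv n s) = h' (real_pv n s)) -> h = h'.
Proof.
move=> [_ _ H] [_ _ H']; apply: (slice_unique (side := fun J a => J * a)) H H' => a.
exact: mulr0.
Qed.

Lemma right_slice_unique h h' :
  right_slice_monogenic setT h -> right_slice_monogenic setT h' ->
  (forall s : R, h (real_pv n s) = h' (real_pv n s)) -> h = h'.
Proof.
move=> [_ _ H] [_ _ H']; apply: (slice_unique (side := fun J a => a * J)) H H' => a.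
exact: mul0r.
Qed.

Lemma intrinsic_left h : intrinsic_slice_monogenic setT h -> left_slice_monogenic setT h.
Proof.
by move=> [oU aU [g0 [g1 H]]]; split=> //; exists (fun p => (g0 p)%:A), (fun p => (g1 p)%:A).
Qed.

End SliceUniqueness.

(** * The slice monogenic exponential *)

Section ComplexExponential.
Variable R : realType.
Implicit Types (z w : R[i]) (F G : R -> R[i]) (u : nat -> R[i]) (t : R).

Definition chasd F t z : Prop :=
  hasd (fun x => complex.Re (F x)) t (complex.Re z) /\
  hasd (fun x => complex.Im (F x)) t (complex.Im z).

Lemma chasd_eq F t z w : chasd F t z -> z = w -> chasd F t w.
Proof. by move=> ? <-. Qed.

Lemma chasdD F G t z w : chasd F t z -> chasd G t w ->
  chasd (fun x => F x + G x) t (z + w).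
Proof.
move=> [Fr Fi] [Gr Gi]; rewrite /chasd cReD cImD; split.
  by under eq_fun do rewrite cReD; exact: hasdD.
by under eq_fun do rewrite cImD; exact: hasdD.
Qed.

Lemma chasdM F G t z w : chasd F t z -> chasd G t w ->
  chasd (fun x => F x * G x) t (z * G t + F t * w).
Proof.
move=> [Fr Fi] [Gr Gi]; rewrite /chasd cReD cImD !cReM !cImM; split.
  under eq_fun do rewrite cReM.
  by apply: hasd_eq (hasdD (hasdM Fr Gr) (hasdN (hasdM Fi Gi))) _; ring.
under eq_fun do rewrite cImM.
by apply: hasd_eq (hasdD (hasdM Fr Gi) (hasdM Fi Gr)) _; ring.
Qed.

Lemma chasd_cst w t : chasd (fun=> w) t 0.
Proof. by split; exact: hasd_cst. Qed.

Lemma chasd_line z t : chasd (fun x => x%:C * z) t z.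
Proof.
split; under eq_fun do rewrite ?cReM ?cImM /= mul0r ?subr0 ?addr0.
  by apply: hasd_eq (hasdM (hasd_id t) (hasd_cst _ t)) _; rewrite mul1r mulr0 addr0.
by apply: hasd_eq (hasdM (hasd_id t) (hasd_cst _ t)) _; rewrite mul1r mulr0 addr0.
Qed.

Lemma chasdX F t z k : chasd F t z -> chasd (fun x => F x ^+ k) t (k%:R * F t ^+ k.-1 * z).
Proof.
move=> Fz; elim: k => [|k IH]; first by rewrite !mul0r; exact: chasd_cst.
rewrite (_ : (fun x => F x ^+ k.+1) = (fun x => F x * F x ^+ k)); last first.
  by apply/funext => x; rewrite exprS.
apply: chasd_eq (chasdM Fz IH) _.
by case: k {IH} => [|k] /=; rewrite ?expr0 ?exprS -?[k.+2%:R]natr1; ring.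
Qed.

Lemma chasd_cexp F t z : chasd F t z ->
  chasd (fun x => cexp (F x)) t (z * cexp (F t)).
Proof.
move=> [Fr Fi]; rewrite /chasd cReM cImM /cexp; split.
  rewrite (_ : (fun _ => _) = fun x =>
    expR (complex.Re (F x)) * cos (complex.Im (F x))); last first.
    by apply/funext => x; rewrite cReM /= mul0r subr0.
  hasd_by (rewrite ?(cReM, cImM) /=; ring).
rewrite (_ : (fun _ => _) = fun x =>
  expR (complex.Re (F x)) * sin (complex.Im (F x))); last first.
  by apply/funext => x; rewrite cImM /= mul0r addr0.
hasd_by (rewrite ?(cReM, cImM) /=; ring).
Qed.

Lemma normc_cexp z : Normc.normc (cexp z) = expR (complex.Re z).
Proof.
rewrite /cexp Normc.normcM normc_real ger0_norm ?expR_ge0//.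
by rewrite /Normc.normc cos2Dsin2 sqrtr1 mulr1.
Qed.

Lemma normc_exp z k : Normc.normc (z ^+ k) = Normc.normc z ^+ k.
Proof.
elim: k => [|k IH]; first by rewrite /Normc.normc /= expr0n addr0 expr1n sqrtr1.
by rewrite !exprS Normc.normcM IH.
Qed.

Definition exp_sum z N : R[i] := \sum_(k < N) (k`!%:R)^-1 * z ^+ k.

Lemma chasd_exp_sum z N t :
  chasd (fun x => exp_sum (x%:C * z) N.+1) t (z * exp_sum (t%:C * z) N).
Proof.
elim: N => [|N IH].
  rewrite /exp_sum big_ord0 mulr0; under eq_fun do rewrite big_ord1 expr0.
  exact: chasd_cst.
rewrite {2}/exp_sum; under eq_fun do rewrite /exp_sum big_ord_recr -/(exp_sum _ N.+1) /=.
have := chasdM (chasd_cst (N.+1`!%:R)^-1 t) (chasdX N.+1 (chasd_line z t)).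
move=> /(chasdD IH); move/chasd_eq; apply.
rewrite {1}/exp_sum big_ord_recr /= mul0r add0r mulrDr; congr (_ + _).
have n0 : N.+1%:R != 0 :> R[i] by rewrite pnatr_eq0.
have fE : (N.+1`!%:R)^-1 * N.+1%:R = (N`!%:R)^-1 :> R[i].
  by rewrite factS natrM invfM mulrAC mulVf// mul1r.
have shape (x y v w : R[i]) : x * (y * v * w) = w * (x * y * v) by ring.
by rewrite shape fE.
Qed.

(** The derivative of e^(- t z) S_(N+1)(t z) in t is - z e^(- t z) (t z)^N / N!,
    which is small on [0, 1]; at t = 0 the value is 1. *)
Lemma exp_sum_remainder z N :
  let c := Normc.normc z * expR (Normc.normc z) * exp_coeff (Normc.normc z) N in
  `|complex.Re (cexp (- z) * exp_sum z N.+1) - 1| <= c /\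
  `|complex.Im (cexp (- z) * exp_sum z N.+1)| <= c.
Proof.
move=> c.
pose h t := cexp (t%:C * - z) * exp_sum (t%:C * z) N.+1.
pose h' t := - (z * cexp (t%:C * - z) * ((N`!%:R)^-1 * (t%:C * z) ^+ N)).
have dh t : chasd h t (h' t).
  apply: chasd_eq (chasdM (chasd_cexp (chasd_line (- z) t)) (chasd_exp_sum z N t)) _.
  by rewrite /h' {1}/exp_sum big_ord_recr -/(exp_sum _ N) /=; ring.
have h0 : h 0 = 1.
  rewrite /h !mul0r cexp0 mul1r /exp_sum big_ord_recl expr0 fact0 invr1 mulr1.
  by rewrite big1 ?addr0// => k _; rewrite expr0n mulr0.
have h1 : h 1 = cexp (- z) * exp_sum z N.+1 by rewrite /h !mul1r.
have hb t : 0 <= t <= 1 -> Normc.normc (h' t) <= c.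
  move=> /andP[t0 t1]; rewrite /h' -mulNr -mulNr Normc.normcM [X in X * _]Normc.normcM.
  rewrite normc_cexp Normc.normcM Normc.normcV.
  rewrite normc_exp Normc.normcM normc_real ger0_norm//.
  have -> : Normc.normc (- z) = Normc.normc z.
    by case: z {c h h' dh h0 h1} => a b; rewrite /= !sqrrN.
  have -> : Normc.normc (N`!%:R : R[i]) = N`!%:R.
    by rewrite -[N`!%:R](rmorph_nat (real_complex R)) normc_real ger0_norm.
  rewrite /c /exp_coeff /= -!mulrA ler_wpM2l ?normc_ge0//.
  apply: ler_pM; rewrite ?expR_ge0 ?mulr_ge0 ?invr_ge0 ?exprn_ge0 ?mulr_ge0 ?normc_ge0//.
    rewrite ler_expR cReM /= mul0r subr0 cReN mulrN (le_trans (ler_norm _))// normrN.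
    rewrite normrM ger0_norm// (le_trans _ (ler_Re_normc z))// ler_piMl//.
  rewrite mulrC ler_wpM2r ?invr_ge0// lerXn2r ?nnegrE ?mulr_ge0 ?normc_ge0//.
  by rewrite ler_piMl ?normc_ge0.
have mvt (f : R -> R) (f' : R -> R) : (forall t, hasd f t (f' t)) ->
    (forall t, 0 <= t <= 1 -> `|f' t| <= c) -> `|f 1 - f 0| <= c.
  move=> df bf; have cf : continuous f.
    by apply: hasd_continuous => t; exists (f' t).
  have [t] := MVT (@ltr01 R) (fun t _ => df t) (continuous_subspaceT cf).
  rewrite in_itv /= => /andP[t0 t1] ->; rewrite subr0 mulr1; apply: bf.
  by rewrite !ltW.
have br t : 0 <= t <= 1 -> `|complex.Re (h' t)| <= c.
  by move=> t01; exact: le_trans (ler_Re_normc _) (hb _ t01).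
have bi t : 0 <= t <= 1 -> `|complex.Im (h' t)| <= c.
  by move=> t01; exact: le_trans (ler_Im_normc _) (hb _ t01).
have hr := mvt _ _ (fun t => (dh t).1) br.
have hi := mvt _ _ (fun t => (dh t).2) bi.
rewrite -h1; split; first by move: hr; rewrite h0.
by move: hi; rewrite h0 subr0.
Qed.

Definition ccvg u z : Prop :=
  (fun N => complex.Re (u N)) @ \oo --> complex.Re z /\
  (fun N => complex.Im (u N)) @ \oo --> complex.Im z.

Lemma ccvg_clim u z : ccvg u z -> clim u = z.
Proof.
move=> [ur ui]; apply: complexP; rewrite /clim /=.
  exact: (cvg_lim (@norm_hausdorff _ _) ur).
exact: (cvg_lim (@norm_hausdorff _ _) ui).
Qed.

Lemma ccvg_cst z : ccvg (fun=> z) z.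
Proof. by split; exact: cvg_cst. Qed.

Lemma ccvgD u v z w : ccvg u z -> ccvg v w -> ccvg (fun N => u N + v N) (z + w).
Proof.
move=> [ur ui] [vr vi]; rewrite /ccvg cReD cImD; split.
  by under eq_fun do rewrite cReD; exact: cvgD.
by under eq_fun do rewrite cImD; exact: cvgD.
Qed.

Lemma ccvgM u v z w : ccvg u z -> ccvg v w -> ccvg (fun N => u N * v N) (z * w).
Proof.
move=> [ur ui] [vr vi]; rewrite /ccvg cReM cImM; split.
  by under eq_fun do rewrite cReM; apply: cvgB; exact: cvgM.
by under eq_fun do rewrite cImM; apply: cvgD; exact: cvgM.
Qed.

Lemma ccvg_exp_sum z : ccvg (exp_sum z) (cexp z).
Proof.
pose v N := cexp (- z) * exp_sum z N.+1.
pose c N := Normc.normc z * expR (Normc.normc z) * exp_coeff (Normc.normc z) N.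
have c0 : c @ \oo --> (0 : R).
  rewrite -[0](mulr0 (Normc.normc z * expR (Normc.normc z))); apply: cvgM.
    exact: cvg_cst.
  by apply: cvg_series_cvg_0; exact: is_cvg_series_exp_coeff.
have v1 : ccvg v 1.
  have sq (f : nat -> R) (l : R) : (forall N, `|f N - l| <= c N) -> f @ \oo --> l.
    move=> H; apply/cvgrPdist_lt => e e0.
    move/cvgr0_norm_lt : c0 => /(_ _ e0); apply: filterS => N /=.
    by rewrite distrC; apply: le_lt_trans; rewrite (le_trans (H N))// ler_norm.
  split; apply: sq => N; first by have [] := exp_sum_remainder z N.
  by rewrite subr0; have [] := exp_sum_remainder z N.
have : ccvg (fun N => exp_sum z N.+1) (cexp z).
  have := ccvgM (ccvg_cst (cexp z)) v1; rewrite mulr1; congr ccvg.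
  by apply/funext => N; rewrite /v mulrA -cexpD subrr cexp0 mul1r.
move=> [hr hi]; split; [rewrite -(cvg_shiftS (fun N => complex.Re (exp_sum z N)))
  |rewrite -(cvg_shiftS (fun N => complex.Im (exp_sum z N)))]; [exact: hr|exact: hi].
Qed.

End ComplexExponential.

Section Idempotents.
Variables (K : fieldType) (A : algType K).
Implicit Types (e f J : A) (z w : K).

Lemma idempotents_exp e f z w k : e + f = 1 -> e * e = e -> f * f = f ->
  e * f = 0 -> f * e = 0 -> (z *: e + w *: f) ^+ k = z ^+ k *: e + w ^+ k *: f.
Proof.
move=> ef1 ee ff ef fe; elim: k => [|k IH]; first by rewrite !expr0 !scale1r.
rewrite exprS IH mulrDl !mulrDr -!scalerAl -!scalerAr !scalerA ee ff ef fe.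
by rewrite !scaler0 addr0 add0r !exprS.
Qed.

Variables (i : K) (J : A).
Hypotheses (two_neq0 : (2 : K) != 0) (i2 : i * i = -1) (J2 : J * J = -1).

Definition idem_plus : A := 2^-1 *: (1 + i *: J).
Definition idem_minus : A := 2^-1 *: (1 - i *: J).

Let L2 : (i *: J) * (i *: J) = 1.
Proof. by rewrite -scalerAl -scalerAr scalerA i2 J2 scaleN1r opprK. Qed.

Let half : 2^-1 + 2^-1 = 1 :> K. Proof. by field. Qed.

Let quarter (x : A) : (2^-1 * 2^-1) *: (x + x) = 2^-1 *: x.
Proof. by rewrite scalerDr -scalerDl -mulrDr half mulr1. Qed.

Lemma idemD : idem_plus + idem_minus = 1.
Proof. by rewrite -scalerDr addrACA subrr addr0 scalerDr -scalerDl half scale1r. Qed.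

Lemma idem_plusM : idem_plus * idem_plus = idem_plus.
Proof.
rewrite /idem_plus; move: (i *: J) L2 => L LL.
rewrite -scalerAl -scalerAr scalerA mulrDl mul1r mulrDr mulr1 LL.
by rewrite [L + 1]addrC quarter.
Qed.

Lemma idem_minusM : idem_minus * idem_minus = idem_minus.
Proof.
rewrite /idem_minus; move: (i *: J) L2 => L LL.
rewrite -scalerAl -scalerAr scalerA mulrBl mul1r mulrBr mulr1 LL.
by rewrite opprB addrA -quarter; congr (_ *: _); rewrite addrA.
Qed.

Lemma idem_plus_minus : idem_plus * idem_minus = 0.
Proof.
rewrite /idem_minus /idem_plus; move: (i *: J) L2 => L LL.
rewrite -scalerAl -scalerAr mulrDl mul1r mulrBr mulr1 LL.
by rewrite addrA subrK subrr !scaler0.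
Qed.

Lemma idem_minus_plus : idem_minus * idem_plus = 0.
Proof.
rewrite /idem_minus /idem_plus; move: (i *: J) L2 => L LL.
rewrite -scalerAl -scalerAr mulrBl mul1r mulrDr mulr1 LL.
by rewrite [L + 1]addrC subrr !scaler0.
Qed.

Lemma idem_combine z w : z *: idem_plus + w *: idem_minus =
  (2^-1 * (z + w))%:A + J * (i / 2 * (z - w))%:A.
Proof.
rewrite -scalerAr mulr1 /idem_plus /idem_minus !scalerDr !scalerN !scalerA.
rewrite -!scaleNr addrACA -!scalerDl.
by congr (_ *: _ + _ *: _); field.
Qed.

Lemma idem_split z (u v : K) : z *: (u%:A + v *: J) =
  (z * (u - i * v)) *: idem_plus + (z * (u + i * v)) *: idem_minus.
Proof.
rewrite idem_combine -scalerAr mulr1 scalerDr !scalerA.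
congr (_ *: _ + _ *: _); first by field.
have -> : i / 2 * (z * (u - i * v) - z * (u + i * v)) = - (i * i) * (z * v).
  by field.
by rewrite i2 opprK mul1r.
Qed.

End Idempotents.

Section CliffordExponential.
Variables (R : realType) (n : nat).
Local Notation Cl := (cliff R[i] n).
Implicit Types (J : Cl) (z : R[i]).

Lemma cliff_combE (x y : R[i]) (e f : Cl) A : (x *: e + y *: f) A = x * e A + y * f A.
Proof. by rewrite ffunE; congr (_ + _); rewrite ffunE. Qed.

Lemma exp_partial_sum (b e f : Cl) (x y : R[i]) N A :
  (forall k, b ^+ k = x ^+ k *: e + y ^+ k *: f) ->
  (\sum_(k < N) (k`!%:R)^-1 *: b ^+ k : Cl) A = exp_sum x N * e A + exp_sum y N * f A.
Proof.
move=> H; rewrite -cliff_combE /exp_sum !scaler_suml -big_split /=.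
congr (fun_of_fin _ A); apply: eq_bigr => k _.
by rewrite H scalerDr !scalerA.
Qed.

Lemma cliff_exp_split (b e f : Cl) (x y : R[i]) :
  (forall k, b ^+ k = x ^+ k *: e + y ^+ k *: f) ->
  cliff_exp b = cexp x *: e + cexp y *: f.
Proof.
move=> H; apply/ffunP => A; rewrite cliff_combE [LHS]ffunE; apply: ccvg_clim.
rewrite (_ : (fun _ => _) = fun N => exp_sum x N * e A + exp_sum y N * f A).
  by apply: ccvgD; apply: ccvgM; by [exact: ccvg_exp_sum|exact: ccvg_cst].
by apply/funext => N; exact: exp_partial_sum.
Qed.

(** (1 + iJ) / 2 and (1 - iJ) / 2 are complementary orthogonal idempotents when
    J^2 = -1, and u + v J = (u - i v) (1 + iJ) / 2 + (u + i v) (1 - iJ) / 2.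
    Therefore powers, and hence the exponential, of such elements reduce to
    those of two complex numbers. *)
Lemma cliff_exp_unit J z (u v : R[i]) : J * J = - 1 ->
  cliff_exp (z *: (u%:A + v *: J)) =
  (2^-1 * (cexp (z * (u - 'i * v)) + cexp (z * (u + 'i * v))))%:A +
  J * ('i / 2 * (cexp (z * (u - 'i * v)) - cexp (z * (u + 'i * v))))%:A.
Proof.
move=> JJ; have i2 : 'i * 'i = -1 :> R[i] by rewrite -expr2 sqr_i.
have two0 : (2 : R[i]) != 0 by rewrite pnatr_eq0.
rewrite (idem_split J two0 i2) -(idem_combine 'i J two0).
set a := z * _; set b := z * _.
apply: cliff_exp_split => k.
exact: (idempotents_exp a b k (idemD 'i J two0) (idem_plusM two0 i2 JJ)
  (idem_minusM two0 i2 JJ) (idem_plus_minus i2 JJ) (idem_minus_plus i2 JJ)).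
Qed.

End CliffordExponential.

(** * Slice monogenicity of the exponential *)

Section ScaledExtensions.
Variables (K : comNzRingType) (A : algType K).
Implicit Types (k x y : K) (q J : A).

Lemma scale_left_factor k q x y J :
  k *: (q * (x%:A + J * y%:A)) = x *: (k *: q) + (y *: (k *: q)) * J.
Proof.
rewrite mulrDr scalerDr -!scalerAr !mulr1 -!scalerAl !scalerA.
by rewrite [k * x]mulrC [k * y]mulrC.
Qed.

Lemma scale_right_factor k q x y J :
  k *: ((x%:A + J * y%:A) * q) = x *: (k *: q) + J * (y *: (k *: q)).
Proof.
rewrite mulrDl scalerDr -!scalerAr !mulr1 -!scalerAl mul1r !scalerA.
by rewrite [k * x]mulrC [k * y]mulrC.
Qed.

Lemma scalar_central k x q : k *: (x%:A * q) = k *: (q * x%:A).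
Proof. by rewrite -scalerAl -scalerAr mul1r mulr1. Qed.

End ScaledExtensions.

Section PlaneFunctions.
Variable R : realType.
Local Notation P := (R^o * R^o)%type.
Implicit Types (F G : P -> R).

Definition c1 F (Fu Fv : P -> R) : Prop :=
  [/\ forall p, differentiable (F : P -> R^o) p,
      forall p, 'D_((1, 0) : P) (F : P -> R^o) p = Fu p,
      forall p, 'D_((0, 1) : P) (F : P -> R^o) p = Fv p &
      continuous Fu /\ continuous Fv].

Lemma c1_rC1 F Fu Fv : c1 F Fu Fv -> rC1 setT F.
Proof.
move=> [dF Du Dv [cu cv]]; split=> p _; first exact: dF.
  by rewrite (_ : (fun q => _) = Fu); [exact: cu|exact/funext].
by rewrite (_ : (fun q => _) = Fv); [exact: cv|exact/funext].
Qed.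

Lemma c1_comb (x y : R) F Fu Fv G Gu Gv : c1 F Fu Fv -> c1 G Gu Gv ->
  c1 (fun p => x * F p + y * G p) (fun p => x * Fu p + y * Gu p)
     (fun p => x * Fv p + y * Gv p).
Proof.
move=> [dF Fu1 Fv1 [cFu cFv]] [dG Gu1 Gv1 [cGu cGv]].
have dC z (H : P -> R) p : differentiable (H : P -> R^o) p ->
    differentiable (fun p => z * H p : R^o) p by exact: differentiableZ.
have D d p : 'D_d (fun p => x * F p + y * G p : R^o) p =
    x * 'D_d (F : P -> R^o) p + y * 'D_d (G : P -> R^o) p.
  have dxF := diff_derivable (v := d) (dC x F p (dF p)).
  have dyG := diff_derivable (v := d) (dC y G p (dG p)).
  rewrite [LHS](deriveD dxF dyG) [X in X + _](deriveZ x (diff_derivable (v := d) (dF p))).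
  by rewrite [X in _ + X](deriveZ y (diff_derivable (v := d) (dG p))).
split=> [p|p|p|].
- exact: (differentiableD (dC x F p (dF p)) (dC y G p (dG p))).
- by rewrite D Fu1 Gu1.
- by rewrite D Fv1 Gv1.
- by split=> p; apply: cvgD; (apply: cvgM; first exact: cvg_cst);
    by [exact: cFu|exact: cGu|exact: cFv|exact: cGv].
Qed.

Lemma c1_tensor (al al' be be' : R -> R) :
  (forall x, hasd al x (al' x)) -> (forall x, hasd be x (be' x)) ->
  continuous al' -> continuous be' ->
  c1 (fun p => al p.1 * be p.2) (fun p => al' p.1 * be p.2) (fun p => al p.1 * be' p.2).
Proof.
move=> da db ca' cb'.
have ca : continuous al by apply: hasd_continuous => x; exists (al' x).
have cb : continuous be by apply: hasd_continuous => x; exists (be' x).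
have dF p : differentiable (fun p : P => al p.1 * be p.2 : R^o) p.
  apply: differentiableM.
    apply: (@differentiable_comp _ _ _ _ (fun p : P => p.1) (al : R^o -> R^o)).
      apply: (@linear_differentiable R P R^o (@fst R^o R^o)) => q; exact: cvg_fst.
    by apply/derivable1_diffP; exact: hasd_derivable (da _).
  apply: (@differentiable_comp _ _ _ _ (fun p : P => p.2) (be : R^o -> R^o)).
    apply: (@linear_differentiable R P R^o (@snd R^o R^o)) => q; exact: cvg_snd.
  by apply/derivable1_diffP; exact: hasd_derivable (db _).
have D (d p : P) : 'D_d (fun p : P => al p.1 * be p.2 : R^o) p =
    al' p.1 * be p.2 * d.1 + al p.1 * be' p.2 * d.2.
  have := @derivative_line R _ (fun p : P => al p.1 * be p.2) p d 0.
  rewrite scale0r addr0 => /(_ (dF p)) /hasd_derive <-.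
  apply: hasd_derive; rewrite /=.
  have da0 := da (p.1 + 0 * d.1); have db0 := db (p.2 + 0 * d.2).
  have h1 : hasd (fun h => al (p.1 + h * d.1)) 0 (al' (p.1 + 0 * d.1) * d.1).
    by apply: (hasd_comp (f := al)) => //; hasd_by ring.
  have h2 : hasd (fun h => be (p.2 + h * d.2)) 0 (be' (p.2 + 0 * d.2) * d.2).
    by apply: (hasd_comp (f := be)) => //; hasd_by ring.
  by apply: hasd_eq (hasdM h1 h2) _; rewrite !mul0r !addr0; ring.
have c2 (f g : R -> R) : continuous f -> continuous g ->
    continuous (fun p : P => f p.1 * g p.2).
  move=> cf cg p; apply: cvgM.
    by apply: (@continuous_comp _ _ _ (fun p : P => p.1) f); [exact: cvg_fst|exact: cf].
  by apply: (@continuous_comp _ _ _ (fun p : P => p.2) g); [exact: cvg_snd|exact: cg].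
split=> [p|p|p|]; first exact: dF.
- by rewrite D /= mulr1 mulr0 addr0.
- by rewrite D /= mulr0 mulr1 add0r.
- by split; exact: c2.
Qed.

Definition cc1 (G Gu Gv : P -> R[i]) : Prop :=
  c1 (fun p => complex.Re (G p)) (fun p => complex.Re (Gu p)) (fun p => complex.Re (Gv p)) /\
  c1 (fun p => complex.Im (G p)) (fun p => complex.Im (Gu p)) (fun p => complex.Im (Gv p)).

Variable n : nat.
Local Notation V := 'rV[R]_n.+1.
Local Notation Cl := (cliff R[i] n).

Lemma cc1_scale (G Gu Gv : P -> R[i]) (c : Cl) : cc1 G Gu Gv ->
  [/\ clC1 setT (fun p => G p *: c),
      forall p, cl_deriv (1, 0) (fun p => G p *: c) p = Gu p *: c &
      forall p, cl_deriv (0, 1) (fun p => G p *: c) p = Gv p *: c].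
Proof.
move=> [Gr Gi].
have E (z : R[i]) A : (z *: c) A = z * c A by rewrite ffunE.
have sr A : c1 (fun p => complex.Re ((G p *: c) A)) (fun p => complex.Re ((Gu p *: c) A))
    (fun p => complex.Re ((Gv p *: c) A)).
  have := c1_comb (complex.Re (c A)) (- complex.Im (c A)) Gr Gi; congr c1;
    apply/funext => p; by rewrite E cReM; ring.
have si A : c1 (fun p => complex.Im ((G p *: c) A)) (fun p => complex.Im ((Gu p *: c) A))
    (fun p => complex.Im ((Gv p *: c) A)).
  have := c1_comb (complex.Im (c A)) (complex.Re (c A)) Gr Gi; congr c1;
    apply/funext => p; by rewrite E cImM; ring.
split=> [A|p|p].
- by split; [exact: c1_rC1 (sr A)|exact: c1_rC1 (si A)].
- apply/ffunP => A; rewrite [LHS]ffunE; have [_ Du _ _] := sr A.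
  by have [_ Du' _ _] := si A; rewrite Du Du'; case: ((Gu p *: c) A).
- apply/ffunP => A; rewrite [LHS]ffunE; have [_ _ Dv _] := sr A.
  by have [_ _ Dv' _] := si A; rewrite Dv Dv'; case: ((Gv p *: c) A).
Qed.

Lemma slice_pair_scale (g0 g0u g0v g1 g1u g1v : P -> R[i]) (c : Cl) :
  cc1 g0 g0u g0v -> cc1 g1 g1u g1v ->
  (forall p, g0u p = g1v p) -> (forall p, g0v p = - g1u p) ->
  (forall u v, g0 (u, - v) = g0 (u, v)) -> (forall u v, g1 (u, - v) = - g1 (u, v)) ->
  slice_pair setT (fun p => g0 p *: c) (fun p => g1 p *: c).
Proof.
move=> h0 h1 cr1 cr2 even odd.
have [c0 u0 v0] := cc1_scale c h0; have [c1' u1 v1] := cc1_scale c h1.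
split; [exact: c0|exact: c1'|move=> u v _; split].
- by rewrite even.
- by rewrite odd scaleNr.
- by rewrite u0 v1 cr1 subrr.
- by rewrite v0 u1 cr2 scaleNr addNr.
Qed.

End PlaneFunctions.

Section SliceExponential.
Variables (R : realType) (n : nat).
Local Notation V := 'rV[R]_n.+1.
Local Notation Cl := (cliff R[i] n).
Local Notation P := (R^o * R^o)%type.
Variable a : R.

Definition ch (v : R) : R := (expR (a * v) + expR (- (a * v))) / 2.
Definition sh (v : R) : R := (expR (a * v) - expR (- (a * v))) / 2.

(** The real and imaginary parts in I of exp (- i a (u + I v)). *)
Definition exp_pair0 (p : P) : R[i] :=
  cos (a * p.1) * ch p.2 -i* (sin (a * p.1) * ch p.2).
Definition exp_pair1 (p : P) : R[i] :=
  (- (sin (a * p.1) * sh p.2)) -i* (cos (a * p.1) * sh p.2).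

Lemma hasd_ch v : hasd ch v (a * sh v).
Proof. rewrite /ch /sh; hasd_by ring. Qed.

Lemma hasd_sh v : hasd sh v (a * ch v).
Proof. rewrite /ch /sh; hasd_by ring. Qed.

Lemma chN v : ch (- v) = ch v.
Proof. by rewrite /ch mulrN opprK addrC. Qed.

Lemma shN v : sh (- v) = - sh v.
Proof. by rewrite /sh mulrN opprK; ring. Qed.

Lemma exp_pair_slice (c : Cl) :
  slice_pair setT (fun p => exp_pair0 p *: c) (fun p => exp_pair1 p *: c).
Proof.
pose C x := cos (a * x); pose S x := sin (a * x).
have dC x : hasd C x (- a * S x) by rewrite /C /S; hasd_by ring.
have dS x : hasd S x (a * C x) by rewrite /C /S; hasd_by ring.
have cont (f f' : R -> R) k : (forall x, hasd f x (f' x)) -> continuous (fun x => k * f x).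
  move=> df x; apply: cvgM; first exact: cvg_cst.
  by apply: hasd_continuous => y; exists (f' y).
have t (al al' be be' : R -> R) (k l : R) : (forall x, hasd al x (k * al' x)) ->
    (forall x, hasd be x (l * be' x)) -> continuous (fun x => k * al' x) ->
    continuous (fun x => l * be' x) -> forall s : R,
    c1 (fun p => s * (al p.1 * be p.2)) (fun p => s * k * (al' p.1 * be p.2))
       (fun p => s * l * (al p.1 * be' p.2)).
  move=> da db ca cb s.
  have h := c1_tensor da db ca cb.
  have := c1_comb s 0 h h; congr c1; apply/funext => p; ring.
have tC := t C S ch sh (- a) a dC hasd_ch (cont _ _ _ dS) (cont _ _ _ hasd_sh).
have tS := t S C ch sh a a dS hasd_ch (cont _ _ _ dC) (cont _ _ _ hasd_sh).
have tC' := t C S sh ch (- a) a dC hasd_sh (cont _ _ _ dS) (cont _ _ _ hasd_ch).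
have tS' := t S C sh ch a a dS hasd_sh (cont _ _ _ dC) (cont _ _ _ hasd_ch).
apply: (@slice_pair_scale _ _ exp_pair0
  (fun p => (- a * (S p.1 * ch p.2)) -i* (a * (C p.1 * ch p.2)))
  (fun p => (a * (C p.1 * sh p.2)) -i* (a * (S p.1 * sh p.2)))
  exp_pair1
  (fun p => (- a * (C p.1 * sh p.2)) +i* (a * (S p.1 * sh p.2)))
  (fun p => (- a * (S p.1 * ch p.2)) -i* (a * (C p.1 * ch p.2))) c).
- split; [have := tC 1|have := tS (-1)]; congr c1; apply/funext => p;
    rewrite /exp_pair0 /=; rewrite /C /S; ring.
- split; [have := tS' (-1)|have := tC' (-1)]; congr c1; apply/funext => p;
    rewrite /exp_pair1 /=; rewrite /C /S; ring.
- by [].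
- by move=> p; apply: complexP; rewrite /=; ring.
- by move=> u v; rewrite /exp_pair0 /= chN.
- by move=> u v; rewrite /exp_pair1 /= shN; apply: complexP; rewrite /=; ring.
Qed.

Lemma pv_unit_sqr (I : 'rV[R]_n) : unit_sphere I ->
  pv (paravec 0 I) * pv (paravec 0 I) = -1 :> Cl.
Proof.
move=> I1; rewrite /pv spart_paravec vpart_paravec scale0r add0r -expr2 cliff_vec_sqr.
by rewrite (I1 : enorm I = 1) expr1n scale1r.
Qed.

Lemma pv_slice (u v : R) (I : 'rV[R]_n) :
  pv (paravec u (v *: I)) = u%:C%:A + v%:C *: pv (paravec 0 I) :> Cl.
Proof.
rewrite /pv !spart_paravec !vpart_paravec scale0r add0r scaler_sumr; congr (_ + _).
by apply: eq_bigr => l _; rewrite mxE rmorphM scalerA.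
Qed.

Lemma cliff_exp_slice (u v : R) (I : 'rV[R]_n) : unit_sphere I ->
  cliff_exp ((- 'i * a%:C) *: pv (paravec u (v *: I))) =
  (exp_pair0 (u, v))%:A + pv (paravec 0 I) * (exp_pair1 (u, v))%:A :> Cl.
Proof.
move=> I1; rewrite pv_slice cliff_exp_unit; last exact: pv_unit_sqr.
have E (b : R) : cexp (- 'i * a%:C * (u%:C + 'i * b%:C)) =
    (expR (a * b))%:C * (cos (a * u) -i* sin (a * u)).
  have -> : - 'i * a%:C * (u%:C + 'i * b%:C) = (a * b) -i* (a * u) :> R[i].
    by apply: complexP; rewrite !(cReM, cImM, cReD, cImD, cReN, cImN) /=; ring.
  by rewrite /cexp /= cosN sinN.
have E1 := E v; have E2 : cexp (- 'i * a%:C * (u%:C - 'i * v%:C)) =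
    (expR (- (a * v)))%:C * (cos (a * u) -i* sin (a * u)).
  by have := E (- v); rewrite rmorphN !mulrN.
have h2 : (2^-1 : R[i]) = (2^-1)%:C by rewrite fmorphV rmorph_nat.
have e0 (x y c s : R) : 2^-1 * (y%:C * (c -i* s) + x%:C * (c -i* s)) =
    (c * ((x + y) / 2)) -i* (s * ((x + y) / 2)).
  by rewrite h2; apply: complexP; rewrite /=; field.
have e1 (x y c s : R) : 'i / 2 * (y%:C * (c -i* s) - x%:C * (c -i* s)) =
    (- (s * ((x - y) / 2))) -i* (c * ((x - y) / 2)).
  by rewrite h2; apply: complexP; rewrite /=; field.
by rewrite E1 E2 e0 e1.
Qed.

Lemma cliff_exp_real (s : R) : (0 < n)%N ->
  cliff_exp ((- 'i * a%:C) *: pv (real_pv n s)) =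
  (cexp (- 'i * s%:C * a%:C))%:A :> Cl.
Proof.
move=> /unit_sphere_nonempty - /(_ R)[I I1].
have -> : real_pv n s = paravec s (0 *: I) by rewrite scale0r.
rewrite cliff_exp_slice// /exp_pair0 /exp_pair1 /ch /sh !mulr0 oppr0 expR0 subrr.
rewrite !mul0r !mulr0 oppr0 -mulrA -rmorphM cexp_Ni [a * s]mulrC.
have -> : (1 + 1) / 2 = 1 :> R by field.

by rewrite !mulr1 scale0r mulr0 addr0.
Qed.

End SliceExponential.

(** * The Fourier transforms of the kernels *)

Theorem theorem4p2 (R : realType) (n : nat) (n_ge1 : (1 <= n)%N) :
  let k : R[i] :=
    'i * 'i ^+ n.-1 *
    (2 ^+ n * pi `^ (n.+1%:R / 2) * Gamma (n.+1%:R / 2 : R))%:C in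
  let q (xi : 'rV[R]_n.+1) : cliff R[i] n :=
    ((spart xi ^+ 2 + enorm (vpart xi) ^+ 2)^-1)%:C *: pv (pconj xi) in
  let Fhat (s : R) (xi : 'rV[R]_n.+1) : cliff R[i] n :=
    k *: (q xi * (cexp (- 'i * s%:C * (spart xi)%:C))%:A) in
  let E (xi s : 'rV[R]_n.+1) : cliff R[i] n :=
    cliff_exp ((- 'i * (spart xi)%:C) *: pv s) in
  (forall s : R, is_fourier_transform (@Fn R n s) (Fhat s)) /\
  (forall xi : 'rV[R]_n.+1, xi != 0 ->
    [/\ unique
          (fun h => intrinsic_slice_monogenic setT h /\
             extends_from_reals
               (fun s0 : R => (cexp (- 'i * s0%:C * (spart xi)%:C))%:A) h)
          (E xi),
        unique
          (extended_fourier_transform (@right_slice_monogenic R n)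
             (@FL R n) Fhat xi)
          (fun s => k *: (q xi * E xi s)) &
        unique
          (extended_fourier_transform (@left_slice_monogenic R n)
             (@FR R n) Fhat xi)
          (fun s => k *: (E xi s * q xi))]).
Proof.
move=> k q Fhat E.
have openT : open [set: 'rV[R]_n.+1] by exact: openT.
have symT : axially_symmetric [set: 'rV[R]_n.+1] by [].
have part1 (s : R) : is_fourier_transform (@Fn R n s) (Fhat s).
  exact: (Fn_fourier n_ge1 s (gamma_dual_constant R n_ge1)).
split=> [//|xi _].
pose a := spart xi.
have EI (u v : R) (I : 'rV[R]_n) : unit_sphere I -> E xi (paravec u (v *: I)) =
    (exp_pair0 a (u, v))%:A + pv (paravec 0 I) * (exp_pair1 a (u, v))%:A.
  by move=> I1; exact: cliff_exp_slice.
have Ereal (s : R) : E xi (real_pv n s) = (cexp (- 'i * s%:C * (spart xi)%:C))%:A.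
  exact: cliff_exp_real.
have slE (c : cliff R[i] n) : slice_pair (slice_domain [set: 'rV[R]_n.+1])
    (fun p => exp_pair0 a p *: c) (fun p => exp_pair1 a p *: c).
  by rewrite slice_domainT; exact: exp_pair_slice.
have intrE : intrinsic_slice_monogenic setT (E xi).
  by split=> //; exists (exp_pair0 a), (exp_pair1 a); split=> // u v I I1 _; exact: EI.
have rightE : right_slice_monogenic setT (fun s => k *: (q xi * E xi s)).
  split=> //; exists (fun p => exp_pair0 a p *: (k *: q xi)),
    (fun p => exp_pair1 a p *: (k *: q xi)); split=> // u v I I1 _.
  rewrite (EI u v I I1); exact: scale_left_factor.
have leftE : left_slice_monogenic setT (fun s => k *: (E xi s * q xi)).
  split=> //; exists (fun p => exp_pair0 a p *: (k *: q xi)),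
    (fun p => exp_pair1 a p *: (k *: q xi)); split=> // u v I I1 _.
  rewrite (EI u v I I1); exact: scale_right_factor.
have rightR (s : R) : k *: (q xi * E xi (real_pv n s)) = Fhat s xi.
  exact: (congr1 (fun z => k *: (q xi * z)) (Ereal s)).
have leftR (s : R) : k *: (E xi (real_pv n s) * q xi) = Fhat s xi.
  rewrite Ereal; exact: scalar_central.
split; split.
- by split; [exact: intrE|exact: Ereal].
- move=> h [hI hr]; apply: (left_slice_unique n_ge1 (intrinsic_left intrE)
    (intrinsic_left hI)) => s.
  exact: etrans (Ereal s) (esym (hr s)).
- by split; [move=> s; rewrite FL_eq_Fn; exact: part1|exact: rightE|exact: rightR].
- move=> h [_ hR hr]; apply: (right_slice_unique n_ge1 rightE hR) => s.
  exact: etrans (rightR s) (esym (hr s)).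
- by split; [move=> s; rewrite FR_eq_Fn; exact: part1|exact: leftE|exact: leftR].
- move=> h [_ hL hr]; apply: (left_slice_unique n_ge1 leftE hL) => s.
  exact: etrans (leftR s) (esym (hr s)).
Qed.
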